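(* Let $a<b$ be real numbers and let $n,r,m$ be integers with $n\geq r\geq 1$ and $m\geq 1$. Let $A_{r-l}\in (C^{(n-r)})^{m\times m}$ for $1\leq l\leq r$, and let $B:(C^{(n)})^{m}\to\mathbb{C}^{rm}$ be a continuous linear operator. Assume that the boundary-value problem $$y^{(r)}(t)+\sum_{l=1}^{r}A_{r-l}(t)y^{(r-l)}(t)=f(t)\ \ (a\leq t\leq b),\qquad By=q,$$ has a unique solution $y\in(C^{(n)})^{m}$ for every $f\in(C^{(n-r)})^{m}$ and every $q\in\mathbb{C}^{rm}$. Let $\mathcal{X}$ be a dense subset of $(C^{(n-r)})^{m\times m}$. Then there exist, for each integer $k\geq 1$, matrix-valued functions $A_{r-l,k}\in\mathcal{X}$ ($1\leq l\leq r$), a number $p_k\in\mathbb{N}$, points $t_{k,j}\in[a,b]$ ($1\leq j\leq p_k$), and matrices $\beta_k^{j,l}\in\mathbb{C}^{rm\times m}$ ($1\leq j\leq p_k$, $0\leq l\leq n$), all chosen independently of $f$ and $q$, such that the following holds. Consider the multipoint boundary-value problems $$y_k^{(r)}(t)+\sum_{l=1}^{r}A_{r-l,k}(t)y_k^{(r-l)}(t)=f(t)\ \ (a\leq t\leq b),\qquad \sum_{j=1}^{p_k}\sum_{l=0}^{n}\beta_k^{j,l}\,y_k^{(l)}(t_{k,j})=q,$$ with unknown $y_k\in(C^{(n)})^{m}$. Then there is $k_0$ such that for every $k\geq k_0$ these problems have a unique solution $y_k\in(C^{(n)})^m$ for every $f\in(C^{(n-r)})^{m}$ and $q\in\mathbb{C}^{rm}$,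 and for all $f\in(C^{(n-r)})^{m}$, $q\in\mathbb{C}^{rm}$ one has $y_k\to y$ in $(C^{(n)})^{m}$ as $k\to\infty$, where $y$ is the solution of the original problem with the same $f$ and $q$.
   Context: For an integer $l\geq 0$, $C^{(l)}=C^{(l)}([a,b],\mathbb{C})$ is the Banach space of $l$ times continuously differentiable complex-valued functions on $[a,b]$ with norm $\|x\|_{(l)}=\sum_{j=0}^{l}\max_{a\leq t\leq b}|x^{(j)}(t)|$. $(C^{(l)})^{m}$ and $(C^{(l)})^{m\times m}$ denote the Banach spaces of $\mathbb{C}^m$-valued, respectively $\mathbb{C}^{m\times m}$-valued, functions on $[a,b]$ whose components all lie in $C^{(l)}$, normed by the sum of the $\|\cdot\|_{(l)}$-norms of the components. *)

(* Defs.v *)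
From Stdlib Require Import Reals Lra Lia ClassicalEpsilon.
From Coquelicot Require Import Coquelicot.
Open Scope R_scope.

(* Functions on [a,b] are represented by maps R -> C (values outside [a,b]
   are irrelevant).  Vectors in C^m / matrices in C^(m x m) of functions are
   represented by maps indexed by nat (only indices < m are relevant). *)
Definition vfun := nat -> R -> C.
Definition mfun := nat -> nat -> R -> C.

Fixpoint csum (N : nat) (g : nat -> C) : C :=
  match N with O => RtoC 0 | S N' => Cplus (csum N' g) (g N') end.
Fixpoint rsum (N : nat) (g : nat -> R) : R :=
  match N with O => 0 | S N' => rsum N' g + g N' end.

Definition is_deriv_ab (a b : R) (g : R -> C) (t : R) (d : C) : Prop :=
  forall eps, 0 < eps -> exists delta, 0 < delta /\
    forall s, a <= s <= b -> Rabs (s - t) < delta ->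
      Cmod (Cminus (Cminus (g s) (g t)) (Cmult (RtoC (s - t)) d)) <= eps * Rabs (s - t).

Definition cont_ab (a b : R) (g : R -> C) : Prop :=
  forall t, a <= t <= b -> forall eps, 0 < eps -> exists delta, 0 < delta /\
    forall s, a <= s <= b -> Rabs (s - t) < delta -> Cmod (Cminus (g s) (g t)) < eps.

(* the derivative (chosen; unique on [a,b] when a < b and it exists) *)
Definition deriv_ab (a b : R) (g : R -> C) : R -> C :=
  fun t => epsilon (inhabits (RtoC 0)) (fun d => is_deriv_ab a b g t d).

Definition nder (a b : R) (j : nat) (g : R -> C) : R -> C :=
  Nat.iter j (deriv_ab a b) g.

Definition isCl (a b : R) (l : nat) (g : R -> C) : Prop :=
  (forall j, (j < l)%nat -> forall t, a <= t <= b ->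
      is_deriv_ab a b (nder a b j g) t (nder a b (S j) g t)) /\
  cont_ab a b (nder a b l g).

Definition isClVec (a b : R) (l m : nat) (y : vfun) : Prop :=
  forall i, (i < m)%nat -> isCl a b l (y i).
Definition isClMat (a b : R) (l m : nat) (M : mfun) : Prop :=
  forall i j, (i < m)%nat -> (j < m)%nat -> isCl a b l (M i j).

Definition supnorm (a b : R) (g : R -> C) : R :=
  real (Lub_Rbar (fun v => exists t, a <= t <= b /\ v = Cmod (g t))).

Definition normCl (a b : R) (l : nat) (g : R -> C) : R :=
  rsum (S l) (fun j => supnorm a b (nder a b j g)).
Definition normClVec (a b : R) (l m : nat) (y : vfun) : R :=
  rsum m (fun i => normCl a b l (y i)).
Definition normClMat (a b : R) (l m : nat) (M : mfun) : R :=
  rsum m (fun i => rsum m (fun j => normCl a b l (M i j))).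

Definition vsub (y z : vfun) : vfun := fun i t => Cminus (y i t) (z i t).
Definition msub (M N : mfun) : mfun := fun i j t => Cminus (M i j t) (N i j t).
Definition vlin (y : vfun) (c : C) (z : vfun) : vfun :=
  fun i t => Cplus (y i t) (Cmult c (z i t)).

Definition ode_lhs (a b : R) (r m : nat) (A : nat -> mfun) (y : vfun)
    (i : nat) (t : R) : C :=
  Cplus (nder a b r (y i) t)
    (csum r (fun l' => let l := S l' in
       csum m (fun s => Cmult (A (r - l)%nat i s t) (nder a b (r - l) (y s) t)))).

Definition solves_ode (a b : R) (r m : nat) (A : nat -> mfun) (f y : vfun) : Prop :=
  forall i, (i < m)%nat -> forall t, a <= t <= b -> ode_lhs a b r m A y i t = f i t.

(* Main.v *)
(* Write T y = (L y, B y) for the differential operator and the boundary operator. If all Cauchy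
   data of y at a vanish, Gronwall's inequality and repeated differentiation of the equation give
   ||y||_n <= C ||L y||_{n-r}. The kernel of L has the basis of solutions with L h = 0, B h = e_k;
   by linear algebra the Cauchy data of any y can be cancelled by a kernel element, whence
   ||y|| <= K (||L y|| + |B y|).

   Put B_k = B o P_k, where P_k y is the Taylor polynomial of degree n-1 of y at a plus the n-fold
   integral of the piecewise linear interpolant of y^(n) on a uniform grid with k steps. These B_k
   are multipoint functionals, uniformly bounded and strongly convergent to B. Let L_k -> L in
   norm and T_k = (L_k, B_k). As B_k converges only strongly, (T - T_k) T^{-1} is not small in the
   usual norm of the data (f, q). But its boundary component is bounded in f and, the kernel of L
   being finite-dimensional, small in q, so in the norm lam ||f|| + |q| with a large fixed lam
   the operator has norm at most 1/2 for all large k. A Neumann series then inverts T_k, with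
   bounds independent of k, and y_k - y is controlled by T_k (y_k - y) = (T - T_k) y -> 0. *)

Require Import Defs.
From Stdlib Require Import Reals.
From Stdlib Require Import Lra Lia ClassicalEpsilon FunctionalExtensionality PropExtensionality.
From Coquelicot Require Import Coquelicot.
Open Scope R_scope.

(** The obstacle is real: if a component of B is y^(n)(c) with c off the grids, then B_k - B stays
    bounded away from 0 in norm however fine the grid. The cure is to split y = u + w, where w lies
    in the kernel of L and has the boundary values of y, so that B u = 0. Write F and Q for the
    norms of L y and B y. The boundary defect is at most D K F on u, where D bounds B - B_k for all
    k, and eventually at most Q/4 on w, because only finitely many basis functions have to be
    approximated. Taking lam = 4 D K + 1 gives D K F <= lam F / 4. Since lam is fixed before k, the
    convergence L_k -> L still makes lam times the defect of the equation at most (F + Q)/4, and the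
    total is at most (lam F + Q)/2.

    Every solution that is used comes from the assumption on (L, B): the kernel basis and each
    Neumann correction alike. P_k interpolates only y^(n) and reproduces the lower derivatives at a
    exactly, so the whole C^n error is controlled by the oscillation of y^(n) over one mesh
    width. *)

Lemma csum_ext N g h : (forall j, (j < N)%nat -> g j = h j) -> csum N g = csum N h.
Proof.
  induction N as [|N IH]; intros H; simpl; [reflexivity|].
  rewrite IH by (intros; apply H; lia). now rewrite H by lia.
Qed.

Lemma csum_lin N g c h :
  csum N (fun j => Cplus (g j) (Cmult c (h j))) = Cplus (csum N g) (Cmult c (csum N h)).
Proof. induction N as [|N IH]; simpl; [ring|rewrite IH; ring]. Qed.

Lemma csum_zero N g : (forall j, (j < N)%nat -> g j = RtoC 0) -> csum N g = RtoC 0.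
Proof.
  induction N as [|N IH]; intros H; simpl; [reflexivity|].
  rewrite IH by (intros; apply H; lia). rewrite H by lia. ring.
Qed.

Lemma csum_single N g j0 : (j0 < N)%nat ->
  (forall j, (j < N)%nat -> j <> j0 -> g j = RtoC 0) -> csum N g = g j0.
Proof.
  induction N as [|N IH]; intros Hj H; simpl; [lia|].
  destruct (Nat.eq_dec j0 N) as [->|Hne].
  - rewrite csum_zero by (intros; apply H; lia). ring.
  - rewrite IH by (try lia; intros; apply H; lia). rewrite (H N) by lia. ring.
Qed.

Lemma csum_minus N g h : csum N (fun j => Cminus (g j) (h j)) = Cminus (csum N g) (csum N h).
Proof. induction N as [|N IH]; simpl; [ring|rewrite IH; ring]. Qed.

Lemma csum_scal N c g : csum N (fun j => Cmult c (g j)) = Cmult c (csum N g).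
Proof. induction N as [|N IH]; simpl; [ring|rewrite IH; ring]. Qed.

Lemma rsum_ext N g h : (forall j, (j < N)%nat -> g j = h j) -> rsum N g = rsum N h.
Proof.
  induction N as [|N IH]; intros H; simpl; [reflexivity|].
  rewrite IH by (intros; apply H; lia). now rewrite H by lia.
Qed.

Lemma rsum_le N g h : (forall j, (j < N)%nat -> g j <= h j) -> rsum N g <= rsum N h.
Proof.
  induction N as [|N IH]; intros H; simpl; [lra|].
  apply Rplus_le_compat; [apply IH; intros; apply H; lia|apply H; lia].
Qed.

Lemma rsum_nonneg N g : (forall j, (j < N)%nat -> 0 <= g j) -> 0 <= rsum N g.
Proof.
  induction N as [|N IH]; intros H; simpl; [lra|].
  apply Rplus_le_le_0_compat; [apply IH; intros; apply H; lia|apply H; lia].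
Qed.

Lemma rsum_lin N g c h : rsum N (fun j => g j + c * h j) = rsum N g + c * rsum N h.
Proof. induction N as [|N IH]; simpl; [ring|rewrite IH; ring]. Qed.

Lemma rsum_const N c : rsum N (fun _ => c) = INR N * c.
Proof. induction N as [|N IH]; [simpl; ring|]. rewrite S_INR. simpl rsum. rewrite IH. ring. Qed.

Lemma rsum_scal N c h : rsum N (fun j => c * h j) = c * rsum N h.
Proof. induction N as [|N IH]; simpl; [ring|rewrite IH; ring]. Qed.

Lemma rsum_term N g j : (forall j, (j < N)%nat -> 0 <= g j) -> (j < N)%nat -> g j <= rsum N g.
Proof.
  induction N as [|N IH]; intros H Hj; simpl; [lia|].
  assert (0 <= rsum N g) by (apply rsum_nonneg; intros; apply H; lia).
  assert (0 <= g N) by (apply H; lia).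
  destruct (Nat.eq_dec j N) as [->|Hne]; [lra|].
  assert (g j <= rsum N g) by (apply IH; [intros; apply H; lia|lia]). lra.
Qed.

Lemma rsum_shift N g : rsum (S N) g = g 0%nat + rsum N (fun j => g (S j)).
Proof. induction N as [|N IH]; [simpl; ring|]. change (rsum (S (S N)) g) with (rsum (S N) g + g (S N)).
  rewrite IH. simpl. ring. Qed.

Lemma rsum_mono_index N M g : (N <= M)%nat -> (forall j, (j < M)%nat -> 0 <= g j) ->
  rsum N g <= rsum M g.
Proof.
  induction 1 as [|M HM IH]; intros H; simpl; [lra|].
  assert (0 <= g M) by (apply H; lia).
  assert (rsum N g <= rsum M g) by (apply IH; intros; apply H; lia). lra.
Qed.

Lemma Cmod_csum N g : Cmod (csum N g) <= rsum N (fun j => Cmod (g j)).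
Proof.
  induction N as [|N IH]; simpl; [rewrite Cmod_0; lra|].
  eapply Rle_trans; [apply Cmod_triangle|lra].
Qed.

Lemma Cmod_minus_le (x y : C) : Cmod (Cminus x y) <= Cmod x + Cmod y.
Proof. unfold Cminus. rewrite <- (Cmod_opp y). apply Cmod_triangle. Qed.

Lemma Cmod_minus_sym (x y : C) : Cmod (Cminus x y) = Cmod (Cminus y x).
Proof. rewrite <- Cmod_opp. f_equal. ring. Qed.

Lemma Cmod_triangle_minus (x y z : C) :
  Cmod (Cminus x z) <= Cmod (Cminus x y) + Cmod (Cminus y z).
Proof. replace (Cminus x z) with (Cplus (Cminus x y) (Cminus y z)) by ring. apply Cmod_triangle. Qed.

(** * Derivatives relative to a compact interval *)

Section Interval.

Context (a b : R) (hab : a < b).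

(** At the right endpoint only points to the left remain in the interval, hence the case split. This
    is where [a < b] enters the uniqueness of derivatives. *)
Lemma nearby_point t delta : a <= t <= b -> 0 < delta ->
  exists s, a <= s <= b /\ Rabs (s - t) < delta /\ s <> t.
Proof.
  intros Ht Hd. destruct (Rlt_dec t b) as [Hb|Hb].
  - exists (t + Rmin (delta / 2) (b - t)).
    assert (H1 := Rmin_l (delta / 2) (b - t)). assert (H2 := Rmin_r (delta / 2) (b - t)).
    assert (0 < Rmin (delta / 2) (b - t)) by (apply Rmin_glb_lt; lra).
    split; [lra|]. split; [rewrite Rabs_right; lra|lra].
  - exists (t - Rmin (delta / 2) (t - a)).
    assert (H1 := Rmin_l (delta / 2) (t - a)). assert (H2 := Rmin_r (delta / 2) (t - a)).
    assert (0 < Rmin (delta / 2) (t - a)) by (apply Rmin_glb_lt; lra).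
    split; [lra|]. split; [rewrite Rabs_left; lra|lra].
Qed.

Lemma is_deriv_ab_unique g t d e : a <= t <= b ->
  is_deriv_ab a b g t d -> is_deriv_ab a b g t e -> d = e.
Proof.
  intros Ht Hd He.
  assert (Hz : Cminus d e = RtoC 0).
  { apply Cmod_eq_0. apply Rle_antisym; [|apply Cmod_ge_0].
    apply Rnot_lt_le. intros Hpos.
    destruct (Hd (Cmod (Cminus d e) / 4)) as [d1 [Hd1 H1]]; [lra|].
    destruct (He (Cmod (Cminus d e) / 4)) as [d2 [Hd2 H2]]; [lra|].
    destruct (nearby_point t (Rmin d1 d2) Ht) as [s [Hs [Hst Hne]]].
    { apply Rmin_glb_lt; lra. }
    assert (Rabs (s - t) < d1) by (eapply Rlt_le_trans; [exact Hst|apply Rmin_l]).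
    assert (Rabs (s - t) < d2) by (eapply Rlt_le_trans; [exact Hst|apply Rmin_r]).
    specialize (H1 s Hs H). specialize (H2 s Hs H0).
    assert (Hm : Cmod (Cmult (RtoC (s - t)) (Cminus d e)) <= Cmod (Cminus d e) / 2 * Rabs (s - t)).
    { replace (Cmult (RtoC (s - t)) (Cminus d e)) with
        (Cminus (Cminus (Cminus (g s) (g t)) (Cmult (RtoC (s - t)) e))
                (Cminus (Cminus (g s) (g t)) (Cmult (RtoC (s - t)) d))) by ring.
      eapply Rle_trans; [apply Cmod_minus_le|]. lra. }
    rewrite Cmod_mult, Cmod_R in Hm.
    assert (0 < Rabs (s - t)) by (apply Rabs_pos_lt; lra). nra. }
  replace d with (Cplus e (Cminus d e)) by ring. rewrite Hz. ring.
Qed.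

Lemma is_deriv_ab_ext g h t d : (forall s, a <= s <= b -> g s = h s) -> a <= t <= b ->
  is_deriv_ab a b g t d -> is_deriv_ab a b h t d.
Proof.
  intros H Ht Hg eps Heps. destruct (Hg eps Heps) as [delta [Hd H1]].
  exists delta. split; [exact Hd|]. intros s Hs Hst.
  rewrite <- !H by assumption. now apply H1.
Qed.

Lemma cont_ab_ext g h : (forall s, a <= s <= b -> g s = h s) -> cont_ab a b g -> cont_ab a b h.
Proof.
  intros H Hg t Ht eps Heps. destruct (Hg t Ht eps Heps) as [delta [Hd H1]].
  exists delta. split; [exact Hd|]. intros s Hs Hst.
  rewrite <- !H by assumption. now apply H1.
Qed.

(** The only access to the chosen value [deriv_ab]: existence lets [epsilon] pick some derivative,
    uniqueness identifies it. *)
Lemma deriv_ab_eq g t d : a <= t <= b -> is_deriv_ab a b g t d -> deriv_ab a b g t = d.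
Proof.
  intros Ht Hd. apply (is_deriv_ab_unique g t); [exact Ht| |exact Hd].
  unfold deriv_ab. apply epsilon_spec. now exists d.
Qed.

(** True even at points without a derivative: the two predicates given to [epsilon] are equal, so it
    returns the same value. *)
Lemma deriv_ab_ext g h : (forall s, a <= s <= b -> g s = h s) ->
  forall t, a <= t <= b -> deriv_ab a b g t = deriv_ab a b h t.
Proof.
  intros H t Ht. unfold deriv_ab. f_equal. apply functional_extensionality. intros d.
  apply propositional_extensionality.
  split; apply is_deriv_ab_ext; auto. intros; symmetry; auto.
Qed.

Lemma is_deriv_ab_const c t : is_deriv_ab a b (fun _ => c) t (RtoC 0).
Proof.
  intros eps Heps. exists 1. split; [lra|]. intros s _ _.
  replace (Cminus (Cminus c c) _) with (RtoC 0) by ring. rewrite Cmod_0.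
  apply Rmult_le_pos; [lra|apply Rabs_pos].
Qed.

Lemma is_deriv_ab_lin g h c t d e :
  is_deriv_ab a b g t d -> is_deriv_ab a b h t e ->
  is_deriv_ab a b (fun s => Cplus (g s) (Cmult c (h s))) t (Cplus d (Cmult c e)).
Proof.
  intros Hg Hh eps Heps. assert (Hc := Cmod_ge_0 c).
  destruct (Hg (eps / 2)) as [d1 [Hd1 H1]]; [lra|].
  destruct (Hh (eps / (2 * (Cmod c + 1)))) as [d2 [Hd2 H2]].
  { apply Rdiv_lt_0_compat; lra. }
  exists (Rmin d1 d2). split; [now apply Rmin_glb_lt|]. intros s Hs Hst.
  assert (Rabs (s - t) < d1) by (eapply Rlt_le_trans; [exact Hst|apply Rmin_l]).
  assert (Rabs (s - t) < d2) by (eapply Rlt_le_trans; [exact Hst|apply Rmin_r]).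
  specialize (H1 s Hs H). specialize (H2 s Hs H0).
  match goal with |- Cmod ?X <= _ => replace X with
    (Cplus (Cminus (Cminus (g s) (g t)) (Cmult (RtoC (s - t)) d))
      (Cmult c (Cminus (Cminus (h s) (h t)) (Cmult (RtoC (s - t)) e)))) by ring end.
  eapply Rle_trans; [apply Cmod_triangle|]. rewrite Cmod_mult.
  assert (Cmod c * (eps / (2 * (Cmod c + 1)) * Rabs (s - t)) <= eps / 2 * Rabs (s - t)).
  { rewrite <- Rmult_assoc. apply Rmult_le_compat_r; [apply Rabs_pos|].
    apply (Rmult_le_reg_r (2 * (Cmod c + 1))); [lra|].
    replace (Cmod c * (eps / (2 * (Cmod c + 1))) * (2 * (Cmod c + 1))) with (Cmod c * eps)
      by (field; lra). nra. }
  assert (Cmod c * Cmod (Cminus (Cminus (h s) (h t)) (Cmult (RtoC (s - t)) e)) <=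
     Cmod c * (eps / (2 * (Cmod c + 1)) * Rabs (s - t))) by (apply Rmult_le_compat_l; auto).
  lra.
Qed.

Lemma is_deriv_ab_cont g t d : is_deriv_ab a b g t d ->
  forall eps, 0 < eps -> exists delta, 0 < delta /\
    forall s, a <= s <= b -> Rabs (s - t) < delta -> Cmod (Cminus (g s) (g t)) < eps.
Proof.
  intros Hg eps Heps. destruct (Hg 1) as [d1 [Hd1 H1]]; [lra|].
  assert (Hc := Cmod_ge_0 d).
  exists (Rmin d1 (eps / (Cmod d + 2))).
  assert (0 < eps / (Cmod d + 2)) by (apply Rdiv_lt_0_compat; lra).
  split; [apply Rmin_glb_lt; lra|]. intros s Hs Hst.
  assert (Hx : Rabs (s - t) < d1) by (eapply Rlt_le_trans; [exact Hst|apply Rmin_l]).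
  assert (Hy : Rabs (s - t) < eps / (Cmod d + 2)) by (eapply Rlt_le_trans; [exact Hst|apply Rmin_r]).
  specialize (H1 s Hs Hx).
  replace (Cminus (g s) (g t)) with (Cplus (Cminus (Cminus (g s) (g t)) (Cmult (RtoC (s - t)) d))
     (Cmult (RtoC (s - t)) d)) by ring.
  eapply Rle_lt_trans; [apply Cmod_triangle|]. rewrite (Cmod_mult (RtoC _)), Cmod_R.
  apply (Rmult_lt_compat_r (Cmod d + 2)) in Hy; [|lra].
  unfold Rdiv in Hy. rewrite Rmult_assoc, Rinv_l, Rmult_1_r in Hy by lra.
  assert (0 <= Rabs (s - t)) by apply Rabs_pos. nra.
Qed.

Lemma is_deriv_ab_mult g h t d e :
  is_deriv_ab a b g t d -> is_deriv_ab a b h t e ->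
  is_deriv_ab a b (fun s => Cmult (g s) (h s)) t (Cplus (Cmult d (h t)) (Cmult (g t) e)).
Proof.
  intros Hg Hh eps Heps.
  assert (Hgt := Cmod_ge_0 (g t)). assert (Hht := Cmod_ge_0 (h t)). assert (Hdd := Cmod_ge_0 d).
  (* [M] dominates each factor that multiplies a small term below, so the three error terms each
     cost at most [eps / 3] times the increment. *)
  set (M := Cmod (h t) + Cmod (g t) + Cmod d + 2).
  assert (HM : 0 < eps / (3 * M)) by (apply Rdiv_lt_0_compat; unfold M; lra).
  assert (HMe : eps / (3 * M) * M = eps / 3) by (field; unfold M; lra).
  destruct (Hg (eps / (3 * M)) HM) as [d1 [Hd1 H1]].
  destruct (Hh (eps / (3 * M)) HM) as [d2 [Hd2 H2]].
  destruct (is_deriv_ab_cont h t e Hh (Rmin 1 (eps / (3 * M)))) as [d3 [Hd3 H3]].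
  { apply Rmin_glb_lt; lra. }
  exists (Rmin d1 (Rmin d2 d3)). split; [repeat apply Rmin_glb_lt; lra|]. intros s Hs Hst.
  assert (Ha : Rabs (s - t) < d1) by (eapply Rlt_le_trans; [exact Hst|apply Rmin_l]).
  assert (Hb : Rabs (s - t) < d2).
  { eapply Rlt_le_trans; [exact Hst|]. eapply Rle_trans; [apply Rmin_r|apply Rmin_l]. }
  assert (Hc : Rabs (s - t) < d3).
  { eapply Rlt_le_trans; [exact Hst|]. eapply Rle_trans; [apply Rmin_r|apply Rmin_r]. }
  specialize (H1 s Hs Ha). specialize (H2 s Hs Hb). specialize (H3 s Hs Hc).
  assert (H4 : Cmod (Cminus (h s) (h t)) <= eps / (3 * M)).
  { apply Rlt_le, (Rlt_le_trans _ _ _ H3), Rmin_r. }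
  assert (H5 : Cmod (h s) <= Cmod (h t) + 1).
  { replace (h s) with (Cplus (h t) (Cminus (h s) (h t))) by ring.
    eapply Rle_trans; [apply Cmod_triangle|].
    assert (Rmin 1 (eps / (3 * M)) <= 1) by apply Rmin_l. lra. }
  match goal with |- Cmod ?X <= _ => replace X with
    (Cplus (Cplus (Cmult (Cminus (Cminus (g s) (g t)) (Cmult (RtoC (s - t)) d)) (h s))
      (Cmult (g t) (Cminus (Cminus (h s) (h t)) (Cmult (RtoC (s - t)) e))))
      (Cmult (Cmult (RtoC (s - t)) d) (Cminus (h s) (h t)))) by ring end.
  eapply Rle_trans; [apply Cmod_triangle|].
  eapply Rle_trans; [apply Rplus_le_compat_r, Cmod_triangle|].
  rewrite !(Cmod_mult _ (h s)), !(Cmod_mult (g t)), !(Cmod_mult _ (Cminus (h s) (h t))),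
    (Cmod_mult (RtoC _)), Cmod_R.
  assert (Hr := Rabs_pos (s - t)).
  set (u := eps / (3 * M)) in *. set (x := Rabs (s - t)) in *.
  assert (Cmod (Cminus (Cminus (g s) (g t)) (Cmult (RtoC (s - t)) d)) * Cmod (h s) <= (u * x) * M).
  { apply Rmult_le_compat; try apply Cmod_ge_0; [exact H1|unfold M; lra]. }
  assert (Cmod (g t) * Cmod (Cminus (Cminus (h s) (h t)) (Cmult (RtoC (s - t)) e)) <= M * (u * x)).
  { apply Rmult_le_compat; try apply Cmod_ge_0; [unfold M; lra|exact H2]. }
  assert (x * Cmod d * Cmod (Cminus (h s) (h t)) <= (x * M) * u).
  { apply Rmult_le_compat; try apply Cmod_ge_0; [apply Rmult_le_pos; lra| |exact H4].
    apply Rmult_le_compat_l; [lra|unfold M; lra]. }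
  assert (u * x * M = eps / 3 * x) by (rewrite <- HMe; ring). lra.
Qed.

Lemma cont_ab_const c : cont_ab a b (fun _ => c).
Proof.
  intros t Ht eps Heps. exists 1. split; [lra|]. intros.
  replace (Cminus c c) with (RtoC 0) by ring. now rewrite Cmod_0.
Qed.

Lemma cont_ab_lin g h c : cont_ab a b g -> cont_ab a b h ->
  cont_ab a b (fun s => Cplus (g s) (Cmult c (h s))).
Proof.
  intros Hg Hh t Ht eps Heps. assert (Hc := Cmod_ge_0 c).
  destruct (Hg t Ht (eps / 2)) as [d1 [Hd1 H1]]; [lra|].
  destruct (Hh t Ht (eps / (2 * (Cmod c + 1)))) as [d2 [Hd2 H2]].
  { apply Rdiv_lt_0_compat; lra. }
  exists (Rmin d1 d2). split; [now apply Rmin_glb_lt|]. intros s Hs Hst.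
  assert (H : Rabs (s - t) < d1) by (eapply Rlt_le_trans; [exact Hst|apply Rmin_l]).
  assert (H0 : Rabs (s - t) < d2) by (eapply Rlt_le_trans; [exact Hst|apply Rmin_r]).
  specialize (H1 s Hs H). specialize (H2 s Hs H0).
  match goal with |- Cmod ?X < _ => replace X with
    (Cplus (Cminus (g s) (g t)) (Cmult c (Cminus (h s) (h t)))) by ring end.
  eapply Rle_lt_trans; [apply Cmod_triangle|]. rewrite Cmod_mult.
  assert (Cmod c * Cmod (Cminus (h s) (h t)) <= Cmod c * (eps / (2 * (Cmod c + 1))))
    by (apply Rmult_le_compat_l; lra).
  assert (Cmod c * (eps / (2 * (Cmod c + 1))) <= eps / 2).
  { apply (Rmult_le_reg_r (2 * (Cmod c + 1))); [lra|].
    replace (Cmod c * (eps / (2 * (Cmod c + 1))) * (2 * (Cmod c + 1))) with (Cmod c * eps)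
      by (field; lra). nra. }
  lra.
Qed.

Lemma cont_ab_mult g h : cont_ab a b g -> cont_ab a b h ->
  cont_ab a b (fun s => Cmult (g s) (h s)).
Proof.
  intros Hg Hh t Ht eps Heps.
  assert (Hgt := Cmod_ge_0 (g t)). assert (Hht := Cmod_ge_0 (h t)).
  set (M := Cmod (h t) + Cmod (g t) + 2).
  assert (HM : 0 < eps / (2 * M)) by (apply Rdiv_lt_0_compat; unfold M; lra).
  assert (HMe : eps / (2 * M) * M = eps / 2) by (field; unfold M; lra).
  destruct (Hg t Ht (eps / (2 * M)) HM) as [d1 [Hd1 H1]].
  destruct (Hh t Ht (Rmin 1 (eps / (2 * M)))) as [d2 [Hd2 H2]].
  { apply Rmin_glb_lt; lra. }
  exists (Rmin d1 d2). split; [now apply Rmin_glb_lt|]. intros s Hs Hst.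
  assert (H : Rabs (s - t) < d1) by (eapply Rlt_le_trans; [exact Hst|apply Rmin_l]).
  assert (H0 : Rabs (s - t) < d2) by (eapply Rlt_le_trans; [exact Hst|apply Rmin_r]).
  specialize (H1 s Hs H). specialize (H2 s Hs H0).
  assert (Hm1 := Rmin_l 1 (eps / (2 * M))). assert (Hm2 := Rmin_r 1 (eps / (2 * M))).
  assert (H5 : Cmod (h s) <= Cmod (h t) + 1).
  { replace (h s) with (Cplus (h t) (Cminus (h s) (h t))) by ring.
    eapply Rle_trans; [apply Cmod_triangle|]. lra. }
  match goal with |- Cmod ?X < _ => replace X with
    (Cplus (Cmult (Cminus (g s) (g t)) (h s)) (Cmult (g t) (Cminus (h s) (h t)))) by ring end.
  eapply Rle_lt_trans; [apply Cmod_triangle|]. rewrite !Cmod_mult.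
  assert (Cmod (Cminus (g s) (g t)) * Cmod (h s) <= eps / (2 * M) * (Cmod (h t) + 1)).
  { apply Rmult_le_compat; try apply Cmod_ge_0; lra. }
  assert (Cmod (g t) * Cmod (Cminus (h s) (h t)) <= Cmod (g t) * (eps / (2 * M))).
  { apply Rmult_le_compat_l; lra. }
  assert (eps / (2 * M) * (Cmod (h t) + 1) + Cmod (g t) * (eps / (2 * M)) < eps / (2 * M) * M * 2).
  { unfold M in *. nra. }
  lra.
Qed.

Lemma is_derive_is_deriv_ab (f : R -> R) t d : is_derive f t d ->
  is_deriv_ab a b (fun s => RtoC (f s)) t (RtoC d).
Proof.
  intros Hf eps Heps. apply is_derive_Reals in Hf. destruct (Hf eps Heps) as [delta H].
  exists delta. split; [apply cond_pos|]. intros s Hs Hst.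
  rewrite <- RtoC_minus, <- RtoC_mult, <- RtoC_minus, Cmod_R.
  destruct (Req_dec s t) as [->|Hne].
  - replace (f t - f t - (t - t) * d) with 0 by ring. rewrite Rabs_R0.
    apply Rmult_le_pos; [lra|apply Rabs_pos].
  - specialize (H (s - t) ltac:(lra) Hst). replace (t + (s - t)) with s in H by ring.
    replace (f s - f t - (s - t) * d) with (((f s - f t) / (s - t) - d) * (s - t)) by (field; lra).
    rewrite Rabs_mult. apply Rmult_le_compat_r; [apply Rabs_pos|lra].
Qed.

Lemma continuous_cont_ab (f : R -> R) : (forall t, continuity_pt f t) ->
  cont_ab a b (fun s => RtoC (f s)).
Proof.
  intros Hf t Ht eps Heps. destruct (Hf t eps Heps) as [delta [Hd H]].
  exists delta. split; [exact Hd|]. intros s Hs Hst.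
  rewrite <- RtoC_minus, Cmod_R.
  destruct (Req_dec s t) as [->|Hne].
  - now rewrite Rminus_diag, Rabs_R0.
  - apply H. split; [|exact Hst]. split; [exact I|auto].
Qed.

(** * Iterated derivatives and the classes C^l *)

Lemma nder_S j g : nder a b (S j) g = nder a b j (deriv_ab a b g).
Proof. unfold nder. now rewrite Nat.iter_succ_r. Qed.

Lemma nder_add i j g : nder a b (i + j) g = nder a b i (nder a b j g).
Proof. unfold nder. apply Nat.iter_add. Qed.

Lemma nder_ext j g h : (forall s, a <= s <= b -> g s = h s) ->
  forall t, a <= t <= b -> nder a b j g t = nder a b j h t.
Proof.
  intros H. induction j as [|j IH]; [exact H|]. intros t Ht. simpl.
  now apply deriv_ab_ext.
Qed.

(** Any explicit chain of successive derivatives agrees with the chosen ones, by induction on the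
    order. Derivatives of sums, iterated integrals and limits are all computed by exhibiting such a
    chain. *)
Lemma nder_tower l (G : nat -> R -> C) :
  (forall j, (j < l)%nat -> forall t, a <= t <= b -> is_deriv_ab a b (G j) t (G (S j) t)) ->
  forall j, (j <= l)%nat -> forall t, a <= t <= b -> nder a b j (G 0%nat) t = G j t.
Proof.
  intros H j. induction j as [|j IH]; intros Hj t Ht; [reflexivity|].
  simpl. apply deriv_ab_eq; [exact Ht|].
  apply (is_deriv_ab_ext (G j)); [|exact Ht|apply H; [lia|exact Ht]].
  intros s Hs. symmetry. apply IH; [lia|exact Hs].
Qed.

Lemma isCl_tower l (G : nat -> R -> C) :
  (forall j, (j < l)%nat -> forall t, a <= t <= b -> is_deriv_ab a b (G j) t (G (S j) t)) ->
  cont_ab a b (G l) -> isCl a b l (G 0%nat).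
Proof.
  intros H Hc. assert (E := nder_tower l G H). split.
  - intros j Hj t Ht. rewrite (E (S j)) by (try lia; assumption).
    apply (is_deriv_ab_ext (G j)); [|exact Ht|apply H; assumption].
    intros s Hs. symmetry. apply E; [lia|exact Hs].
  - apply (cont_ab_ext (G l)); [|exact Hc]. intros s Hs. symmetry. now apply E.
Qed.

Lemma isCl_ext l g h : (forall s, a <= s <= b -> g s = h s) -> isCl a b l g -> isCl a b l h.
Proof.
  intros H [H1 H2]. split.
  - intros j Hj t Ht. rewrite <- (nder_ext (S j) g h H) by exact Ht.
    apply (is_deriv_ab_ext (nder a b j g)); [|exact Ht|now apply H1].
    now apply nder_ext.
  - apply (cont_ab_ext (nder a b l g)); [|exact H2]. now apply nder_ext.
Qed.

Lemma nder_lin l g h c : isCl a b l g -> isCl a b l h ->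
  forall j, (j <= l)%nat -> forall t, a <= t <= b ->
  nder a b j (fun s => Cplus (g s) (Cmult c (h s))) t =
  Cplus (nder a b j g t) (Cmult c (nder a b j h t)).
Proof.
  intros [Hg _] [Hh _].
  apply (nder_tower l (fun j t => Cplus (nder a b j g t) (Cmult c (nder a b j h t)))).
  intros j Hj t Ht. apply is_deriv_ab_lin; [now apply Hg|now apply Hh].
Qed.

Lemma isCl_lin l g h c : isCl a b l g -> isCl a b l h ->
  isCl a b l (fun s => Cplus (g s) (Cmult c (h s))).
Proof.
  intros [Hg Hg'] [Hh Hh'].
  apply (isCl_tower l (fun j t => Cplus (nder a b j g t) (Cmult c (nder a b j h t)))).
  - intros j Hj t Ht. apply is_deriv_ab_lin; [now apply Hg|now apply Hh].
  - now apply cont_ab_lin.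
Qed.

Lemma isCl_cont l g j : isCl a b l g -> (j <= l)%nat -> cont_ab a b (nder a b j g).
Proof.
  intros [H1 H2] Hj. destruct (Nat.eq_dec j l) as [->|Hne]; [exact H2|].
  intros t Ht. apply (is_deriv_ab_cont _ t (nder a b (S j) g t)). apply H1; [lia|exact Ht].
Qed.

Lemma isCl_le l l' g : (l' <= l)%nat -> isCl a b l g -> isCl a b l' g.
Proof.
  intros Hl H. split; [|now apply (isCl_cont l)].
  intros j Hj. apply H. lia.
Qed.

Lemma isCl_nder l j g : isCl a b (l + j) g -> isCl a b l (nder a b j g).
Proof.
  intros [H1 H2]. split.
  - intros i Hi t Ht. rewrite <- !nder_add. apply (H1 (i + j)%nat); [lia|exact Ht].
  - rewrite <- nder_add. exact H2.
Qed.

Lemma isCl_S l g : (forall t, a <= t <= b -> is_deriv_ab a b g t (deriv_ab a b g t)) ->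
  isCl a b l (deriv_ab a b g) -> isCl a b (S l) g.
Proof.
  intros H [H1 H2]. split.
  - intros [|j] Hj t Ht; [now apply H|]. rewrite (nder_S (S j) g), (nder_S j g). apply H1; [lia|exact Ht].
  - now rewrite nder_S.
Qed.

Lemma isCl_zero l : isCl a b l (fun _ => RtoC 0).
Proof.
  apply (isCl_tower l (fun _ _ => RtoC 0)); [|apply cont_ab_const].
  intros. apply is_deriv_ab_const.
Qed.

Lemma nder_zero j t : a <= t <= b -> nder a b j (fun _ => RtoC 0) t = RtoC 0.
Proof.
  intros Ht. apply (nder_tower j (fun _ _ => RtoC 0)); auto. intros. apply is_deriv_ab_const.
Qed.

(** The factor [RtoC 1] puts Leibniz' rule into the shape g + c h that [isCl_lin] and [normCl_lin]
    accept. *)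
Lemma deriv_ab_mult l g h : isCl a b (S l) g -> isCl a b (S l) h ->
  forall t, a <= t <= b -> is_deriv_ab a b (fun s => Cmult (g s) (h s)) t
   (Cplus (Cmult (deriv_ab a b g t) (h t)) (Cmult (RtoC 1) (Cmult (g t) (deriv_ab a b h t)))).
Proof.
  intros Hg Hh t Ht. rewrite Cmult_1_l. apply is_deriv_ab_mult.
  - apply (proj1 Hg 0%nat); [lia|exact Ht].
  - apply (proj1 Hh 0%nat); [lia|exact Ht].
Qed.

(** Peeling off one derivative at a time needs only the first-order product rule and no binomial
    formula. *)
Lemma isCl_mult l g h : isCl a b l g -> isCl a b l h -> isCl a b l (fun s => Cmult (g s) (h s)).
Proof.
  revert g h. induction l as [|l IH]; intros g h Hg Hh.
  - split; [intros; lia|]. apply cont_ab_mult; [apply Hg|apply Hh].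
  - assert (D := deriv_ab_mult l g h Hg Hh).
    assert (Hg' : isCl a b l (deriv_ab a b g)) by (apply (isCl_nder l 1); now replace (l + 1)%nat with (S l) by lia).
    assert (Hh' : isCl a b l (deriv_ab a b h)) by (apply (isCl_nder l 1); now replace (l + 1)%nat with (S l) by lia).
    apply (isCl_le (S l) l) in Hg; [|lia]. apply (isCl_le (S l) l) in Hh; [|lia].
    apply isCl_S.
    + intros t Ht. now rewrite (deriv_ab_eq _ t _ Ht (D t Ht)); auto.
    + eapply isCl_ext; [intros s Hs; symmetry; apply (deriv_ab_eq _ s _ Hs (D s Hs))|].
      apply isCl_lin; apply IH; assumption.
Qed.

End Interval.

(** * Suprema and the mean value inequality *)

Section Norms.

Context (a b : R) (hab : a < b).

(** Retraction of the line onto the interval. Composing with it extends a function continuously to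
    all of R, as the classical theorems on real functions expect. *)
Definition clamp (x : R) : R := Rmax a (Rmin b x).

Lemma clamp_in x : a <= clamp x <= b.
Proof.
  unfold clamp. split; [apply Rmax_l|]. apply Rmax_lub; [lra|apply Rmin_l].
Qed.

Lemma clamp_id x : a <= x <= b -> clamp x = x.
Proof. intros Hx. unfold clamp. rewrite Rmin_right, Rmax_right; lra. Qed.

Lemma clamp_lipschitz x y : Rabs (clamp x - clamp y) <= Rabs (x - y).
Proof.
  unfold clamp, Rmax, Rmin.
  repeat destruct Rle_dec; unfold Rabs; repeat destruct Rcase_abs; lra.
Qed.

(** The 1-Lipschitz map [u] stands for the modulus, the real part or the imaginary part. *)
Lemma continuity_clamp (u : C -> R) g : (forall z w, Rabs (u z - u w) <= Cmod (Cminus z w)) ->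
  cont_ab a b g -> forall x, continuity_pt (fun t => u (g (clamp t))) x.
Proof.
  intros Hu Hg x eps Heps. destruct (Hg (clamp x) (clamp_in x) eps Heps) as [delta [Hd H]].
  exists delta. split; [exact Hd|]. intros y [_ Hy]. simpl in *.
  eapply Rle_lt_trans; [apply Hu|]. apply H; [apply clamp_in|].
  eapply Rle_lt_trans; [apply clamp_lipschitz|exact Hy].
Qed.

Lemma Cmod_lipschitz z w : Rabs (Cmod z - Cmod w) <= Cmod (Cminus z w).
Proof.
  assert (Cmod z <= Cmod (Cminus z w) + Cmod w).
  { replace z with (Cplus (Cminus z w) w) at 1 by ring. apply Cmod_triangle. }
  assert (Cmod w <= Cmod (Cminus z w) + Cmod z).
  { rewrite Cmod_minus_sym. replace w with (Cplus (Cminus w z) z) at 1 by ring. apply Cmod_triangle. }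
  apply Rabs_le. lra.
Qed.

Lemma cont_ab_bounded g : cont_ab a b g -> exists M, forall t, a <= t <= b -> Cmod (g t) <= M.
Proof.
  intros Hg. destruct (continuity_ab_maj (fun t => Cmod (g (clamp t))) a b) as [x [Hx _]]; [lra| |].
  - intros. apply continuity_clamp; [apply Cmod_lipschitz|exact Hg].
  - exists (Cmod (g (clamp x))). intros t Ht. rewrite <- (clamp_id t Ht). now apply Hx.
Qed.

(** [real] sends both infinities to 0, so the supremum must first be shown finite: the bound [M]
    excludes plus infinity, the value at [a] excludes minus infinity. *)
Lemma supnorm_lub g M : (forall t, a <= t <= b -> Cmod (g t) <= M) ->
  (forall t, a <= t <= b -> Cmod (g t) <= supnorm a b g) /\ supnorm a b g <= M.
Proof.
  intros HM. unfold supnorm.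
  set (E := fun v => exists t, a <= t <= b /\ v = Cmod (g t)).
  destruct (Lub_Rbar_correct E) as [Hub Hlub].
  assert (Hle : Rbar_le (Lub_Rbar E) M).
  { apply Hlub. intros v [t [Ht ->]]. now apply HM. }
  assert (Hge : forall t, a <= t <= b -> Rbar_le (Cmod (g t)) (Lub_Rbar E)).
  { intros t Ht. apply Hub. now exists t. }
  destruct (Lub_Rbar E) as [x| |]; simpl in *.
  - now split.
  - contradiction.
  - exfalso. apply (Hge a). lra.
Qed.

Lemma supnorm_le g M : (forall t, a <= t <= b -> Cmod (g t) <= M) -> supnorm a b g <= M.
Proof. intros H. now apply supnorm_lub. Qed.

Lemma supnorm_ub g t : cont_ab a b g -> a <= t <= b -> Cmod (g t) <= supnorm a b g.
Proof.
  intros Hg Ht. destruct (cont_ab_bounded g Hg) as [M HM]. now apply (supnorm_lub g M).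
Qed.

Lemma supnorm_ge0 g : cont_ab a b g -> 0 <= supnorm a b g.
Proof.
  intros Hg. eapply Rle_trans; [apply (Cmod_ge_0 (g a))|]. apply supnorm_ub; [exact Hg|lra].
Qed.

Lemma supnorm_ext g h : (forall t, a <= t <= b -> g t = h t) -> supnorm a b g = supnorm a b h.
Proof.
  intros H. unfold supnorm. f_equal. f_equal. apply functional_extensionality. intros v.
  apply propositional_extensionality.
  split; intros [t [Ht ->]]; exists t; split; auto; now rewrite H.
Qed.

(** An arbitrary majorant [phi], rather than a Lipschitz constant, allows comparison with an
    exponential in the Gronwall argument. *)
Lemma mean_value_ineq g g' phi phi' :
  (forall t, a <= t <= b -> is_deriv_ab a b g t (g' t)) ->
  (forall t, a <= t <= b -> is_derive phi t (phi' t)) ->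
  (forall t, a <= t <= b -> Cmod (g' t) <= phi' t) ->
  forall s t, a <= s -> s <= t -> t <= b -> Cmod (Cminus (g t) (g s)) <= phi t - phi s.
Proof.
  intros Hg Hphi Hle s t Has Hst Htb.
  remember (Cminus (g t) (g s)) as z eqn:Ez.
  (* Apply the real mean value theorem to Re (conj z * g) - |z| * phi, where z = g t - g s. *)
  set (psi := fun x => Re (Cmult (Cconj z) (g (clamp x))) - Cmod z * phi x).
  set (dpsi := fun x => Re (Cmult (Cconj z) (g' x)) - Cmod z * phi' x).
  assert (Hpsi : exists c, s <= c <= t /\ psi t - psi s = dpsi c * (t - s)).
  { destruct (MVT_gen psi s t dpsi) as [c [Hc E]].
    - intros x Hx. rewrite Rmin_left, Rmax_right in Hx by lra.
      apply (is_derive_minus (fun x => Re (Cmult (Cconj z) (g (clamp x)))) (fun x => Cmod z * phi x)).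
      + apply is_derive_Reals. intros eps Heps.
        assert (Hz := Cmod_ge_0 z).
        destruct (Hg x ltac:(lra) (eps / (Cmod z + 1))) as [d [Hd H]].
        { apply Rdiv_lt_0_compat; lra. }
        (* Keeping [x + h] inside the interval makes [clamp] act as the identity in the difference
           quotient. *)
        assert (Hdd : 0 < Rmin d (Rmin (x - a) (b - x))) by (repeat apply Rmin_glb_lt; lra).
        exists (mkposreal _ Hdd). simpl. intros h Hh0 Hh.
        assert (Hh1 : Rabs h < d) by (eapply Rlt_le_trans; [exact Hh|apply Rmin_l]).
        assert (Hh2 : Rabs h < x - a).
        { eapply Rlt_le_trans; [exact Hh|]. eapply Rle_trans; [apply Rmin_r|apply Rmin_l]. }
        assert (Hh3 : Rabs h < b - x).
        { eapply Rlt_le_trans; [exact Hh|]. eapply Rle_trans; [apply Rmin_r|apply Rmin_r]. }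
        apply Rabs_def2 in Hh2. apply Rabs_def2 in Hh3.
        rewrite !clamp_id by lra.
        specialize (H (x + h) ltac:(lra)). replace (x + h - x) with h in H by ring.
        specialize (H Hh1).
        assert (Hm : Rabs (Re (Cmult (Cconj z) (Cminus (Cminus (g (x + h)) (g x)) (Cmult (RtoC h) (g' x)))))
          <= Cmod z * (eps / (Cmod z + 1) * Rabs h)).
        { eapply Rle_trans; [apply re_le_Cmod|]. rewrite Cmod_mult, Cmod_conj.
          now apply Rmult_le_compat_l. }
        assert (Hlt : Cmod z * (eps / (Cmod z + 1) * Rabs h) < eps * Rabs h).
        { rewrite <- Rmult_assoc. apply Rmult_lt_compat_r; [now apply Rabs_pos_lt|].
          apply (Rmult_lt_reg_r (Cmod z + 1)); [lra|].
          replace (Cmod z * (eps / (Cmod z + 1)) * (Cmod z + 1)) with (Cmod z * eps) by (field; lra).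
          nra. }
        apply (Rmult_lt_reg_r (Rabs h)); [now apply Rabs_pos_lt|].
        eapply Rle_lt_trans; [|exact Hlt]. eapply Rle_trans; [|exact Hm].
        rewrite <- Rabs_mult. apply Req_le. f_equal.
        destruct z as [z1 z2], (g (x + h)) as [u1 u2], (g x) as [v1 v2], (g' x) as [w1 w2].
        simpl. field. exact Hh0.
      + apply is_derive_scal. apply Hphi. lra.
    - intros x Hx. rewrite Rmin_left, Rmax_right in Hx by lra.
      apply (continuity_pt_minus (fun x => Re (Cmult (Cconj z) (g (clamp x)))) (fun x => Cmod z * phi x)).
      + assert (Hz := Cmod_ge_0 z). intros eps Heps.
        assert (Hc : cont_ab a b (fun x => Cmult (Cconj z) (g x))).
        { apply cont_ab_mult; [apply cont_ab_const|]. intros u Hu.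
          apply (is_deriv_ab_cont a b g u (g' u)). now apply Hg. }
        apply (continuity_clamp Re _ (fun z w => Rle_trans _ _ _ (Req_le _ _ (f_equal Rabs (eq_refl (Re (Cminus z w))))) (re_le_Cmod _)) Hc x eps Heps).
      + apply derivable_continuous_pt. exists (Cmod z * phi' x).
        apply is_derive_Reals. apply is_derive_scal. apply Hphi. lra.
    - rewrite Rmin_left, Rmax_right in Hc by lra. now exists c. }
  destruct Hpsi as [c [Hc E]]. unfold psi, dpsi in E.
  rewrite !clamp_id in E by lra.
  assert (E2 : Re (Cmult (Cconj z) (g t)) - Re (Cmult (Cconj z) (g s)) = Cmod z ^ 2).
  { rewrite Cmod2_alt, Ez. destruct (g t) as [t1 t2], (g s) as [s1 s2]. simpl. ring. }
  assert (E3 : Re (Cmult (Cconj z) (g' c)) <= Cmod z * phi' c).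
  { eapply Rle_trans; [apply Rle_abs|]. eapply Rle_trans; [apply re_le_Cmod|].
    rewrite Cmod_mult, Cmod_conj. apply Rmult_le_compat_l; [apply Cmod_ge_0|]. apply Hle. lra. }
  assert (E4 : Cmod z ^ 2 <= Cmod z * (phi t - phi s)) by nra.
  (* The factor |z| in [E4] can be cancelled unless z = 0. In that case the claim says that [phi]
     does not decrease, which follows from 0 <= |g'| <= phi'. *)
  destruct (Req_dec (Cmod z) 0) as [Hz|Hz].
  - rewrite Hz in E, E3 |- *.
    destruct (MVT_gen phi s t phi') as [d [Hd Ed]].
    + intros x Hx. rewrite Rmin_left, Rmax_right in Hx by lra. apply Hphi. lra.
    + intros x Hx. rewrite Rmin_left, Rmax_right in Hx by lra.
      apply derivable_continuous_pt. exists (phi' x). apply is_derive_Reals, Hphi. lra.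
    + rewrite Rmin_left, Rmax_right in Hd by lra. rewrite Ed.
      apply Rmult_le_pos; [|lra]. eapply Rle_trans; [apply Cmod_ge_0|apply Hle; lra].
  - assert (Hz' := Cmod_ge_0 z). apply (Rmult_le_reg_l (Cmod z)); [lra|]. simpl in E4. lra.
Qed.

Lemma lipschitz_of_deriv_bound g g' M :
  (forall t, a <= t <= b -> is_deriv_ab a b g t (g' t)) ->
  (forall t, a <= t <= b -> Cmod (g' t) <= M) ->
  forall s t, a <= s <= b -> a <= t <= b -> Cmod (Cminus (g t) (g s)) <= M * Rabs (t - s).
Proof.
  intros Hg HM.
  assert (H : forall s t, a <= s -> s <= t -> t <= b -> Cmod (Cminus (g t) (g s)) <= M * t - M * s).
  { apply (mean_value_ineq g g' (fun t => M * t) (fun _ => M) Hg); [|exact HM].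
    intros t _. auto_derive; [exact I|ring]. }
  intros s t Hs Ht. destruct (Rle_dec s t) as [Hst|Hst].
  - rewrite Rabs_right by lra. specialize (H s t). lra.
  - rewrite Cmod_minus_sym, Rabs_left by lra. specialize (H t s). lra.
Qed.

(** * The norms *)

Lemma normCl_S l g : normCl a b (S l) g = supnorm a b g + normCl a b l (deriv_ab a b g).
Proof.
  unfold normCl. rewrite rsum_shift. f_equal. apply rsum_ext. intros j _.
  now rewrite nder_S.
Qed.

Lemma normCl_ext l g h : (forall t, a <= t <= b -> g t = h t) -> normCl a b l g = normCl a b l h.
Proof.
  intros H. apply rsum_ext. intros j _. apply supnorm_ext. intros t Ht.
  now apply nder_ext.
Qed.

Lemma supnorm_nder_ge0 l g j : isCl a b l g -> (j <= l)%nat -> 0 <= supnorm a b (nder a b j g).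
Proof. intros Hg Hj. apply supnorm_ge0. now apply (isCl_cont _ _ l). Qed.

Lemma normCl_ge0 l g : isCl a b l g -> 0 <= normCl a b l g.
Proof.
  intros Hg. apply rsum_nonneg. intros j Hj. apply (supnorm_nder_ge0 l); [exact Hg|lia].
Qed.

Lemma normCl_sup l g j : isCl a b l g -> (j <= l)%nat ->
  supnorm a b (nder a b j g) <= normCl a b l g.
Proof.
  intros Hg Hj. apply (rsum_term (S l) (fun j => supnorm a b (nder a b j g))); [|lia].
  intros i Hi. apply (supnorm_nder_ge0 l); [exact Hg|lia].
Qed.

Lemma normCl_term l g j t : isCl a b l g -> (j <= l)%nat -> a <= t <= b ->
  Cmod (nder a b j g t) <= normCl a b l g.
Proof.
  intros Hg Hj Ht. eapply Rle_trans; [|apply (normCl_sup l g j Hg Hj)].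
  apply supnorm_ub; [now apply (isCl_cont _ _ l)|exact Ht].
Qed.

Lemma normCl_le l g M :
  (forall j t, (j <= l)%nat -> a <= t <= b -> Cmod (nder a b j g t) <= M) ->
  normCl a b l g <= INR (S l) * M.
Proof.
  intros H. rewrite <- rsum_const. apply rsum_le. intros j Hj. apply supnorm_le.
  intros t Ht. apply H; [lia|exact Ht].
Qed.

Lemma normCl_lin l g h c : isCl a b l g -> isCl a b l h ->
  normCl a b l (fun t => Cplus (g t) (Cmult c (h t))) <= normCl a b l g + Cmod c * normCl a b l h.
Proof.
  intros Hg Hh. unfold normCl. rewrite <- rsum_lin. apply rsum_le. intros j Hj.
  apply supnorm_le. intros t Ht. rewrite (nder_lin a b hab l g h c Hg Hh) by (try lia; exact Ht).
  eapply Rle_trans; [apply Cmod_triangle|]. rewrite Cmod_mult.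
  apply Rplus_le_compat; [|apply Rmult_le_compat_l; [apply Cmod_ge_0|]];
    (apply supnorm_ub; [eapply isCl_cont; [eassumption|lia]|exact Ht]).
Qed.

Lemma normCl_mono l l' g : (l' <= l)%nat -> isCl a b l g -> normCl a b l' g <= normCl a b l g.
Proof.
  intros Hl Hg. apply rsum_mono_index; [lia|]. intros j Hj.
  apply (supnorm_nder_ge0 l); [exact Hg|lia].
Qed.

Lemma normCl_nder l j g : isCl a b (l + j) g -> normCl a b l (nder a b j g) <= normCl a b (l + j) g.
Proof.
  revert l g. induction j as [|j IH]; intros l g Hg.
  - rewrite Nat.add_0_r. apply Rle_refl.
  - replace (l + S j)%nat with (S (l + j)) in * by lia.
    rewrite nder_S, normCl_S.
    assert (H1 : isCl a b (l + j) (deriv_ab a b g)).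
    { apply (isCl_nder a b (l + j) 1). now rewrite Nat.add_1_r. }
    specialize (IH l _ H1). assert (H2 := supnorm_nder_ge0 _ g 0 Hg ltac:(lia)). simpl in H2.
    change (nder a b 0 g) with g in H2. lra.
Qed.

Lemma normCl_zero l : normCl a b l (fun _ => RtoC 0) = 0.
Proof.
  apply Rle_antisym; [|apply normCl_ge0, isCl_zero; exact hab].
  eapply Rle_trans; [apply (normCl_le l _ 0)|lra]. intros j t _ Ht.
  rewrite nder_zero by assumption. rewrite Cmod_0. lra.
Qed.

(** The 1 pays for the supremum of the product itself, the 2 for the two summands of its derivative;
    in closed form 2^(l+1) - 1. *)
Fixpoint leibniz_const (l : nat) : R :=
  match l with O => 1 | S l => 1 + 2 * leibniz_const l end.

Lemma leibniz_const_pos l : 0 < leibniz_const l.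
Proof. induction l as [|l IH]; simpl; lra. Qed.

Lemma normCl_mult l g h : isCl a b l g -> isCl a b l h ->
  normCl a b l (fun t => Cmult (g t) (h t)) <= leibniz_const l * normCl a b l g * normCl a b l h.
Proof.
  revert g h. induction l as [|l IH]; intros g h Hg Hh.
  - unfold normCl. simpl. rewrite !Rplus_0_l, Rmult_1_l. apply supnorm_le. intros t Ht.
    change (nder a b 0 ?f) with f. rewrite Cmod_mult.
    apply Rmult_le_compat; try apply Cmod_ge_0; apply supnorm_ub; try exact Ht;
      [apply Hg|apply Hh].
  - assert (D := deriv_ab_mult a b l g h Hg Hh).
    assert (Hg' : isCl a b l (deriv_ab a b g)) by (apply (isCl_nder a b l 1); now rewrite Nat.add_1_r).
    assert (Hh' : isCl a b l (deriv_ab a b h)) by (apply (isCl_nder a b l 1); now rewrite Nat.add_1_r).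
    assert (Hg0 := isCl_le a b (S l) l g ltac:(lia) Hg).
    assert (Hh0 := isCl_le a b (S l) l h ltac:(lia) Hh).
    rewrite normCl_S.
    rewrite (normCl_ext l (deriv_ab a b (fun t => Cmult (g t) (h t)))
      (fun t => Cplus (Cmult (deriv_ab a b g t) (h t)) (Cmult (RtoC 1) (Cmult (g t) (deriv_ab a b h t)))))
      by (intros t Ht; apply deriv_ab_eq; auto).
    assert (H1 := normCl_lin l (fun t => Cmult (deriv_ab a b g t) (h t))
      (fun t => Cmult (g t) (deriv_ab a b h t)) (RtoC 1)
      (isCl_mult a b hab l _ _ Hg' Hh0) (isCl_mult a b hab l _ _ Hg0 Hh')).
    rewrite Cmod_1, Rmult_1_l in H1.
    assert (H2 := IH _ _ Hg' Hh0). assert (H3 := IH _ _ Hg0 Hh').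
    assert (H4 := normCl_mono (S l) l g ltac:(lia) Hg).
    assert (H5 := normCl_mono (S l) l h ltac:(lia) Hh).
    assert (H6 := normCl_nder l 1 g). rewrite Nat.add_1_r in H6. specialize (H6 Hg).
    assert (H7 := normCl_nder l 1 h). rewrite Nat.add_1_r in H7. specialize (H7 Hh).
    change (nder a b 1 g) with (deriv_ab a b g) in H6. change (nder a b 1 h) with (deriv_ab a b h) in H7.
    assert (H8 : supnorm a b (fun t => Cmult (g t) (h t)) <= normCl a b (S l) g * normCl a b (S l) h).
    { apply supnorm_le. intros t Ht. rewrite Cmod_mult.
      apply Rmult_le_compat; try apply Cmod_ge_0;
        [apply (normCl_term (S l) g 0)|apply (normCl_term (S l) h 0)]; auto; lia. }
    assert (H9 := leibniz_const_pos l).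
    assert (Pg := normCl_ge0 _ _ Hg0). assert (Ph := normCl_ge0 _ _ Hh0).
    assert (Pg' := normCl_ge0 _ _ Hg'). assert (Ph' := normCl_ge0 _ _ Hh').
    set (G := normCl a b (S l) g) in *. set (H := normCl a b (S l) h) in *.
    assert (HA : leibniz_const l * normCl a b l (deriv_ab a b g) * normCl a b l h <= leibniz_const l * G * H).
    { rewrite !Rmult_assoc. apply Rmult_le_compat_l; [lra|]. apply Rmult_le_compat; lra. }
    assert (HB : leibniz_const l * normCl a b l g * normCl a b l (deriv_ab a b h) <= leibniz_const l * G * H).
    { rewrite !Rmult_assoc. apply Rmult_le_compat_l; [lra|]. apply Rmult_le_compat; lra. }
    simpl leibniz_const. lra.
Qed.

End Norms.

(** * Completeness of C^l *)

Lemma half_pow_pos J : 0 < (/ 2) ^ J.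
Proof. apply pow_lt. lra. Qed.

Lemma half_pow_small M eps : 0 < eps -> exists J, M * (/ 2) ^ J < eps.
Proof.
  intros Heps. assert (HM := Rabs_pos M).
  destruct (pow_lt_1_zero (/ 2) ltac:(rewrite Rabs_right; lra) (eps / (Rabs M + 1))) as [J HJ].
  { apply Rdiv_lt_0_compat; lra. }
  exists J. specialize (HJ J ltac:(lia)). assert (Hp := half_pow_pos J).
  rewrite Rabs_right in HJ by lra.
  apply (Rmult_lt_compat_r (Rabs M + 1)) in HJ; [|lra].
  unfold Rdiv in HJ. rewrite Rmult_assoc, Rinv_l, Rmult_1_r in HJ by lra.
  assert (M <= Rabs M) by apply Rle_abs. nra.
Qed.

(** Used to let an index tend to infinity in an inequality without speaking of limits. *)
Lemma le_of_half_pow x y M : (forall J, x <= y + M * (/ 2) ^ J) -> x <= y.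
Proof.
  intros H. apply Rnot_lt_le. intros Hlt.
  destruct (half_pow_small M (x - y) ltac:(lra)) as [J HJ]. specialize (H J). lra.
Qed.

Lemma im_le_Cmod (c : C) : Rabs (Im c) <= Cmod c.
Proof. destruct c as [x y]. eapply Rle_trans; [|apply Rmax_Cmod]. apply Rmax_r. Qed.

Lemma Cmod_le_re_im (c : C) : Cmod c <= Rabs (Re c) + Rabs (Im c).
Proof.
  destruct c as [x y]. simpl.
  replace (x, y) with (Cplus (RtoC x) (Cmult Ci (RtoC y))).
  - eapply Rle_trans; [apply Cmod_triangle|]. rewrite Cmod_mult, Cmod_Ci, !Cmod_R. lra.
  - unfold RtoC, Ci, Cplus, Cmult. simpl. f_equal; ring.
Qed.

Lemma geometric_telescope (z : nat -> C) M : (forall J, Cmod (Cminus (z (S J)) (z J)) <= M * (/ 2) ^ J) ->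
  forall J i, Cmod (Cminus (z (i + J)%nat) (z J)) <= 2 * M * (/ 2) ^ J.
Proof.
  intros H J i.
  (* The subtracted term makes the bound the exact partial sum of the geometric series, which is
     what the induction can carry. *)
  assert (Hs : Cmod (Cminus (z (i + J)%nat) (z J)) <= 2 * M * (/ 2) ^ J - 2 * M * (/ 2) ^ (i + J)).
  { induction i as [|i IH].
    - simpl. replace (Cminus (z J) (z J)) with (RtoC 0) by ring. rewrite Cmod_0. lra.
    - eapply Rle_trans; [apply (Cmod_triangle_minus _ (z (i + J)%nat))|].
      specialize (H (i + J)%nat). simpl in *. lra. }
  assert (HM : 0 <= M).
  { specialize (H 0%nat). simpl in H. assert (Hz := Cmod_ge_0 (Cminus (z 1%nat) (z 0%nat))). lra. }
  assert (Hp := half_pow_pos (i + J)). nra.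
Qed.

Lemma geometric_limit (z : nat -> C) M : (forall J, Cmod (Cminus (z (S J)) (z J)) <= M * (/ 2) ^ J) ->
  exists x, forall J, Cmod (Cminus x (z J)) <= 2 * M * (/ 2) ^ J.
Proof.
  intros H. assert (T := geometric_telescope z M H).
  assert (Hcv : forall u : C -> R, (forall x y, Rabs (u x - u y) <= Cmod (Cminus x y)) ->
    { l : R | Un_cv (fun J => u (z J)) l }).
  { intros u Hu. apply Stdlib.Reals.Rcomplete.R_complete. intros eps Heps.
    destruct (half_pow_small (2 * (2 * M)) eps Heps) as [J HJ]. exists J. intros n m Hn Hm.
    assert (H1 := T J (n - J)%nat). assert (H2 := T J (m - J)%nat).
    rewrite Nat.sub_add in H1, H2 by lia.
    unfold Rdist. eapply Rle_lt_trans; [apply Hu|].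
    eapply Rle_lt_trans; [apply (Cmod_triangle_minus _ (z J))|].
    rewrite (Cmod_minus_sym (z J)). lra. }
  destruct (Hcv Re (fun x y => re_le_Cmod (Cminus x y))) as [x Hx].
  destruct (Hcv Im (fun x y => im_le_Cmod (Cminus x y))) as [y Hy].
  exists (x, y). intros J. apply le_epsilon. intros eps Heps.
  destruct (Hx (eps / 2)) as [Nx HNx]; [lra|]. destruct (Hy (eps / 2)) as [Ny HNy]; [lra|].
  set (i := (Nx + Ny)%nat).
  eapply Rle_trans; [apply (Cmod_triangle_minus _ (z (i + J)%nat))|].
  rewrite Rplus_comm. apply Rplus_le_compat; [apply T|].
  specialize (HNx (i + J)%nat ltac:(unfold i; lia)). specialize (HNy (i + J)%nat ltac:(unfold i; lia)).
  unfold Rdist in *. rewrite Rabs_minus_sym in HNx. rewrite Rabs_minus_sym in HNy.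
  eapply Rle_trans; [apply Cmod_le_re_im|]. unfold Re, Im in *. destruct (z (i + J)%nat) as [u v].
  simpl in *. unfold Rminus in *. lra.
Qed.

(** The pointwise limits of the derivatives are shown to form a tower of derivatives.
    Differentiation passes to the limit because the difference of two members of the sequence has a
    uniformly small derivative, hence a small Lipschitz constant. *)
Lemma isCl_complete a b l (y : nat -> R -> C) M : a < b ->
  (forall J, isCl a b l (y J)) ->
  (forall J j t, (j <= l)%nat -> a <= t <= b ->
     Cmod (Cminus (nder a b j (y (S J)) t) (nder a b j (y J) t)) <= M * (/ 2) ^ J) ->
  exists g, isCl a b l g /\ forall J j t, (j <= l)%nat -> a <= t <= b ->
     Cmod (Cminus (nder a b j g t) (nder a b j (y J) t)) <= 2 * M * (/ 2) ^ J.
Proof.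
  intros hab Hy H.
  assert (HG : exists G : nat -> R -> C, forall J j t, (j <= l)%nat -> a <= t <= b ->
     Cmod (Cminus (G j t) (nder a b j (y J) t)) <= 2 * M * (/ 2) ^ J).
  { exists (fun j t => epsilon (inhabits (RtoC 0)) (fun x => forall J,
      Cmod (Cminus x (nder a b j (y J) t)) <= 2 * M * (/ 2) ^ J)).
    intros J j t Hj Ht. revert J. apply epsilon_spec.
    apply (geometric_limit (fun J => nder a b j (y J) t)). intros J. now apply H. }
  destruct HG as [G HG].
  assert (HM : 0 <= M).
  { specialize (H 0%nat 0%nat a ltac:(lia) ltac:(lra)). rewrite pow_O, Rmult_1_r in H.
    eapply Rle_trans; [apply Cmod_ge_0|exact H]. }
  assert (HGd : forall j, (j < l)%nat -> forall t, a <= t <= b -> is_deriv_ab a b (G j) t (G (S j) t)).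
  { intros j Hj t Ht eps Heps.
    (* 6 = 4 + 2: the first part bounds the increment of [G j] minus the J-th approximation ([H2]),
       the second the error of the derivative at t ([H3]). *)
    destruct (half_pow_small (6 * M) (eps / 2) ltac:(lra)) as [J HJ].
    destruct (proj1 (Hy J) j Hj t Ht (eps / 2) ltac:(lra)) as [delta [Hd H1]].
    exists delta. split; [exact Hd|]. intros s Hs Hst. specialize (H1 s Hs Hst).
    assert (HJp := half_pow_pos J).
    assert (H2 : Cmod (Cminus (Cminus (G j s) (nder a b j (y J) s)) (Cminus (G j t) (nder a b j (y J) t)))
       <= 4 * M * (/ 2) ^ J * Rabs (s - t)).
    { apply (le_of_half_pow _ _ (4 * M)). intros i.
      set (D := fun x => Cplus (nder a b j (y (i + J)%nat) x) (Cmult (Copp (RtoC 1)) (nder a b j (y J) x))).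
      set (D' := fun x => Cplus (nder a b (S j) (y (i + J)%nat) x) (Cmult (Copp (RtoC 1)) (nder a b (S j) (y J) x))).
      assert (HD : Cmod (Cminus (D s) (D t)) <= 2 * M * (/ 2) ^ J * Rabs (s - t)).
      { apply (lipschitz_of_deriv_bound a b hab D D'); auto.
        - intros x Hx. apply is_deriv_ab_lin; now apply Hy.
        - intros x Hx. unfold D'.
          replace (Cplus _ _) with (Cminus (nder a b (S j) (y (i + J)%nat) x) (nder a b (S j) (y J) x))
            by ring.
          apply (geometric_telescope (fun J => nder a b (S j) (y J) x) M).
          intros J'. apply H; [lia|exact Hx]. }
      replace (Cminus (Cminus (G j s) (nder a b j (y J) s)) (Cminus (G j t) (nder a b j (y J) t)))
        with (Cplus (Cminus (D s) (D t)) (Cminus (Cminus (G j s) (nder a b j (y (i + J)%nat) s))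
           (Cminus (G j t) (nder a b j (y (i + J)%nat) t)))) by (unfold D; ring).
      assert (Hs1 := HG (i + J)%nat j s ltac:(lia) Hs). assert (Ht1 := HG (i + J)%nat j t ltac:(lia) Ht).
      assert (Hpow : (/ 2) ^ (i + J) <= (/ 2) ^ i).
      { rewrite pow_add. rewrite <- (Rmult_1_r ((/ 2) ^ i)) at 2.
        apply Rmult_le_compat_l; [apply Rlt_le, half_pow_pos|].
        rewrite <- (pow1 J). apply pow_incr. lra. }
      assert (HMp : M * (/ 2) ^ (i + J) <= M * (/ 2) ^ i) by (apply Rmult_le_compat_l; auto).
      assert (Hab := Rabs_pos (s - t)).
      assert (0 <= M * (/ 2) ^ J * Rabs (s - t)).
      { repeat apply Rmult_le_pos; lra. }
      eapply Rle_trans; [apply Cmod_triangle|].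
      eapply Rle_trans; [apply Rplus_le_compat_l, Cmod_minus_le|]. lra. }
    assert (H3 := HG J (S j) t ltac:(lia) Ht).
    match goal with |- Cmod ?X <= _ => replace X with
      (Cminus (Cplus (Cminus (Cminus (G j s) (nder a b j (y J) s)) (Cminus (G j t) (nder a b j (y J) t)))
        (Cminus (Cminus (nder a b j (y J) s) (nder a b j (y J) t)) (Cmult (RtoC (s - t)) (nder a b (S j) (y J) t))))
        (Cmult (RtoC (s - t)) (Cminus (G (S j) t) (nder a b (S j) (y J) t)))) by ring end.
    eapply Rle_trans; [apply Cmod_minus_le|].
    eapply Rle_trans; [apply Rplus_le_compat_r, Cmod_triangle|].
    rewrite (Cmod_mult (RtoC (s - t)) (Cminus _ _)), Cmod_R.
    assert (Hab := Rabs_pos (s - t)).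
    assert (H4 : Rabs (s - t) * Cmod (Cminus (G (S j) t) (nder a b (S j) (y J) t)) <=
      Rabs (s - t) * (2 * M * (/ 2) ^ J)) by (apply Rmult_le_compat_l; auto).
    assert (H5 : 6 * M * (/ 2) ^ J * Rabs (s - t) <= eps / 2 * Rabs (s - t)).
    { apply Rmult_le_compat_r; lra. }
    lra. }
  assert (HGc : cont_ab a b (G l)).
  { intros t Ht eps Heps.
    destruct (half_pow_small (2 * M) (eps / 3) ltac:(lra)) as [J HJ].
    destruct (proj2 (Hy J) t Ht (eps / 3) ltac:(lra)) as [delta [Hd H1]].
    exists delta. split; [exact Hd|]. intros s Hs Hst. specialize (H1 s Hs Hst).
    assert (H2 := HG J l s ltac:(lia) Hs). assert (H3 := HG J l t ltac:(lia) Ht).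
    eapply Rle_lt_trans; [apply (Cmod_triangle_minus _ (nder a b l (y J) s))|].
    eapply Rle_lt_trans; [apply Rplus_le_compat_l, (Cmod_triangle_minus _ (nder a b l (y J) t))|].
    rewrite (Cmod_minus_sym (nder a b l (y J) t) (G l t)). lra. }
  exists (G 0%nat). split; [now apply (isCl_tower a b hab l G)|].
  intros J j t Hj Ht. rewrite (nder_tower a b hab l G HGd) by assumption. now apply HG.
Qed.

(** * Vector-valued functions *)

Definition vzero : vfun := fun _ _ => RtoC 0.

Definition vcomb (N : nat) (c : nat -> C) (h : nat -> vfun) : vfun :=
  fun i t => csum N (fun k => Cmult (c k) (h k i t)).

Lemma vcomb_S N c h : vcomb (S N) c h = vlin (vcomb N c h) (c N) (h N).
Proof. reflexivity. Qed.

Lemma vsub_vlin y z : vsub y z = vlin y (Copp (RtoC 1)) z.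
Proof.
  apply functional_extensionality; intros i. apply functional_extensionality; intros t.
  unfold vsub, vlin. ring.
Qed.

Section Vectors.

Context (a b : R) (hab : a < b) (m : nat).

Lemma isCl_csum l N (F : nat -> R -> C) : (forall j, (j < N)%nat -> isCl a b l (F j)) ->
  isCl a b l (fun t => csum N (fun j => F j t)) /\
  normCl a b l (fun t => csum N (fun j => F j t)) <= rsum N (fun j => normCl a b l (F j)).
Proof.
  induction N as [|N IH]; intros H.
  - split; [now apply isCl_zero|]. simpl. rewrite normCl_zero by assumption. lra.
  - destruct IH as [H1 H2]; [intros; apply H; lia|].
    assert (H3 := H N ltac:(lia)).
    assert (E : forall t, a <= t <= b -> Cplus (csum N (fun j => F j t)) (Cmult (RtoC 1) (F N t)) =
      csum (S N) (fun j => F j t)) by (intros; simpl; ring).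
    split.
    + eapply isCl_ext; [exact E|]. apply isCl_lin; assumption.
    + rewrite <- (normCl_ext a b _ _ _ E).
      eapply Rle_trans; [apply normCl_lin; assumption|]. rewrite Cmod_1. simpl. lra.
Qed.

Lemma isClVec_lin l y z c : isClVec a b l m y -> isClVec a b l m z -> isClVec a b l m (vlin y c z).
Proof. intros Hy Hz i Hi. apply isCl_lin; auto. Qed.

Lemma isClVec_sub l y z : isClVec a b l m y -> isClVec a b l m z -> isClVec a b l m (vsub y z).
Proof. rewrite vsub_vlin. apply isClVec_lin. Qed.

Lemma isClVec_zero l : isClVec a b l m vzero.
Proof. intros i Hi. now apply isCl_zero. Qed.

Lemma isClVec_comb l N c h : (forall k, (k < N)%nat -> isClVec a b l m (h k)) ->
  isClVec a b l m (vcomb N c h).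
Proof.
  induction N as [|N IH]; intros H; [apply isClVec_zero|].
  rewrite vcomb_S. apply isClVec_lin; [apply IH; intros; apply H|apply H]; lia.
Qed.

Lemma normClVec_ext l y z : (forall i t, (i < m)%nat -> a <= t <= b -> y i t = z i t) ->
  normClVec a b l m y = normClVec a b l m z.
Proof. intros H. apply rsum_ext. intros i Hi. apply normCl_ext; auto. Qed.

Lemma normClVec_ge0 l y : isClVec a b l m y -> 0 <= normClVec a b l m y.
Proof. intros H. apply rsum_nonneg. intros i Hi. apply normCl_ge0; auto. Qed.

Lemma normClVec_lin l y z c : isClVec a b l m y -> isClVec a b l m z ->
  normClVec a b l m (vlin y c z) <= normClVec a b l m y + Cmod c * normClVec a b l m z.
Proof.
  intros Hy Hz. unfold normClVec. rewrite <- rsum_lin. apply rsum_le. intros i Hi.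
  apply normCl_lin; auto.
Qed.

Lemma normClVec_sub l y z : isClVec a b l m y -> isClVec a b l m z ->
  normClVec a b l m (vsub y z) <= normClVec a b l m y + normClVec a b l m z.
Proof.
  intros Hy Hz. rewrite vsub_vlin. eapply Rle_trans; [now apply normClVec_lin|].
  rewrite Cmod_opp, Cmod_1. lra.
Qed.

Lemma normClVec_zero l : normClVec a b l m vzero = 0.
Proof.
  unfold normClVec. transitivity (rsum m (fun _ => 0)).
  - apply rsum_ext. intros i _. now apply normCl_zero.
  - rewrite rsum_const. ring.
Qed.

Lemma normClVec_comb l N c h : (forall k, (k < N)%nat -> isClVec a b l m (h k)) ->
  normClVec a b l m (vcomb N c h) <= rsum N (fun k => Cmod (c k) * normClVec a b l m (h k)).
Proof.
  induction N as [|N IH]; intros H.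
  - simpl. change (vcomb 0 c h) with vzero. rewrite normClVec_zero. lra.
  - rewrite vcomb_S. eapply Rle_trans; [apply normClVec_lin|].
    + apply isClVec_comb. intros; apply H; lia.
    + apply H. lia.
    + simpl. apply Rplus_le_compat_r, IH. intros; apply H; lia.
Qed.

Lemma normCl_le_Vec l y i : isClVec a b l m y -> (i < m)%nat ->
  normCl a b l (y i) <= normClVec a b l m y.
Proof.
  intros Hy Hi. apply (rsum_term m (fun i => normCl a b l (y i))); [|exact Hi].
  intros. apply normCl_ge0; auto.
Qed.

Lemma normClVec_term l y i j t : isClVec a b l m y -> (i < m)%nat -> (j <= l)%nat -> a <= t <= b ->
  Cmod (nder a b j (y i) t) <= normClVec a b l m y.
Proof.
  intros Hy Hi Hj Ht. eapply Rle_trans; [|apply (normCl_le_Vec _ _ i Hy Hi)].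
  apply normCl_term; auto.
Qed.

Lemma normClVec_le l y M :
  (forall i j t, (i < m)%nat -> (j <= l)%nat -> a <= t <= b -> Cmod (nder a b j (y i) t) <= M) ->
  normClVec a b l m y <= INR m * (INR (S l) * M).
Proof.
  intros H. rewrite <- rsum_const. apply rsum_le. intros i Hi. apply normCl_le; auto.
Qed.

Lemma normClVec_mono l l' y : (l' <= l)%nat -> isClVec a b l m y ->
  normClVec a b l' m y <= normClVec a b l m y.
Proof. intros Hl Hy. apply rsum_le. intros i Hi. apply normCl_mono; auto. Qed.

Lemma normClVec_le0 l y : isClVec a b l m y -> normClVec a b l m y <= 0 ->
  forall i t, (i < m)%nat -> a <= t <= b -> y i t = RtoC 0.
Proof.
  intros Hy H i t Hi Ht. apply Cmod_eq_0, Rle_antisym; [|apply Cmod_ge_0].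
  eapply Rle_trans; [apply (normClVec_term l y i 0 t); auto; lia|exact H].
Qed.

Lemma nder_comb l N c h i j t : (forall k, (k < N)%nat -> isClVec a b l m (h k)) ->
  (i < m)%nat -> (j <= l)%nat -> a <= t <= b ->
  nder a b j (vcomb N c h i) t = csum N (fun k => Cmult (c k) (nder a b j (h k i) t)).
Proof.
  intros H Hi Hj Ht. induction N as [|N IH].
  - simpl. now apply nder_zero.
  - rewrite vcomb_S. unfold vlin. rewrite (nder_lin a b hab l); auto.
    + simpl. f_equal. apply IH. intros; apply H; lia.
    + apply isClVec_comb; [|exact Hi]. intros; apply H; lia.
    + apply H; [lia|exact Hi].
Qed.

Lemma isClVec_complete l (y : nat -> vfun) M :
  (forall J, isClVec a b l m (y J)) ->
  (forall J, normClVec a b l m (vsub (y (S J)) (y J)) <= M * (/ 2) ^ J) ->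
  exists z, isClVec a b l m z /\ forall J,
    normClVec a b l m (vsub z (y J)) <= INR m * (INR (S l) * (2 * M)) * (/ 2) ^ J.
Proof.
  intros Hy H.
  assert (HD : forall u v i j t, isClVec a b l m u -> isClVec a b l m v -> (i < m)%nat ->
    (j <= l)%nat -> a <= t <= b ->
    nder a b j (vsub u v i) t = Cminus (nder a b j (u i) t) (nder a b j (v i) t)).
  { intros u v i j t Hu Hv Hi Hj Ht. rewrite vsub_vlin. unfold vlin.
    rewrite (nder_lin a b hab l) by auto. ring. }
  (* Keeping [i < m] inside the existential makes the choice below a total function of the index. *)
  assert (HZ : forall i, exists g, (i < m)%nat -> isCl a b l g /\ forall J j t, (j <= l)%nat -> a <= t <= b ->
     Cmod (Cminus (nder a b j g t) (nder a b j (y J i) t)) <= 2 * M * (/ 2) ^ J).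
  { intros i. destruct (Nat.le_gt_cases m i) as [Hi|Hi].
    { exists (fun _ => RtoC 0). lia. }
    destruct (isCl_complete a b l (fun J => y J i) M hab) as [g Hg].
    - intros J. now apply Hy.
    - intros J j t Hj Ht. rewrite <- HD by auto. eapply Rle_trans; [|apply H].
      apply normClVec_term; auto. now apply isClVec_sub.
    - now exists g. }
  exists (fun i => epsilon (inhabits (fun _ => RtoC 0)) (fun g => (i < m)%nat -> isCl a b l g /\
    forall J j t, (j <= l)%nat -> a <= t <= b ->
     Cmod (Cminus (nder a b j g t) (nder a b j (y J i) t)) <= 2 * M * (/ 2) ^ J)).
  match goal with |- isClVec _ _ _ _ ?zz /\ _ => set (z := zz) end.
  assert (Hz : forall i, (i < m)%nat -> isCl a b l (z i) /\
    forall J j t, (j <= l)%nat -> a <= t <= b ->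
     Cmod (Cminus (nder a b j (z i) t) (nder a b j (y J i) t)) <= 2 * M * (/ 2) ^ J).
  { intros i. apply epsilon_spec, HZ. }
  assert (Hz1 : isClVec a b l m z) by (intros i Hi; now apply Hz).
  split; [exact Hz1|]. intros J. rewrite !Rmult_assoc. apply normClVec_le.
  intros i j t Hi Hj Ht. rewrite HD by auto. rewrite <- Rmult_assoc. now apply Hz.
Qed.

(** * The differential operator *)

Context (r : nat) (hr : (1 <= r)%nat).

(** Kept apart from the leading derivative because two operators with different coefficients differ
    only here, and because these terms involve derivatives of order below r only. *)
Definition lower_terms (M : nat -> mfun) (y : vfun) : vfun := fun i t =>
  csum r (fun l => csum m (fun s => Cmult (M (r - S l)%nat i s t) (nder a b (r - S l) (y s) t))).

Lemma normCl_le_Mat l M i j : isClMat a b l m M -> (i < m)%nat -> (j < m)%nat ->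
  normCl a b l (M i j) <= normClMat a b l m M.
Proof.
  intros HM Hi Hj. eapply Rle_trans; [|apply (rsum_term m (fun i => rsum m (fun j => normCl a b l (M i j))))].
  - apply (rsum_term m (fun j => normCl a b l (M i j))); [|exact Hj].
    intros. apply normCl_ge0; auto.
  - intros. apply rsum_nonneg. intros. apply normCl_ge0; auto.
  - exact Hi.
Qed.

Definition lower_const (l : nat) : R := INR m * (INR r * (INR m * leibniz_const l)).

Lemma lower_const_ge0 l : 0 <= lower_const l.
Proof.
  assert (H := leibniz_const_pos l). unfold lower_const.
  repeat apply Rmult_le_pos; try apply pos_INR. lra.
Qed.

(** Only [l + pred r] derivatives of y enter, one fewer than for y^(r) in C^l. This gap is what lets
    the regularity estimate gain a derivative. *)
Lemma lower_terms_bound l M y e :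
  (forall j, (j < r)%nat -> isClMat a b l m (M j)) ->
  (forall j, (j < r)%nat -> normClMat a b l m (M j) <= e) ->
  isClVec a b (l + pred r) m y ->
  isClVec a b l m (lower_terms M y) /\
  normClVec a b l m (lower_terms M y) <= lower_const l * e * normClVec a b (l + pred r) m y.
Proof.
  intros HM He Hy.
  set (Y := normClVec a b (l + pred r) m y).
  assert (HYd : forall l' s, (l' < r)%nat -> (s < m)%nat -> isCl a b l (nder a b (r - S l') (y s)) /\
     normCl a b l (nder a b (r - S l') (y s)) <= Y).
  { intros l' s Hl' Hs.
    assert (Hys : isCl a b (l + (r - S l')) (y s)).
    { apply (isCl_le a b (l + pred r)); [lia|now apply Hy]. }
    split; [now apply isCl_nder|].
    eapply Rle_trans; [now apply normCl_nder|].
    eapply Rle_trans; [|apply (normCl_le_Vec _ _ s Hy Hs)].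
    apply normCl_mono; [exact hab|lia|now apply Hy]. }
  assert (HP : forall i l' s, (i < m)%nat -> (l' < r)%nat -> (s < m)%nat ->
    isCl a b l (fun t => Cmult (M (r - S l')%nat i s t) (nder a b (r - S l') (y s) t)) /\
    normCl a b l (fun t => Cmult (M (r - S l')%nat i s t) (nder a b (r - S l') (y s) t)) <=
      leibniz_const l * e * Y).
  { intros i l' s Hi Hl Hs. destruct (HYd l' s Hl Hs) as [H1 H2].
    assert (H3 : isCl a b l (M (r - S l')%nat i s)) by (apply HM; auto; lia).
    split; [now apply isCl_mult|].
    eapply Rle_trans; [now apply normCl_mult|].
    assert (H4 : normCl a b l (M (r - S l')%nat i s) <= e).
    { eapply Rle_trans; [apply normCl_le_Mat|apply He]; auto; [apply HM|]; lia. }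
    assert (H5 := leibniz_const_pos l). rewrite !Rmult_assoc. apply Rmult_le_compat_l; [lra|].
    apply Rmult_le_compat; auto; now apply normCl_ge0. }
  assert (HI : forall i l', (i < m)%nat -> (l' < r)%nat ->
    isCl a b l (fun t => csum m (fun s => Cmult (M (r - S l')%nat i s t) (nder a b (r - S l') (y s) t))) /\
    normCl a b l (fun t => csum m (fun s => Cmult (M (r - S l')%nat i s t) (nder a b (r - S l') (y s) t)))
      <= INR m * (leibniz_const l * e * Y)).
  { intros i l' Hi Hl.
    destruct (isCl_csum l m (fun s t => Cmult (M (r - S l')%nat i s t) (nder a b (r - S l') (y s) t))) as [H1 H2].
    { intros s Hs. now apply HP. }
    split; [exact H1|]. eapply Rle_trans; [exact H2|]. rewrite <- rsum_const.
    apply rsum_le. intros s Hs. now apply HP. }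
  assert (HE : forall i, (i < m)%nat -> isCl a b l (lower_terms M y i) /\
     normCl a b l (lower_terms M y i) <= INR r * (INR m * (leibniz_const l * e * Y))).
  { intros i Hi. unfold lower_terms.
    destruct (isCl_csum l r (fun l' t => csum m (fun s => Cmult (M (r - S l')%nat i s t)
       (nder a b (r - S l') (y s) t)))) as [H1 H2].
    { intros l' Hl. now apply HI. }
    split; [exact H1|]. eapply Rle_trans; [exact H2|]. rewrite <- rsum_const.
    apply rsum_le. intros l' Hl. now apply HI. }
  split; [intros i Hi; now apply HE|].
  replace (lower_const l * e * Y) with (INR m * (INR r * (INR m * (leibniz_const l * e * Y))))
    by (unfold lower_const; ring).
  rewrite <- rsum_const. apply rsum_le. intros i Hi. now apply HE.
Qed.

Lemma ode_lhs_split A y i t :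
  ode_lhs a b r m A y i t = Cplus (nder a b r (y i) t) (lower_terms A y i t).
Proof. reflexivity. Qed.

Lemma ode_lhs_diff A A' y i t :
  Cminus (ode_lhs a b r m A y i t) (ode_lhs a b r m A' y i t) =
  lower_terms (fun j => msub (A j) (A' j)) y i t.
Proof.
  rewrite !ode_lhs_split.
  assert (E : lower_terms (fun j => msub (A j) (A' j)) y i t =
     Cminus (lower_terms A y i t) (lower_terms A' y i t)).
  { unfold lower_terms, msub. rewrite <- csum_minus. apply csum_ext. intros l _.
    rewrite <- csum_minus. apply csum_ext. intros s _. ring. }
  rewrite E. ring.
Qed.

Lemma ode_lhs_lin n A y z c i t : (r <= n)%nat -> isClVec a b n m y -> isClVec a b n m z ->
  (i < m)%nat -> a <= t <= b ->
  ode_lhs a b r m A (vlin y c z) i t =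
  Cplus (ode_lhs a b r m A y i t) (Cmult c (ode_lhs a b r m A z i t)).
Proof.
  intros Hn Hy Hz Hi Ht. rewrite !ode_lhs_split.
  assert (E : lower_terms A (vlin y c z) i t =
     Cplus (lower_terms A y i t) (Cmult c (lower_terms A z i t))).
  { unfold lower_terms. rewrite <- csum_lin. apply csum_ext. intros l Hl.
    rewrite <- csum_lin. apply csum_ext. intros s Hs. unfold vlin.
    rewrite (nder_lin a b hab n) by (auto; lia). ring. }
  rewrite E. unfold vlin. rewrite (nder_lin a b hab n) by auto. ring.
Qed.

Lemma ode_lhs_comb n A N c h i t : (r <= n)%nat -> (forall k, (k < N)%nat -> isClVec a b n m (h k)) ->
  (i < m)%nat -> a <= t <= b ->
  ode_lhs a b r m A (vcomb N c h) i t = csum N (fun k => Cmult (c k) (ode_lhs a b r m A (h k) i t)).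
Proof.
  intros Hn H Hi Ht. induction N as [|N IH].
  - rewrite ode_lhs_split. simpl csum. unfold lower_terms.
    rewrite (csum_zero r).
    + change (vcomb 0 c h i) with (fun _ : R => RtoC 0). rewrite nder_zero by auto. ring.
    + intros l _. apply csum_zero. intros s _.
      change (vcomb 0 c h s) with (fun _ : R => RtoC 0). rewrite nder_zero by auto. ring.
  - rewrite vcomb_S, (ode_lhs_lin n); auto.
    + simpl. f_equal. apply IH. intros; apply H; lia.
    + apply isClVec_comb. intros; apply H; lia.
Qed.

Lemma normClMat_bound l M : (forall j, (j < r)%nat -> isClMat a b l m (M j)) ->
  exists e, 0 <= e /\ forall j, (j < r)%nat -> normClMat a b l m (M j) <= e.
Proof.
  intros HM.
  assert (Hp : forall j, (j < r)%nat -> 0 <= normClMat a b l m (M j)).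
  { intros j Hj. apply rsum_nonneg. intros i Hi. apply rsum_nonneg. intros s Hs.
    apply normCl_ge0; [exact hab|]. now apply HM. }
  exists (rsum r (fun j => normClMat a b l m (M j))). split; [now apply rsum_nonneg|].
  intros j Hj. now apply (rsum_term r (fun j => normClMat a b l m (M j))).
Qed.

Lemma ode_lhs_isCl n A y : (r <= n)%nat -> (forall j, (j < r)%nat -> isClMat a b (n - r) m (A j)) ->
  isClVec a b n m y -> isClVec a b (n - r) m (ode_lhs a b r m A y).
Proof.
  intros Hn HA Hy.
  destruct (normClMat_bound (n - r) A HA) as [e [_ He]].
  destruct (lower_terms_bound (n - r) A y e HA He) as [H1 _].
  { intros i Hi. apply (isCl_le a b n); [lia|now apply Hy]. }
  intros i Hi.
  apply (isCl_ext a b (n - r) (fun t => Cplus (nder a b r (y i) t) (Cmult (RtoC 1) (lower_terms A y i t)))).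
  - intros t _. rewrite ode_lhs_split. ring.
  - apply isCl_lin; [exact hab| |now apply H1].
    apply isCl_nder. rewrite Nat.sub_add by lia. now apply Hy.
Qed.

Lemma ode_lhs_bound n A : (r <= n)%nat -> (forall j, (j < r)%nat -> isClMat a b (n - r) m (A j)) ->
  exists K, 0 <= K /\ forall y, isClVec a b n m y ->
    normClVec a b (n - r) m (ode_lhs a b r m A y) <= K * normClVec a b n m y.
Proof.
  intros Hn HA. destruct (normClMat_bound (n - r) A HA) as [e [He0 He]].
  assert (Hc := lower_const_ge0 (n - r)).
  exists (1 + lower_const (n - r) * e). split; [nra|]. intros y Hy.
  assert (Hy' : isClVec a b (n - r + pred r) m y).
  { intros i Hi. apply (isCl_le a b n); [lia|now apply Hy]. }
  destruct (lower_terms_bound (n - r) A y e HA He Hy') as [H1 H2].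
  assert (H3 : normClVec a b (n - r + pred r) m y <= normClVec a b n m y).
  { apply normClVec_mono; [lia|exact Hy]. }
  assert (H4 : isClVec a b (n - r) m (fun i => nder a b r (y i))).
  { intros i Hi. apply isCl_nder. rewrite Nat.sub_add by lia. now apply Hy. }
  assert (H5 : normClVec a b (n - r) m (fun i => nder a b r (y i)) <= normClVec a b n m y).
  { apply rsum_le. intros i Hi. rewrite <- (Nat.sub_add r n) at 2 by lia. apply normCl_nder; [exact hab|].
    rewrite Nat.sub_add by lia. now apply Hy. }
  assert (H6 := normClVec_lin (n - r) _ _ (RtoC 1) H4 H1). rewrite Cmod_1, Rmult_1_l in H6.
  rewrite (normClVec_ext _ _ (ode_lhs a b r m A y)) in H6
    by (intros; unfold vlin; rewrite ode_lhs_split; ring).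
  assert (0 <= lower_const (n - r) * e) by (apply Rmult_le_pos; auto).
  assert (lower_const (n - r) * e * normClVec a b (n - r + pred r) m y <=
     lower_const (n - r) * e * normClVec a b n m y) by (apply Rmult_le_compat_l; auto).
  lra.
Qed.

Lemma ode_lhs_diff_bound n A A' e y : (r <= n)%nat ->
  (forall j, (j < r)%nat -> isClMat a b (n - r) m (msub (A j) (A' j))) ->
  (forall j, (j < r)%nat -> normClMat a b (n - r) m (msub (A j) (A' j)) <= e) -> 0 <= e ->
  isClVec a b n m y ->
  normClVec a b (n - r) m (vsub (ode_lhs a b r m A y) (ode_lhs a b r m A' y)) <=
    lower_const (n - r) * e * normClVec a b n m y.
Proof.
  intros Hn HM He He0 Hy.
  assert (Hy' : isClVec a b (n - r + pred r) m y).
  { intros i Hi. apply (isCl_le a b n); [lia|now apply Hy]. }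
  destruct (lower_terms_bound (n - r) _ y e HM He Hy') as [_ H2].
  rewrite (normClVec_ext _ _ (lower_terms (fun j => msub (A j) (A' j)) y))
    by (intros; unfold vsub; apply ode_lhs_diff).
  eapply Rle_trans; [exact H2|]. apply Rmult_le_compat_l.
  - apply Rmult_le_pos; [apply lower_const_ge0|exact He0].
  - apply normClVec_mono; [lia|exact Hy].
Qed.

Lemma exp_mono x y : x <= y -> exp x <= exp y.
Proof. intros [H| ->]; [now apply Rlt_le, exp_increasing|apply Rle_refl]. Qed.

(* The weighted bounds N exp(lam (t - a)) on the derivatives of order < r improve from N to
   (N + F) / 2, so iterating gives the Gronwall bound F exp(lam (t - a)). *)
Lemma zero_cauchy_gronwall n A : (r <= n)%nat ->
  (forall j, (j < r)%nat -> isClMat a b (n - r) m (A j)) ->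
  exists K, 0 <= K /\ forall y, isClVec a b n m y ->
    (forall j i, (j < r)%nat -> (i < m)%nat -> nder a b j (y i) a = RtoC 0) ->
    normClVec a b (pred r) m y <= K * normClVec a b (n - r) m (ode_lhs a b r m A y).
Proof.
  intros Hn HA. destruct (normClMat_bound (n - r) A HA) as [mu [Hmu0 Hmu]].
  (* If all derivatives of order below r are bounded by U at a point, then [alpha * U] bounds the
     lower-order terms there. *)
  set (alpha := INR r * (INR m * mu)).
  assert (Ha : 0 <= alpha) by (unfold alpha; repeat apply Rmult_le_pos; auto; apply pos_INR).
  (* Chosen so that integrating (F + (1 + alpha) N) w gives at most F / lam + N / 2 times w, which
     is at most (N + F) / 2 times w since lam >= 2. *)
  set (lam := 2 * (1 + alpha)).
  exists (INR m * (INR (S (pred r)) * exp (lam * (b - a)))). split.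
  { repeat apply Rmult_le_pos; try apply pos_INR. apply Rlt_le, exp_pos. }
  intros y Hy H0. set (F := normClVec a b (n - r) m (ode_lhs a b r m A y)).
  assert (HL := ode_lhs_isCl n A y Hn HA Hy).
  assert (HF0 : 0 <= F) by now apply normClVec_ge0.
  set (w := fun t => exp (lam * (t - a))).
  assert (Hw1 : forall t, a <= t -> 1 <= w t).
  { intros t Ht. unfold w. rewrite <- exp_0. apply exp_mono.
    apply Rmult_le_pos; unfold lam; lra. }
  assert (Htop : forall U i t, (i < m)%nat -> a <= t <= b ->
    (forall j s, (j < r)%nat -> (s < m)%nat -> Cmod (nder a b j (y s) t) <= U) ->
    Cmod (nder a b r (y i) t) <= F + alpha * U).
  { intros U i t Hi Ht HU.
    replace (nder a b r (y i) t) with (Cminus (ode_lhs a b r m A y i t) (lower_terms A y i t))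
      by (rewrite ode_lhs_split; ring).
    eapply Rle_trans; [apply Cmod_minus_le|]. apply Rplus_le_compat.
    - apply (normClVec_term (n - r) _ i 0 t HL Hi); [lia|exact Ht].
    - unfold lower_terms, alpha. eapply Rle_trans; [apply Cmod_csum|].
      rewrite !Rmult_assoc, <- rsum_const. apply rsum_le. intros l Hl.
      eapply Rle_trans; [apply Cmod_csum|]. rewrite <- rsum_const. apply rsum_le. intros s Hs.
      rewrite Cmod_mult. apply Rmult_le_compat; try apply Cmod_ge_0.
      + eapply Rle_trans; [apply (normCl_term a b hab (n - r) (A (r - S l)%nat i s) 0 t)|].
        * apply HA; auto; lia.
        * lia.
        * exact Ht.
        * eapply Rle_trans; [apply normCl_le_Mat|apply Hmu]; auto; [apply HA|]; lia.
      + apply HU; auto; lia. }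
  assert (Hstep : forall N, 0 <= N ->
    (forall j i t, (j < r)%nat -> (i < m)%nat -> a <= t <= b -> Cmod (nder a b j (y i) t) <= N * w t) ->
    forall j i t, (j < r)%nat -> (i < m)%nat -> a <= t <= b -> Cmod (nder a b j (y i) t) <= (N + F) / 2 * w t).
  { intros N HN H j i t Hj Hi Ht.
    set (K := F + (1 + alpha) * N).
    assert (HK : 0 <= K) by (unfold K; nra).
    assert (Hlam : 0 < lam) by (unfold lam; lra).
    assert (H1 : Cmod (Cminus (nder a b j (y i) t) (nder a b j (y i) a)) <= K / lam * w t - K / lam * w a).
    { apply (mean_value_ineq a b hab _ (nder a b (S j) (y i)) (fun t => K / lam * w t) (fun t => K * w t)); try lra.
      - intros s Hs. apply (Hy i Hi); [lia|exact Hs].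
      - intros s _. unfold w, Rminus. auto_derive; [exact I|]. field. lra.
      - intros s Hs. assert (Hw := Hw1 s ltac:(lra)).
        assert (0 <= N * w s) by (apply Rmult_le_pos; lra).
        assert (0 <= alpha * (N * w s)) by (apply Rmult_le_pos; lra).
        assert (F <= F * w s) by nra.
        (* The derivative of order r is bounded through the differential equation, those of lower
           order by the current bound. *)
        destruct (Nat.le_gt_cases r (S j)) as [Hr|Hr].
        + replace (S j) with r by lia.
          eapply Rle_trans; [apply (Htop (N * w s) i s Hi Hs)|].
          * intros; now apply H.
          * unfold K. nra.
        + eapply Rle_trans; [apply (H (S j) i s Hr Hi Hs)|]. unfold K. nra. }
    rewrite (H0 j i Hj Hi) in H1.
    replace (Cminus (nder a b j (y i) t) (RtoC 0)) with (nder a b j (y i) t) in H1 by ring.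
    assert (Hwt := Hw1 t ltac:(lra)). assert (Hwa := Hw1 a ltac:(lra)).
    assert (HKl : 0 <= K / lam <= (N + F) / 2).
    { split; [apply Rmult_le_pos; [lra|apply Rlt_le, Rinv_0_lt_compat; lra]|].
      apply (Rmult_le_reg_r lam); [lra|]. unfold Rdiv at 1. rewrite Rmult_assoc, Rinv_l, Rmult_1_r by lra.
      unfold K, lam. nra. }
    nra. }
  set (N0 := normClVec a b n m y).
  assert (HN0 : 0 <= N0) by now apply normClVec_ge0.
  assert (Hit : forall J j i t, (j < r)%nat -> (i < m)%nat -> a <= t <= b ->
     Cmod (nder a b j (y i) t) <= (F + N0 * (/ 2) ^ J) * w t).
  { intros J. induction J as [|J IH].
    - intros j i t Hj Hi Ht. rewrite pow_O, Rmult_1_r.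
      assert (Cmod (nder a b j (y i) t) <= N0) by (apply normClVec_term; auto; lia).
      assert (Hwt := Hw1 t ltac:(lra)). nra.
    - intros j i t Hj Hi Ht. assert (Hp := half_pow_pos J).
      replace (F + N0 * (/ 2) ^ S J) with ((F + N0 * (/ 2) ^ J + F) / 2) by (simpl; field).
      apply Hstep; auto. apply Rplus_le_le_0_compat; [exact HF0|]. apply Rmult_le_pos; lra. }
  rewrite !Rmult_assoc. apply normClVec_le. intros i j t Hi Hj Ht.
  apply Rle_trans with (F * w t).
  - apply (le_of_half_pow _ _ (N0 * w t)). intros J.
    eapply Rle_trans; [apply (Hit J); auto; lia|]. lra.
  - rewrite Rmult_comm. apply Rmult_le_compat_r; [exact HF0|]. unfold w. apply exp_mono.
    apply Rmult_le_compat_l; [unfold lam; lra|lra].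
Qed.

(** Bootstrapping from the Gronwall bound: solving the equation for y^(r) in C^l costs only
    [l + pred r] derivatives of y and yields [l + r]. The induction stops at l = n - r + 1, where
    [l + pred r] equals n. *)
Lemma zero_cauchy_estimate n A : (r <= n)%nat ->
  (forall j, (j < r)%nat -> isClMat a b (n - r) m (A j)) ->
  exists K, 0 <= K /\ forall y, isClVec a b n m y ->
    (forall j i, (j < r)%nat -> (i < m)%nat -> nder a b j (y i) a = RtoC 0) ->
    normClVec a b n m y <= K * normClVec a b (n - r) m (ode_lhs a b r m A y).
Proof.
  intros Hn HA.
  assert (Hind : forall l, (l <= S (n - r))%nat -> exists K, 0 <= K /\ forall y, isClVec a b n m y ->
    (forall j i, (j < r)%nat -> (i < m)%nat -> nder a b j (y i) a = RtoC 0) ->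
    normClVec a b (l + pred r) m y <= K * normClVec a b (n - r) m (ode_lhs a b r m A y)).
  { intros l. induction l as [|l IH]; intros Hl; [now apply zero_cauchy_gronwall|].
    destruct (IH ltac:(lia)) as [K [HK0 HK]].
    assert (HAl : forall j, (j < r)%nat -> isClMat a b l m (A j)).
    { intros j Hj i s Hi Hs. apply (isCl_le a b (n - r)); [lia|]. now apply HA. }
    destruct (normClMat_bound l A HAl) as [e [He0 He]].
    assert (Hc := lower_const_ge0 l).
    assert (Hce : 0 <= lower_const l * e) by now apply Rmult_le_pos.
    exists (K + (1 + lower_const l * e * K)). split; [nra|]. intros y Hy H0.
    specialize (HK y Hy H0). set (F := normClVec a b (n - r) m (ode_lhs a b r m A y)) in *.
    assert (Hyl : isClVec a b (l + pred r) m y).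
    { intros i Hi. apply (isCl_le a b n); [lia|now apply Hy]. }
    destruct (lower_terms_bound l A y e HAl He Hyl) as [H1 H2].
    assert (HL := ode_lhs_isCl n A y Hn HA Hy).
    assert (HLl : isClVec a b l m (ode_lhs a b r m A y)).
    { intros i Hi. apply (isCl_le a b (n - r)); [lia|now apply HL]. }
    assert (Hd : isClVec a b l m (fun i => nder a b r (y i))).
    { intros i Hi. apply isCl_nder. apply (isCl_le a b n); [lia|now apply Hy]. }
    assert (H3 : normClVec a b l m (fun i => nder a b r (y i)) <= F + lower_const l * e * (K * F)).
    { rewrite (normClVec_ext l _ (vsub (ode_lhs a b r m A y) (lower_terms A y)))
        by (intros; unfold vsub; rewrite ode_lhs_split; ring).
      eapply Rle_trans; [now apply normClVec_sub|]. apply Rplus_le_compat.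
      - apply normClVec_mono; [lia|exact HL].
      - eapply Rle_trans; [exact H2|]. now apply Rmult_le_compat_l. }
    assert (H4 : normClVec a b (S l + pred r) m y <=
      normClVec a b (l + pred r) m y + 1 * normClVec a b l m (fun i => nder a b r (y i))).
    { unfold normClVec. rewrite <- rsum_lin. apply rsum_le. intros i Hi. simpl Nat.add.
      unfold normCl at 1. change (rsum (S (S (l + pred r))) ?f) with (rsum (S (l + pred r)) f + f (S (l + pred r))).
      apply Rplus_le_compat_l. rewrite Rmult_1_l. cbv beta.
      replace (S (l + pred r)) with (l + r)%nat by lia. rewrite nder_add.
      apply normCl_sup; auto. }
    lra. }
  destruct (Hind (S (n - r)) ltac:(lia)) as [K [HK0 HK]].
  exists K. split; [exact HK0|]. intros y Hy H0.
  replace n with (S (n - r) + pred r)%nat at 1 by lia. now apply HK.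
Qed.

End Vectors.

(** * Boundedness of the inverse *)

(* Two relations among N+1 vectors that hold in the first N coordinates combine to one that
   also holds in the last coordinate; exchanging one vector keeps the combination nontrivial. *)
Lemma linear_dependence N (v : nat -> nat -> C) :
  exists c : nat -> C, (exists k, (k <= N)%nat /\ c k <> RtoC 0) /\
    forall i, (i < N)%nat -> csum (S N) (fun k => Cmult (c k) (v k i)) = RtoC 0.
Proof.
  revert v. induction N as [|N IH]; intros v.
  - exists (fun _ => RtoC 1). split; [|intros; lia]. exists 0%nat. split; [lia|].
    intros H. apply RtoC_inj in H. lra.
  - destruct (IH v) as [c [[k0 [Hk0 Hc0]] Hc]].
    (* The vector exchanged for the new one is one with a nonzero coefficient in the first relation,
       so that relation cannot be recovered from the second. *)
    destruct (IH (fun k => if Nat.eqb k k0 then v (S N) else v k)) as [c' [[k1 [Hk1 Hc1]] Hc']].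
    set (s := csum (S N) (fun k => Cmult (c k) (v k N))).
    set (c'' := fun k => if Nat.eqb k k0 then RtoC 0 else c' k).
    (* The second relation rewritten in the original vectors: nothing on [v k0], and [c' k0] on the
       new vector. *)
    assert (Hrepl : forall i, csum (S N) (fun k => Cmult (c' k) ((if Nat.eqb k k0 then v (S N) else v k) i)) =
      Cplus (csum (S N) (fun k => Cmult (c'' k) (v k i))) (Cmult (c' k0) (v (S N) i))).
    { intros i. rewrite (csum_ext _ _ (fun k => Cplus (Cmult (c'' k) (v k i))
        (Cmult (RtoC 1) (if Nat.eqb k k0 then Cmult (c' k0) (v (S N) i) else RtoC 0)))).
      - rewrite csum_lin. rewrite (csum_single (S N) (fun k => if Nat.eqb k k0 then _ else _) k0).
        + rewrite Nat.eqb_refl. ring.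
        + lia.
        + intros j _ Hj. apply Nat.eqb_neq in Hj. now rewrite Hj.
      - intros k _. unfold c''. destruct (Nat.eqb_spec k k0) as [->|Hne]; ring. }
    set (s' := Cplus (csum (S N) (fun k => Cmult (c'' k) (v k N))) (Cmult (c' k0) (v (S N) N))).
    (* [s] and [s'] are the last coordinates of the two relations. If s = 0 the first relation
       already works; otherwise s' times the first minus s times the second kills the last
       coordinate. *)
    destruct (excluded_middle_informative (s = RtoC 0)) as [Hs|Hs].
    { exists (fun k => if Nat.eqb k (S N) then RtoC 0 else c k). split.
      - exists k0. split; [lia|]. destruct (Nat.eqb_spec k0 (S N)); [lia|exact Hc0].
      - intros i Hi. change (csum (S (S N)) ?f) with (Cplus (csum (S N) f) (f (S N))).
        cbv beta. rewrite Nat.eqb_refl, (csum_ext _ _ (fun k => Cmult (c k) (v k i))).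
        + destruct (Nat.eq_dec i N) as [->|Hne]; [fold s; rewrite Hs|rewrite Hc by lia]; ring.
        + intros k Hk. destruct (Nat.eqb_spec k (S N)); [lia|reflexivity]. }
    exists (fun k => if Nat.eqb k (S N) then Copp (Cmult s (c' k0))
      else Cminus (Cmult s' (c k)) (Cmult s (c'' k))). split.
    (* A nonzero coefficient sits at the new vector if c' k0 is nonzero; otherwise at k0 if s' is
       nonzero, since [c''] vanishes there; otherwise at k1, which then differs from k0. *)
    + destruct (excluded_middle_informative (c' k0 = RtoC 0)) as [H0|H0].
      * destruct (excluded_middle_informative (s' = RtoC 0)) as [Hs'|Hs'].
        -- exists k1. split; [lia|]. destruct (Nat.eqb_spec k1 (S N)); [lia|].
           unfold c''. destruct (Nat.eqb_spec k1 k0) as [->|Hne]; [contradiction|].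
           rewrite Hs'. intros E. apply (Cmult_neq_0 _ _ Hs Hc1).
           replace (Cmult s (c' k1)) with (Copp (Cminus (Cmult (RtoC 0) (c k1)) (Cmult s (c' k1)))) by ring.
           rewrite E. ring.
        -- exists k0. split; [lia|]. destruct (Nat.eqb_spec k0 (S N)); [lia|].
           unfold c''. rewrite Nat.eqb_refl. intros E. apply (Cmult_neq_0 _ _ Hs' Hc0).
           rewrite <- E. ring.
      * exists (S N). split; [lia|]. rewrite Nat.eqb_refl. intros E.
        apply (Cmult_neq_0 _ _ Hs H0). replace (Cmult s (c' k0)) with (Copp (Copp (Cmult s (c' k0)))) by ring.
        rewrite E. ring.
    + intros i Hi. change (csum (S (S N)) ?f) with (Cplus (csum (S N) f) (f (S N))).
      cbv beta. rewrite Nat.eqb_refl.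
      rewrite (csum_ext _ _ (fun k => Cminus (Cmult s' (Cmult (c k) (v k i))) (Cmult s (Cmult (c'' k) (v k i))))).
      2:{ intros k Hk. destruct (Nat.eqb_spec k (S N)); [lia|ring]. }
      rewrite csum_minus, !csum_scal.
      destruct (Nat.eq_dec i N) as [->|Hne].
      * fold s. unfold s'. ring.
      * rewrite Hc by lia. specialize (Hc' i ltac:(lia)). rewrite Hrepl in Hc'.
        transitivity (Copp (Cmult s (Cplus (csum (S N) (fun k => Cmult (c'' k) (v k i))) (Cmult (c' k0) (v (S N) i))))).
        { ring. } rewrite Hc'. ring.
Qed.

Definition qnorm (N : nat) (q : nat -> C) : R := rsum N (fun i => Cmod (q i)).

Lemma qnorm_ge0 N q : 0 <= qnorm N q.
Proof. apply rsum_nonneg. intros. apply Cmod_ge_0. Qed.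

Lemma qnorm_ext N q q' : (forall i, (i < N)%nat -> q i = q' i) -> qnorm N q = qnorm N q'.
Proof. intros H. apply rsum_ext. intros i Hi. now rewrite H. Qed.

Lemma qnorm_term N q i : (i < N)%nat -> Cmod (q i) <= qnorm N q.
Proof. intros Hi. apply (rsum_term N (fun i => Cmod (q i))); auto. intros. apply Cmod_ge_0. Qed.

Lemma qnorm_minus N q q' : qnorm N (fun i => Cminus (q i) (q' i)) <= qnorm N q + qnorm N q'.
Proof.
  unfold qnorm. rewrite <- (Rmult_1_l (rsum N (fun i => Cmod (q' i)))), <- rsum_lin. apply rsum_le.
  intros i _. rewrite Rmult_1_l. apply Cmod_minus_le.
Qed.

(** * Linear boundary operators and their boundedness *)

Section BoundaryOperator.

Context (a b : R) (hab : a < b) (n m N : nat).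
Context (B : vfun -> nat -> C)
  (hBlin : forall y z c, isClVec a b n m y -> isClVec a b n m z ->
     forall i, (i < N)%nat -> B (vlin y c z) i = Cplus (B y i) (Cmult c (B z i))).

Lemma boundary_zero i : (i < N)%nat -> B vzero i = RtoC 0.
Proof.
  intros Hi. assert (Hz : isClVec a b n m vzero) by now apply isClVec_zero.
  assert (H := hBlin vzero vzero (Copp (RtoC 1)) Hz Hz i Hi).
  replace (vlin vzero (Copp (RtoC 1)) vzero) with vzero in H.
  - rewrite H. ring.
  - apply functional_extensionality; intros j. apply functional_extensionality; intros t.
    unfold vlin, vzero. ring.
Qed.

Lemma boundary_comb M c h i : (forall k, (k < M)%nat -> isClVec a b n m (h k)) -> (i < N)%nat ->
  B (vcomb M c h) i = csum M (fun k => Cmult (c k) (B (h k) i)).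
Proof.
  intros H Hi. induction M as [|M IH].
  - now apply boundary_zero.
  - rewrite vcomb_S, hBlin; auto.
    + simpl. f_equal. apply IH. intros; apply H; lia.
    + apply isClVec_comb; [exact hab|]. intros; apply H; lia.
Qed.

Lemma boundary_sub y z i : isClVec a b n m y -> isClVec a b n m z -> (i < N)%nat ->
  B (vsub y z) i = Cminus (B y i) (B z i).
Proof. intros Hy Hz Hi. rewrite vsub_vlin, hBlin by auto. ring. Qed.

(** Continuity at 0 and scaling bound each component by 2 / delta times the norm; summing the
    components gives the factor [INR N]. *)
Lemma boundary_bounded
  (hBcont : forall y, isClVec a b n m y -> forall eps, 0 < eps ->
     exists delta, 0 < delta /\ forall z, isClVec a b n m z ->
       normClVec a b n m (vsub z y) < delta ->
       forall i, (i < N)%nat -> Cmod (Cminus (B z i) (B y i)) < eps) :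
  exists K, 0 <= K /\ forall y, isClVec a b n m y -> qnorm N (B y) <= K * normClVec a b n m y.
Proof.
  assert (Hz : isClVec a b n m vzero) by now apply isClVec_zero.
  destruct (hBcont vzero Hz 1 ltac:(lra)) as [delta [Hd H]].
  assert (Hi2 : 0 < 2 / delta) by (apply Rdiv_lt_0_compat; lra).
  exists (INR N * (2 / delta)). split; [apply Rmult_le_pos; [apply pos_INR|lra]|].
  intros y Hy. rewrite Rmult_assoc, <- rsum_const. apply rsum_le. intros i Hi.
  assert (HY := normClVec_ge0 a b hab m n y Hy). set (Y := normClVec a b n m y) in *.
  apply le_epsilon. intros eps Heps.
  (* The scaling brings the norm of x y to at most delta / 2. The term with [eps] keeps the
     denominator positive when Y = 0, and 1 / x = (2 / delta) Y + eps is exactly the required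
     bound. *)
  set (x := delta / 2 / (Y + eps * (delta / 2))).
  assert (Hed : 0 < eps * (delta / 2)) by (apply Rmult_lt_0_compat; lra).
  assert (Hx : 0 < x) by (unfold x; apply Rdiv_lt_0_compat; lra).
  set (z := vlin vzero (RtoC x) y).
  assert (Hzz : isClVec a b n m z) by now apply isClVec_lin.
  assert (Hn : normClVec a b n m (vsub z vzero) < delta).
  { replace (vsub z vzero) with z.
    - eapply Rle_lt_trans; [now apply normClVec_lin|].
      rewrite normClVec_zero by exact hab. fold Y. rewrite Cmod_R, Rabs_right by lra.
      unfold x. assert (delta / 2 / (Y + eps * (delta / 2)) * Y <= delta / 2); [|lra].
      apply (Rmult_le_reg_r (Y + eps * (delta / 2))); [lra|].
      replace (delta / 2 / (Y + eps * (delta / 2)) * Y * (Y + eps * (delta / 2))) with (delta / 2 * Y)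
        by (field; lra). nra.
    - apply functional_extensionality; intros j. apply functional_extensionality; intros t.
      unfold vsub, vzero. ring. }
  specialize (H z Hzz Hn i Hi). unfold z in H.
  rewrite hBlin, boundary_zero in H by auto.
  replace (Cminus (Cplus (RtoC 0) (Cmult (RtoC x) (B y i))) (RtoC 0)) with (Cmult (RtoC x) (B y i)) in H by ring.
  rewrite Cmod_mult, Cmod_R, Rabs_right in H by lra.
  apply (Rmult_le_reg_l x); [exact Hx|].
  apply Rle_trans with 1; [lra|]. apply Req_le. unfold x. field. lra.
Qed.

End BoundaryOperator.

Section Inverse.

Context (a b : R) (hab : a < b) (n r m : nat) (hrn : (1 <= r <= n)%nat).
Context (A : nat -> mfun) (hA : forall j, (j < r)%nat -> isClMat a b (n - r) m (A j)).
Context (B : vfun -> nat -> C)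
  (hBlin : forall y z c, isClVec a b n m y -> isClVec a b n m z ->
     forall i, (i < r * m)%nat -> B (vlin y c z) i = Cplus (B y i) (Cmult c (B z i)))
  (hBbound : exists K, 0 <= K /\ forall y, isClVec a b n m y ->
     qnorm (r * m) (B y) <= K * normClVec a b n m y).

Context (h : nat -> vfun) (hcl : forall k, (k < r * m)%nat -> isClVec a b n m (h k))
  (hode : forall k, (k < r * m)%nat -> solves_ode a b r m A vzero (h k))
  (hbc : forall k, (k < r * m)%nat -> forall i, (i < r * m)%nat ->
     B (h k) i = if Nat.eqb i k then RtoC 1 else RtoC 0).

Lemma boundary_basis c i : (i < r * m)%nat -> B (vcomb (r * m) c h) i = c i.
Proof.
  intros Hi. rewrite (boundary_comb a b hab n m (r * m) B hBlin) by auto.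
  rewrite (csum_single _ _ i Hi).
  - rewrite hbc, Nat.eqb_refl by auto. ring.
  - intros k Hk Hne. rewrite hbc by auto. destruct (Nat.eqb_spec i k); [congruence|ring].
Qed.

Lemma ode_basis c : solves_ode a b r m A vzero (vcomb (r * m) c h).
Proof.
  intros i Hi t Ht. rewrite (ode_lhs_comb a b hab m r (proj1 hrn) n) by (auto; lia).
  apply csum_zero. intros k Hk. rewrite (hode k Hk i Hi t Ht). unfold vzero. ring.
Qed.

Lemma inverse_bound : exists K, 0 <= K /\ forall y, isClVec a b n m y ->
  normClVec a b n m y <= K * (normClVec a b (n - r) m (ode_lhs a b r m A y) + qnorm (r * m) (B y)).
Proof.
  destruct (zero_cauchy_estimate a b hab m r (proj1 hrn) n A (proj2 hrn) hA) as [K1 [HK1 Hcauchy]].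
  destruct hBbound as [Kb [HKb HB]].
  set (H := rsum (r * m) (fun k => normClVec a b n m (h k))).
  assert (HH : 0 <= H) by (apply rsum_nonneg; intros; apply normClVec_ge0; auto).
  (* The Cauchy data at [a] as one vector of length r m: entry j * m + i is the j-th derivative of
     component i. *)
  set (cd := fun (y : vfun) k => nder a b (k / m) (y (k mod m)) a).
  assert (Hcd : forall y, (forall k, (k < r * m)%nat -> cd y k = RtoC 0) ->
    forall j i, (j < r)%nat -> (i < m)%nat -> nder a b j (y i) a = RtoC 0).
  { intros y Hy j i Hj Hi. specialize (Hy (j * m + i)%nat ltac:(nia)). unfold cd in Hy.
    rewrite Nat.div_add_l, Nat.div_small, Nat.add_0_r in Hy by lia.
    now rewrite Nat.add_comm, Nat.Div0.mod_add, Nat.mod_small in Hy by lia. }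
  (* With y = u - w and u free of Cauchy data: K1 F bounds u, and H (Kb K1 F + Q) bounds w, where F
     and Q are the norms of the equation and boundary data of y. *)
  exists (K1 + H * (Kb * K1) + H). split.
  { assert (0 <= H * (Kb * K1)) by (repeat apply Rmult_le_pos; auto). lra. }
  intros y Hy.
  (* The Cauchy data of y and of the r m kernel functions are r m + 1 vectors of length r m. *)
  destruct (linear_dependence (r * m) (fun k => if Nat.eqb k (r * m) then cd y else cd (h k)))
    as [c [[k0 [Hk0 Hc0]] Hc]].
  assert (Hsum : forall k, (k < r * m)%nat ->
    Cplus (csum (r * m) (fun k' => Cmult (c k') (cd (h k') k))) (Cmult (c (r * m)%nat) (cd y k)) = RtoC 0).
  { intros k Hk. rewrite <- (Hc k Hk). simpl csum. rewrite Nat.eqb_refl. f_equal.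
    apply csum_ext. intros k' Hk'. destruct (Nat.eqb_spec k' (r * m)); [lia|reflexivity]. }
  assert (Hcomb : forall d k, (k < r * m)%nat -> cd (vcomb (r * m) d h) k =
     csum (r * m) (fun k' => Cmult (d k') (cd (h k') k))).
  { intros d k Hk. unfold cd. apply (nder_comb a b hab m n); auto; try lra.
    - apply Nat.mod_upper_bound. lia.
    - assert (k / m < r)%nat by (apply Nat.Div0.div_lt_upper_bound; lia). lia. }
  (* Otherwise the relation concerns kernel functions only. Their combination has zero Cauchy data,
     so it vanishes, and its boundary values, which are the coefficients [c], vanish too. *)
  assert (HcN : c (r * m)%nat <> RtoC 0).
  { intros E. set (w := vcomb (r * m) c h).
    assert (Hw : isClVec a b n m w) by now apply isClVec_comb.
    assert (Hw0 : normClVec a b n m w <= 0).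
    { eapply Rle_trans; [apply Hcauchy; [exact Hw|]|].
      - apply Hcd. intros k Hk. unfold w. rewrite Hcomb, <- (Hsum k Hk), E by auto. ring.
      - rewrite (normClVec_ext a b m _ _ vzero) by (intros; now apply ode_basis).
        rewrite normClVec_zero by exact hab. lra. }
    apply Hc0. destruct (Nat.eq_dec k0 (r * m)) as [->|Hne]; [exact E|].
    apply Cmod_eq_0, Rle_antisym; [|apply Cmod_ge_0].
    rewrite <- (boundary_basis c k0) by lia.
    eapply Rle_trans; [apply (qnorm_term (r * m)); lia|]. eapply Rle_trans; [now apply HB|].
    fold w. nra. }
  set (d := fun k => Cdiv (c k) (c (r * m)%nat)).
  set (w := vcomb (r * m) d h).
  assert (Hw : isClVec a b n m w) by now apply isClVec_comb.
  set (u := vlin y (RtoC 1) w).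
  assert (Hu : isClVec a b n m u) by now apply isClVec_lin.
  assert (Hunorm : normClVec a b n m u <= K1 * normClVec a b (n - r) m (ode_lhs a b r m A y)).
  { eapply Rle_trans; [apply Hcauchy; [exact Hu|]|].
    - apply Hcd. intros k Hk. unfold cd, u, vlin.
      rewrite (nder_lin a b hab n); try lra.
      2:{ apply Hy. apply Nat.mod_upper_bound. lia. }
      2:{ apply Hw. apply Nat.mod_upper_bound. lia. }
      2:{ assert (k / m < r)%nat by (apply Nat.Div0.div_lt_upper_bound; lia). lia. }
      fold (cd y k) (cd w k). unfold w. rewrite Hcomb by auto.
      rewrite (csum_ext _ _ (fun k' => Cmult (Cinv (c (r * m)%nat)) (Cmult (c k') (cd (h k') k))))
        by (intros; unfold d, Cdiv; ring).
      rewrite csum_scal.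
      transitivity (Cmult (Cinv (c (r * m)%nat)) (Cplus (csum (r * m) (fun k' => Cmult (c k') (cd (h k') k)))
         (Cmult (c (r * m)%nat) (cd y k)))); [field; exact HcN|]. rewrite Hsum by auto. ring.
    - apply Req_le. f_equal. apply normClVec_ext. intros i t Hi Ht. unfold u.
      rewrite (ode_lhs_lin a b hab m r (proj1 hrn) n) by (auto; lia).
      unfold w. rewrite (ode_basis d i Hi t Ht). unfold vzero. ring. }
  (* The coefficients of w are its boundary values, hence d = B u - B y. *)
  assert (Hd : qnorm (r * m) d <= qnorm (r * m) (B u) + qnorm (r * m) (B y)).
  { eapply Rle_trans; [|apply qnorm_minus]. apply Req_le, qnorm_ext. intros i Hi.
    unfold u. rewrite hBlin by auto. unfold w. rewrite boundary_basis by auto. ring. }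
  assert (Hwn : normClVec a b n m w <= qnorm (r * m) d * H).
  { eapply Rle_trans; [now apply normClVec_comb|]. unfold H. rewrite <- rsum_scal.
    apply rsum_le. intros k Hk. apply Rmult_le_compat_r; [apply normClVec_ge0; auto|].
    now apply qnorm_term. }
  assert (Hyn : normClVec a b n m y <= normClVec a b n m u + normClVec a b n m w).
  { rewrite (normClVec_ext a b m n y (vsub u w)) by (intros; unfold vsub, u, vlin; ring).
    now apply normClVec_sub. }
  assert (HBu := HB u Hu).
  assert (Hf := normClVec_ge0 a b hab m (n - r) _ (ode_lhs_isCl a b hab m r (proj1 hrn) n A y (proj2 hrn) hA Hy)).
  set (F := normClVec a b (n - r) m (ode_lhs a b r m A y)) in *.
  assert (Hq := qnorm_ge0 (r * m) (B y)). set (Q := qnorm (r * m) (B y)) in *.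
  assert (H1 : Kb * normClVec a b n m u <= Kb * (K1 * F)) by (apply Rmult_le_compat_l; auto).
  assert (H2 : qnorm (r * m) d * H <= (Kb * (K1 * F) + Q) * H) by (apply Rmult_le_compat_r; lra).
  assert (0 <= K1 * Q) by (apply Rmult_le_pos; auto).
  assert (0 <= H * (Kb * K1) * Q) by (repeat apply Rmult_le_pos; auto).
  assert (0 <= H * F) by (apply Rmult_le_pos; auto).
  lra.
Qed.

End Inverse.

(** * Interpolation by multipoint data *)

Definition ramp (x : R) : R := Rmax 0 (Rmin 1 x).

Lemma ramp_mono x y : x <= y -> ramp x <= ramp y.
Proof. intros H. unfold ramp, Rmax, Rmin. repeat destruct Rle_dec; lra. Qed.

Lemma ramp_0 x : x <= 0 -> ramp x = 0.
Proof. intros H. unfold ramp, Rmax, Rmin. repeat destruct Rle_dec; lra. Qed.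

Lemma ramp_1 x : 1 <= x -> ramp x = 1.
Proof. intros H. unfold ramp, Rmax, Rmin. repeat destruct Rle_dec; lra. Qed.

Lemma ramp_lipschitz x y : Rabs (ramp x - ramp y) <= Rabs (x - y).
Proof.
  unfold ramp, Rmax, Rmin. repeat destruct Rle_dec; unfold Rabs; repeat destruct Rcase_abs; lra.
Qed.

Lemma continuous_ramp (f : R -> R) t : continuity_pt f t -> continuity_pt (fun s => ramp (f s)) t.
Proof.
  intros Hf eps Heps. destruct (Hf eps Heps) as [d [Hd H]]. exists d. split; [exact Hd|].
  intros s Hs. eapply Rle_lt_trans; [apply ramp_lipschitz|]. now apply H.
Qed.

Section Interpolation.

Context (a b : R) (hab : a < b).

Definition node (k j : nat) : R := a + INR j * ((b - a) / INR k).

(** In units of the mesh width, the tent function centred at node j. As a difference of consecutive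
    ramps it makes sums over j telescope. *)
Definition hat (k j : nat) (t : R) : R :=
  ramp ((t - a) / ((b - a) / INR k) - INR j + 1) - ramp ((t - a) / ((b - a) / INR k) - INR j).

Lemma continuous_hat k j t : continuity_pt (hat k j) t.
Proof.
  unfold hat. apply (continuity_pt_minus (fun t => ramp _) (fun t => ramp _));
    apply continuous_ramp; unfold Rdiv; reg.
Qed.

Lemma hat_ge0 k j t : 0 <= hat k j t.
Proof. unfold hat. assert (H := ramp_mono ((t - a) / ((b - a) / INR k) - INR j) ((t - a) / ((b - a) / INR k) - INR j + 1)). lra. Qed.

Lemma rsum_hat_telescope k N t : rsum N (fun j => hat k j t) =
  ramp ((t - a) / ((b - a) / INR k) + 1) - ramp ((t - a) / ((b - a) / INR k) - INR N + 1).
Proof.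
  induction N as [|N IH].
  - simpl. rewrite Rminus_0_r. ring.
  - simpl rsum. rewrite IH. unfold hat. rewrite S_INR.
    replace ((t - a) / ((b - a) / INR k) - (INR N + 1) + 1) with ((t - a) / ((b - a) / INR k) - INR N) by ring.
    ring.
Qed.

Lemma mesh_pos k : (1 <= k)%nat -> 0 < (b - a) / INR k.
Proof. intros Hk. apply Rdiv_lt_0_compat; [lra|]. apply lt_0_INR. lia. Qed.

(** With x the distance from [a] in mesh widths, the sum telescopes to ramp (x + 1) - ramp (x - k),
    and 0 <= x <= k makes this 1 - 0. *)
Lemma rsum_hat k t : (1 <= k)%nat -> a <= t <= b -> rsum (S k) (fun j => hat k j t) = 1.
Proof.
  intros Hk Ht. rewrite rsum_hat_telescope. assert (Hm := mesh_pos k Hk).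
  assert (Hkp : 0 < INR k) by (apply lt_0_INR; lia).
  assert (Hx : 0 <= (t - a) / ((b - a) / INR k) <= INR k).
  { split.
    - apply Rmult_le_pos; [lra|apply Rlt_le, Rinv_0_lt_compat; exact Hm].
    - apply (Rmult_le_reg_r ((b - a) / INR k)); [exact Hm|].
      unfold Rdiv at 1. rewrite Rmult_assoc, Rinv_l, Rmult_1_r by lra.
      replace (INR k * ((b - a) / INR k)) with (b - a) by (field; lra). lra. }
  rewrite ramp_1, ramp_0; rewrite ?S_INR; lra.
Qed.

Lemma hat_support k j t : (1 <= k)%nat -> hat k j t <> 0 -> Rabs (node k j - t) <= (b - a) / INR k.
Proof.
  intros Hk. assert (Hm := mesh_pos k Hk). unfold hat, node. intros H.
  set (d := (b - a) / INR k) in *.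
  assert (Ht : t = a + (t - a) / d * d) by (field; lra).
  set (x := (t - a) / d) in *.
  destruct (Rlt_dec (x - INR j) (-1)) as [H1|H1].
  { exfalso. apply H. rewrite !ramp_0; lra. }
  destruct (Rlt_dec 1 (x - INR j)) as [H2|H2].
  { exfalso. apply H. rewrite !ramp_1; lra. }
  rewrite Ht. apply Rabs_le. nra.
Qed.

Lemma node_in k j : (1 <= k)%nat -> (j <= k)%nat -> a <= node k j <= b.
Proof.
  intros Hk Hj. assert (Hm := mesh_pos k Hk). unfold node.
  assert (Hkp : 0 < INR k) by (apply lt_0_INR; lia).
  assert (H0 := pos_INR j). assert (H1 : INR j <= INR k) by now apply le_INR.
  assert (H2 : INR k * ((b - a) / INR k) = b - a) by (field; lra).
  split; [nra|]. assert (INR j * ((b - a) / INR k) <= INR k * ((b - a) / INR k)); [|lra].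
  apply Rmult_le_compat_r; lra.
Qed.

(** The interpolant at t is a convex combination of nodal values, with positive weight only on nodes
    within one mesh width of t. *)
Lemma hat_interpolation_error k (g : R -> C) om t : (1 <= k)%nat -> a <= t <= b ->
  (forall s, a <= s <= b -> Rabs (s - t) <= (b - a) / INR k -> Cmod (Cminus (g s) (g t)) <= om) ->
  Cmod (Cminus (csum (S k) (fun j => Cmult (g (node k j)) (RtoC (hat k j t)))) (g t)) <= om.
Proof.
  intros Hk Ht Hom.
  assert (E : forall N c, csum N (fun j => Cmult (RtoC (hat k j t)) c) = Cmult (RtoC (rsum N (fun j => hat k j t))) c).
  { intros N c. induction N as [|N IH]; simpl; [ring|]. rewrite IH, RtoC_plus. ring. }
  replace (g t) with (csum (S k) (fun j => Cmult (RtoC (hat k j t)) (g t)))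
    by (rewrite E, rsum_hat by auto; ring).
  rewrite <- csum_minus. eapply Rle_trans; [apply Cmod_csum|].
  replace om with (om * rsum (S k) (fun j => hat k j t)) by (rewrite rsum_hat by auto; ring).
  rewrite <- rsum_scal. apply rsum_le. intros j Hj.
  replace (Cminus _ _) with (Cmult (RtoC (hat k j t)) (Cminus (g (node k j)) (g t))) by ring.
  assert (H0 := hat_ge0 k j t).
  rewrite Cmod_mult, Cmod_R, Rabs_right, Rmult_comm by lra.
  destruct (Req_dec (hat k j t) 0) as [Hz|Hz]; [rewrite Hz; lra|].
  apply Rmult_le_compat_r; [exact H0|]. apply Hom; [apply node_in; lia|].
  now apply hat_support.
Qed.

Lemma cont_ab_uniform g : cont_ab a b g -> forall eps, 0 < eps -> exists delta, 0 < delta /\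
  forall s t, a <= s <= b -> a <= t <= b -> Rabs (s - t) < delta -> Cmod (Cminus (g s) (g t)) < eps.
Proof.
  intros Hg eps Heps.
  assert (HU : forall u : C -> R, (forall x y, Rabs (u x - u y) <= Cmod (Cminus x y)) ->
    uniform_continuity (fun t => u (g (clamp a b t))) (fun c => a <= c <= b)).
  { intros u Hu. apply Heine; [apply compact_P3|]. intros x _.
    now apply continuity_clamp. }
  destruct (HU Re (fun x y => re_le_Cmod (Cminus x y)) (mkposreal (eps / 2) ltac:(lra))) as [d1 H1].
  destruct (HU Im (fun x y => im_le_Cmod (Cminus x y)) (mkposreal (eps / 2) ltac:(lra))) as [d2 H2].
  exists (Rmin d1 d2). split; [apply Rmin_glb_lt; apply cond_pos|]. intros s t Hs Ht Hst.
  specialize (H1 s t Hs Ht (Rlt_le_trans _ _ _ Hst (Rmin_l _ _))).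
  specialize (H2 s t Hs Ht (Rlt_le_trans _ _ _ Hst (Rmin_r _ _))).
  simpl in H1, H2. rewrite !clamp_id in H1, H2 by assumption.
  eapply Rle_lt_trans; [apply Cmod_le_re_im|]. destruct (g s) as [x y], (g t) as [u v].
  simpl in *. unfold Rminus in *. lra.
Qed.

Fixpoint iterated_int (f : R -> R) (l : nat) : R -> R :=
  match l with O => f | S l => fun t => RInt (iterated_int f l) a t end.

Lemma iterated_int_derive f : (forall t, continuity_pt f t) -> forall l t,
  is_derive (iterated_int f (S l)) t (iterated_int f l t) /\ continuity_pt (iterated_int f l) t.
Proof.
  intros Hf.
  assert (Hstep : forall g : R -> R, (forall t, continuity_pt g t) -> forall t, is_derive (fun t => RInt g a t) t (g t)).
  { intros g Hg t. apply (is_derive_RInt g _ a).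
    - apply filter_forall. intros s. apply (RInt_correct (V := R_CompleteNormedModule)).
      apply (ex_RInt_continuous (V := R_CompleteNormedModule)). intros x _.
      now apply continuity_pt_filterlim.
    - now apply continuity_pt_filterlim. }
  assert (Hc : forall l t, continuity_pt (iterated_int f l) t).
  { intros l. induction l as [|l IH]; [exact Hf|]. intros t.
    apply derivable_continuous_pt. exists (iterated_int f l t). apply is_derive_Reals.
    now apply (Hstep (iterated_int f l)). }
  intros l t. split; [|apply Hc]. simpl. apply Hstep. apply Hc.
Qed.

Lemma iterated_int_base f l : iterated_int f (S l) a = 0.
Proof. simpl. apply (RInt_point (V := R_CompleteNormedModule)). Qed.

Lemma iterated_int_isCl f n : (forall t, continuity_pt f t) ->
  isCl a b n (fun t => RtoC (iterated_int f n t)) /\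
  forall v t, (v <= n)%nat -> a <= t <= b ->
    nder a b v (fun t => RtoC (iterated_int f n t)) t = RtoC (iterated_int f (n - v) t).
Proof.
  intros Hf.
  set (G := fun v t => RtoC (iterated_int f (n - v) t)).
  assert (HG : forall v, (v < n)%nat -> forall t, a <= t <= b -> is_deriv_ab a b (G v) t (G (S v) t)).
  { intros v Hv t Ht. unfold G. replace (n - v)%nat with (S (n - S v)) by lia.
    apply is_derive_is_deriv_ab. now apply iterated_int_derive. }
  replace (fun t => RtoC (iterated_int f n t)) with (G 0%nat) by (unfold G; now rewrite Nat.sub_0_r).
  split.
  - apply (isCl_tower a b hab n G HG). apply continuous_cont_ab. intros t. now apply iterated_int_derive.
  - intros v t Hv Ht. exact (nder_tower a b hab n G HG v Hv t Ht).
Qed.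

(* [iterated_int (fun _ => 1) l t] is the Taylor monomial (t - a)^l / l!. *)
Lemma taylor_monomial_isCl l n :
  isCl a b n (fun t => RtoC (iterated_int (fun _ => 1) l t)) /\
  forall v t, (v <= n)%nat -> a <= t <= b ->
    nder a b v (fun t => RtoC (iterated_int (fun _ => 1) l t)) t =
    if Nat.leb v l then RtoC (iterated_int (fun _ => 1) (l - v) t) else RtoC 0.
Proof.
  assert (H1 : forall t, continuity_pt (fun _ => 1) t) by (intros; reg).
  set (G := fun v t => if Nat.leb v l then RtoC (iterated_int (fun _ => 1) (l - v) t) else RtoC 0).
  assert (HG : forall v, (v < n)%nat -> forall t, a <= t <= b -> is_deriv_ab a b (G v) t (G (S v) t)).
  { intros v _ t Ht. unfold G. destruct (Nat.leb_spec (S v) l) as [Hl|Hl].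
    - rewrite (proj2 (Nat.leb_le v l)) by lia. replace (l - v)%nat with (S (l - S v)) by lia.
      apply is_derive_is_deriv_ab. now apply iterated_int_derive.
    - destruct (Nat.leb_spec v l).
      + replace (l - v)%nat with 0%nat by lia. apply (is_deriv_ab_const a b (RtoC 1)).
      + apply is_deriv_ab_const. }
  replace (fun t => RtoC (iterated_int (fun _ => 1) l t)) with (G 0%nat)
    by (unfold G; simpl; now rewrite Nat.sub_0_r).
  split.
  - apply (isCl_tower a b hab n G HG). unfold G. destruct (Nat.leb n l); [|apply cont_ab_const].
    apply continuous_cont_ab. intros t. now apply iterated_int_derive.
  - intros v t Hv Ht. exact (nder_tower a b hab n G HG v Hv t Ht).
Qed.

Context (n m : nat).

(** The function multiplying the datum y^(l)(t_j). Derivatives of order l < n are used only at node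
    0, which is [a], and produce the Taylor polynomial; order n is used at every node. *)
Definition interp_basis (k j l : nat) : R -> C :=
  if Nat.ltb l n
  then if Nat.eqb j 0 then fun t => RtoC (iterated_int (fun _ => 1) l t) else fun _ => RtoC 0
  else fun t => RtoC (iterated_int (hat k j) n t).

Lemma interp_basis_isCl k j l : isCl a b n (interp_basis k j l).
Proof.
  unfold interp_basis. destruct (Nat.ltb l n); [destruct (Nat.eqb j 0)|].
  - apply taylor_monomial_isCl.
  - now apply isCl_zero.
  - apply iterated_int_isCl. intros; apply continuous_hat.
Qed.

Definition unit_vec (s : nat) (g : R -> C) : vfun :=
  fun i => if Nat.eqb i s then g else fun _ => RtoC 0.

Lemma unit_vec_isCl s g : isCl a b n g -> isClVec a b n m (unit_vec s g).
Proof. intros H i Hi. unfold unit_vec. destruct (Nat.eqb i s); [exact H|now apply isCl_zero]. Qed.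

(* The Taylor polynomial of degree n - 1 at a plus the n-fold integral of the piecewise linear
   interpolant of the n-th derivative. *)
Definition spline_interp (k : nat) (y : vfun) : vfun :=
  vcomb (S k) (fun _ => RtoC 1) (fun j =>
    vcomb (S n) (fun _ => RtoC 1) (fun l =>
      vcomb m (fun s => nder a b l (y s) (node k j)) (fun s => unit_vec s (interp_basis k j l)))).

Lemma spline_interp_isCl k y : isClVec a b n m (spline_interp k y).
Proof.
  apply isClVec_comb; [exact hab|]. intros j _. apply isClVec_comb; [exact hab|]. intros l _.
  apply isClVec_comb; [exact hab|]. intros s _. apply unit_vec_isCl, interp_basis_isCl.
Qed.

Lemma nder_spline_interp k y i v t : (i < m)%nat -> (v <= n)%nat -> a <= t <= b ->
  nder a b v (spline_interp k y i) t =
  csum (S k) (fun j => csum (S n) (fun l =>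
    Cmult (nder a b l (y i) (node k j)) (nder a b v (interp_basis k j l) t))).
Proof.
  intros Hi Hv Ht. unfold spline_interp. rewrite (nder_comb a b hab m n); auto.
  2:{ intros j _. apply isClVec_comb; [exact hab|]. intros l _.
      apply isClVec_comb; [exact hab|]. intros s _. apply unit_vec_isCl, interp_basis_isCl. }
  apply csum_ext. intros j _. rewrite Cmult_1_l, (nder_comb a b hab m n); auto.
  2:{ intros l _. apply isClVec_comb; [exact hab|]. intros s _. apply unit_vec_isCl, interp_basis_isCl. }
  apply csum_ext. intros l _. rewrite Cmult_1_l, (nder_comb a b hab m n); auto.
  2:{ intros s _. apply unit_vec_isCl, interp_basis_isCl. }
  rewrite (csum_single m _ i Hi).
  - unfold unit_vec. now rewrite Nat.eqb_refl.
  - intros s _ Hs. unfold unit_vec. destruct (Nat.eqb_spec i s); [congruence|].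
    rewrite nder_zero by assumption. ring.
Qed.

Lemma nder_spline_interp_top k y i t : (i < m)%nat -> a <= t <= b ->
  nder a b n (spline_interp k y i) t =
  csum (S k) (fun j => Cmult (nder a b n (y i) (node k j)) (RtoC (hat k j t))).
Proof.
  intros Hi Ht. rewrite nder_spline_interp by auto. apply csum_ext. intros j _.
  rewrite (csum_single (S n) _ n); [|lia|].
  - f_equal. unfold interp_basis. rewrite Nat.ltb_irrefl.
    rewrite (proj2 (iterated_int_isCl (hat k j) n (continuous_hat k j))) by auto.
    now rewrite Nat.sub_diag.
  - intros l Hl Hne. unfold interp_basis. rewrite (proj2 (Nat.ltb_lt l n)) by lia.
    destruct (Nat.eqb j 0).
    + rewrite (proj2 (taylor_monomial_isCl l n)) by auto.
      rewrite (proj2 (Nat.leb_gt n l)) by lia. ring.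
    + rewrite nder_zero by assumption. ring.
Qed.

(** The n-fold integrals vanish at [a] together with their derivatives of order below n, and among
    the Taylor monomials only the one of degree v survives v derivatives at [a]. *)
Lemma nder_spline_interp_base k y i v : (i < m)%nat -> (v < n)%nat ->
  nder a b v (spline_interp k y i) a = nder a b v (y i) a.
Proof.
  intros Hi Hv. assert (Ha : a <= a <= b) by lra. rewrite nder_spline_interp by (auto; lia).
  assert (Hpos : forall f d, (0 < d)%nat -> iterated_int f d a = 0).
  { intros f [|d] Hd; [lia|]. apply iterated_int_base. }
  assert (Hn : forall j, nder a b v (fun t => RtoC (iterated_int (hat k j) n t)) a = RtoC 0).
  { intros j. rewrite (proj2 (iterated_int_isCl (hat k j) n (continuous_hat k j))) by (auto; lia).
    now rewrite Hpos by lia. }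
  rewrite (csum_single (S k) _ 0%nat); [|lia|].
  - replace (node k 0) with a by (unfold node; simpl; ring).
    rewrite (csum_single (S n) _ v); [|lia|].
    + unfold interp_basis. rewrite (proj2 (Nat.ltb_lt v n)) by lia. simpl Nat.eqb. cbv iota.
      rewrite (proj2 (taylor_monomial_isCl v n)) by (auto; lia).
      rewrite Nat.leb_refl, Nat.sub_diag. simpl. ring.
    + intros l Hl Hne. unfold interp_basis. destruct (Nat.ltb_spec l n).
      * simpl Nat.eqb. cbv iota. rewrite (proj2 (taylor_monomial_isCl l n)) by (auto; lia).
        destruct (Nat.leb_spec v l); [rewrite Hpos by lia|]; ring.
      * rewrite Hn. ring.
  - intros j Hj Hne. apply csum_zero. intros l Hl. unfold interp_basis.
    destruct (Nat.ltb_spec l n).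
    + destruct (Nat.eqb_spec j 0); [lia|]. rewrite nder_zero by assumption. ring.
    + rewrite Hn. ring.
Qed.

(** Descending from order n, each integration from [a] costs a factor [b - a]. The larger factor
    [1 + (b - a)] makes its powers increase, so the n-th one serves all orders. *)
Lemma zero_taylor_bound g W : isCl a b n g ->
  (forall v, (v < n)%nat -> nder a b v g a = RtoC 0) ->
  (forall t, a <= t <= b -> Cmod (nder a b n g t) <= W) ->
  forall v t, (v <= n)%nat -> a <= t <= b -> Cmod (nder a b v g t) <= (1 + (b - a)) ^ n * W.
Proof.
  intros Hg H0 HW.
  assert (HW0 : 0 <= W) by (eapply Rle_trans; [apply Cmod_ge_0|apply (HW a); lra]).
  assert (Hp : forall d, 1 <= (1 + (b - a)) ^ d) by (intros; apply pow_R1_Rle; lra).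
  assert (Hind : forall d, (d <= n)%nat -> forall t, a <= t <= b ->
    Cmod (nder a b (n - d) g t) <= (1 + (b - a)) ^ d * W).
  { intros d. induction d as [|d IH]; intros Hd t Ht.
    - rewrite Nat.sub_0_r, pow_O, Rmult_1_l. now apply HW.
    - assert (H1 := lipschitz_of_deriv_bound a b hab (nder a b (n - S d) g) (nder a b (n - d) g)
        ((1 + (b - a)) ^ d * W)).
      specialize (H1 ltac:(intros s Hs; replace (n - d)%nat with (S (n - S d)) by lia; apply Hg; [lia|exact Hs])).
      specialize (H1 (IH ltac:(lia)) a t ltac:(lra) Ht).
      rewrite H0 in H1 by lia.
      replace (Cminus (nder a b (n - S d) g t) (RtoC 0)) with (nder a b (n - S d) g t) in H1 by ring.
      rewrite Rabs_right in H1 by lra.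
      assert (Hq := Hp d). assert (0 <= (1 + (b - a)) ^ d * W) by (apply Rmult_le_pos; lra).
      simpl. nra. }
  intros v t Hv Ht. replace v with (n - (n - v))%nat by lia.
  eapply Rle_trans; [apply Hind; [lia|exact Ht]|]. apply Rmult_le_compat_r; [exact HW0|].
  apply Rle_pow; [lra|lia].
Qed.

Definition spline_interp_const : R := INR m * (INR (S n) * (1 + (b - a)) ^ n).

(** The error has zero Taylor data at [a], and its n-th derivative is the error of piecewise linear
    interpolation, at most the oscillation [W] over one mesh width. *)
Lemma spline_interp_error k y W : isClVec a b n m y -> (1 <= k)%nat ->
  (forall i s t, (i < m)%nat -> a <= s <= b -> a <= t <= b -> Rabs (s - t) <= (b - a) / INR k ->
     Cmod (Cminus (nder a b n (y i) s) (nder a b n (y i) t)) <= W) ->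
  normClVec a b n m (vsub (spline_interp k y) y) <= spline_interp_const * W.
Proof.
  intros Hy Hk HW. unfold spline_interp_const. rewrite !Rmult_assoc. apply normClVec_le; [exact hab|].
  intros i v t Hi Hv Ht.
  assert (HD : forall v t, (v <= n)%nat -> a <= t <= b -> nder a b v (vsub (spline_interp k y) y i) t =
    Cminus (nder a b v (spline_interp k y i) t) (nder a b v (y i) t)).
  { intros v' t' Hv' Ht'. rewrite vsub_vlin. unfold vlin.
    rewrite (nder_lin a b hab n) by (auto; now apply spline_interp_isCl). ring. }
  apply zero_taylor_bound; auto.
  - apply (isClVec_sub a b hab m n (spline_interp k y) y (spline_interp_isCl k y) Hy i Hi).
  - intros v' Hv'. rewrite HD by (try lia; lra). rewrite nder_spline_interp_base by auto. ring.
  - intros t' Ht'. rewrite HD by auto. rewrite nder_spline_interp_top by auto.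
    apply hat_interpolation_error; auto.
Qed.

Lemma spline_interp_const_ge0 : 0 <= spline_interp_const.
Proof.
  unfold spline_interp_const. repeat apply Rmult_le_pos; try apply pos_INR. apply pow_le. lra.
Qed.

(** The trivial oscillation bound, twice the norm, gives a constant that does not depend on k. *)
Lemma spline_interp_bound k y : isClVec a b n m y -> (1 <= k)%nat ->
  normClVec a b n m (vsub (spline_interp k y) y) <= spline_interp_const * 2 * normClVec a b n m y.
Proof.
  intros Hy Hk. rewrite Rmult_assoc. apply spline_interp_error; auto. intros i s t Hi Hs Ht _.
  eapply Rle_trans; [apply Cmod_minus_le|].
  assert (H1 := normClVec_term a b hab m n y i n s Hy Hi (le_n n) Hs).
  assert (H2 := normClVec_term a b hab m n y i n t Hy Hi (le_n n) Ht). lra.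
Qed.

Lemma spline_interp_converges y : isClVec a b n m y -> forall eps, 0 < eps ->
  exists K, forall k, (K <= k)%nat -> (1 <= k)%nat -> normClVec a b n m (vsub (spline_interp k y) y) < eps.
Proof.
  intros Hy eps Heps. assert (HC := spline_interp_const_ge0).
  set (W := eps / (spline_interp_const + 1)).
  assert (HW : 0 < W) by (apply Rdiv_lt_0_compat; lra).
  assert (Hunif : exists delta, 0 < delta /\ forall i s t, (i < m)%nat -> a <= s <= b -> a <= t <= b ->
    Rabs (s - t) < delta -> Cmod (Cminus (nder a b n (y i) s) (nder a b n (y i) t)) <= W).
  (* Uniform continuity is available for each component separately; induction on [m] takes the
     smallest of finitely many deltas. *)
  { clear - hab Hy HW. unfold isClVec in Hy. induction m as [|m' IH].
    - exists 1. split; [lra|]. intros; lia.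
    - destruct IH as [d1 [Hd1 H1]]; [intros; apply Hy; lia|].
      destruct (cont_ab_uniform (nder a b n (y m')) (proj2 (Hy m' ltac:(lia))) W HW) as [d2 [Hd2 H2]].
      exists (Rmin d1 d2). split; [now apply Rmin_glb_lt|]. intros i s t Hi Hs Ht Hst.
      destruct (Nat.eq_dec i m') as [->|Hne].
      + apply Rlt_le, H2; auto. eapply Rlt_le_trans; [exact Hst|apply Rmin_r].
      + apply H1; auto; [lia|]. eapply Rlt_le_trans; [exact Hst|apply Rmin_l]. }
  destruct Hunif as [delta [Hd H]].
  destruct (INR_archimed delta (b - a) Hd) as [K HK].
  exists K. intros k HKk Hk. apply Rle_lt_trans with (spline_interp_const * W).
  - apply spline_interp_error; auto. intros i s t Hi Hs Ht Hst. apply H; auto.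
    eapply Rle_lt_trans; [exact Hst|].
    assert (0 < INR k) by (apply lt_0_INR; lia). assert (INR K <= INR k) by now apply le_INR.
    apply (Rmult_lt_reg_r (INR k)); [assumption|].
    replace ((b - a) / INR k * INR k) with (b - a) by (field; lra). nra.
  - assert (E : W * (spline_interp_const + 1) = eps) by (unfold W; field; lra). nra.
Qed.

End Interpolation.

Lemma qnorm_comb M N c (v : nat -> nat -> C) :
  qnorm M (fun i => csum N (fun k => Cmult (c k) (v k i))) <= rsum N (fun k => Cmod (c k) * qnorm M (v k)).
Proof.
  induction N as [|N IH].
  - simpl. unfold qnorm. rewrite (rsum_ext _ _ (fun _ => 0)) by (intros; apply Cmod_0).
    rewrite rsum_const. lra.
  - simpl rsum. eapply Rle_trans; [|apply Rplus_le_compat_r, IH].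
    unfold qnorm. rewrite <- rsum_lin. apply rsum_le. intros i _. simpl csum.
    eapply Rle_trans; [apply Cmod_triangle|]. rewrite Cmod_mult. lra.
Qed.

(** * Perturbation of a boundary-value problem *)

Section Perturbation.

Context (a b : R) (hab : a < b) (n r m : nat) (hrn : (1 <= r <= n)%nat).
Context (A A' : nat -> mfun)
  (hA : forall j, (j < r)%nat -> isClMat a b (n - r) m (A j))
  (hA' : forall j, (j < r)%nat -> isClMat a b (n - r) m (A' j)).
Context (B B' : vfun -> nat -> C)
  (hBlin' : forall y z c, isClVec a b n m y -> isClVec a b n m z ->
     forall i, (i < r * m)%nat -> B' (vlin y c z) i = Cplus (B' y i) (Cmult c (B' z i)))
  (hBbound' : exists K, 0 <= K /\ forall y, isClVec a b n m y ->
     qnorm (r * m) (B' y) <= K * normClVec a b n m y).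
Context (hsol : forall (f : vfun) (q : nat -> C), isClVec a b (n - r) m f ->
     exists y, isClVec a b n m y /\ solves_ode a b r m A f y /\
       forall i, (i < r * m)%nat -> B y i = q i).
Context (K : R) (hK0 : 0 <= K) (hK : forall y, isClVec a b n m y ->
  normClVec a b n m y <= K * (normClVec a b (n - r) m (ode_lhs a b r m A y) + qnorm (r * m) (B y))).

(* The differential equation and the boundary data are weighted differently: the boundary
   perturbation is only strongly small, and a large lam absorbs its norm on zero boundary data. *)
Context (lam : R) (hlam : 1 <= lam).

Definition data_norm (A : nat -> mfun) (B : vfun -> nat -> C) (y : vfun) : R :=
  lam * normClVec a b (n - r) m (ode_lhs a b r m A y) + qnorm (r * m) (B y).

Context (hcontr : forall y, isClVec a b n m y ->
  lam * normClVec a b (n - r) m (vsub (ode_lhs a b r m A y) (ode_lhs a b r m A' y)) +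
  qnorm (r * m) (fun i => Cminus (B y i) (B' y i)) <= / 2 * data_norm A B y).

Lemma norm_le_data_norm y : isClVec a b n m y -> normClVec a b n m y <= K * data_norm A B y.
Proof.
  intros Hy. eapply Rle_trans; [now apply hK|]. apply Rmult_le_compat_l; [exact hK0|].
  assert (H := normClVec_ge0 a b hab m (n - r) _ (ode_lhs_isCl a b hab m r (proj1 hrn) n A y (proj2 hrn) hA Hy)).
  unfold data_norm. nra.
Qed.

(** By the triangle inequality the unperturbed data norm is at most the perturbed one plus half of
    itself; absorbing that half gives the factor 2. *)
Lemma perturbed_estimate y : isClVec a b n m y ->
  normClVec a b n m y <= 2 * K * data_norm A' B' y.
Proof.
  intros Hy. eapply Rle_trans; [now apply norm_le_data_norm|].
  assert (HL := ode_lhs_isCl a b hab m r (proj1 hrn) n A y (proj2 hrn) hA Hy).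
  assert (HL' := ode_lhs_isCl a b hab m r (proj1 hrn) n A' y (proj2 hrn) hA' Hy).
  assert (H := hcontr y Hy).
  assert (H1 : normClVec a b (n - r) m (ode_lhs a b r m A y) <= 
     normClVec a b (n - r) m (vsub (ode_lhs a b r m A y) (ode_lhs a b r m A' y)) +
     normClVec a b (n - r) m (ode_lhs a b r m A' y)).
  { rewrite (normClVec_ext a b m (n - r) (ode_lhs a b r m A y)
      (vlin (vsub (ode_lhs a b r m A y) (ode_lhs a b r m A' y)) (RtoC 1) (ode_lhs a b r m A' y)))
      by (intros; unfold vlin, vsub; ring).
    eapply Rle_trans; [apply normClVec_lin; auto; now apply isClVec_sub|].
    rewrite Cmod_1. lra. }
  assert (H2 : qnorm (r * m) (B y) <= qnorm (r * m) (fun i => Cminus (B y i) (B' y i)) + qnorm (r * m) (B' y)).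
  { unfold qnorm. rewrite <- (Rmult_1_l (rsum (r * m) (fun i => Cmod (B' y i)))), <- rsum_lin.
    apply rsum_le. intros i _. rewrite Rmult_1_l.
    replace (B y i) with (Cplus (Cminus (B y i) (B' y i)) (B' y i)) at 1 by ring. apply Cmod_triangle. }
  assert (H3 : data_norm A B y <= 2 * data_norm A' B' y).
  { unfold data_norm in *.
    assert (lam * normClVec a b (n - r) m (ode_lhs a b r m A y) <= lam *
      (normClVec a b (n - r) m (vsub (ode_lhs a b r m A y) (ode_lhs a b r m A' y)) +
       normClVec a b (n - r) m (ode_lhs a b r m A' y))) by (apply Rmult_le_compat_l; lra).
    lra. }
  nra.
Qed.

(* Neumann series: the correction solves the unperturbed problem for the residual of the
   previous term, so the data norms of the corrections decay geometrically. *)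
Lemma perturbed_solvable f q : isClVec a b (n - r) m f ->
  exists y, isClVec a b n m y /\ solves_ode a b r m A' f y /\
    forall i, (i < r * m)%nat -> B' y i = q i.
Proof.
  intros Hf.
  destruct (hsol f q Hf) as [u0 [Hu0 [Hode0 Hbc0]]].
  (* The hypothesis on u sits inside the existential so that the correction is a total map, which
     can be iterated. *)
  assert (Hn : forall u, exists v, isClVec a b n m u -> isClVec a b n m v /\
    solves_ode a b r m A (vsub (ode_lhs a b r m A u) (ode_lhs a b r m A' u)) v /\
    forall i, (i < r * m)%nat -> B v i = Cminus (B u i) (B' u i)).
  { intros u. destruct (excluded_middle_informative (isClVec a b n m u)) as [Hu|Hu].
    - destruct (hsol (vsub (ode_lhs a b r m A u) (ode_lhs a b r m A' u)) (fun i => Cminus (B u i) (B' u i)))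
        as [v Hv].
      + apply isClVec_sub; [exact hab| |]; apply ode_lhs_isCl; auto; lia.
      + now exists v.
    - exists vzero. contradiction. }
  set (nxt := fun u => proj1_sig (constructive_indefinite_description _ (Hn u))).
  assert (Hnxt : forall u, isClVec a b n m u -> isClVec a b n m (nxt u) /\
    solves_ode a b r m A (vsub (ode_lhs a b r m A u) (ode_lhs a b r m A' u)) (nxt u) /\
    forall i, (i < r * m)%nat -> B (nxt u) i = Cminus (B u i) (B' u i)).
  { intros u. unfold nxt. apply proj2_sig. }
  set (U := fun J => Nat.iter J nxt u0).
  assert (HU : forall J, isClVec a b n m (U J)).
  { intros J. induction J as [|J IH]; [exact Hu0|]. simpl. now apply Hnxt. }
  set (W := data_norm A B u0).
  assert (HW : forall J, data_norm A B (U J) <= W * (/ 2) ^ J).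
  { intros J. induction J as [|J IH].
    - unfold U, W. simpl. lra.
    - destruct (Hnxt (U J) (HU J)) as [_ [H1 H2]].
      assert (E : data_norm A B (U (S J)) =
        lam * normClVec a b (n - r) m (vsub (ode_lhs a b r m A (U J)) (ode_lhs a b r m A' (U J))) +
        qnorm (r * m) (fun i => Cminus (B (U J) i) (B' (U J) i))).
      { unfold data_norm. f_equal; [f_equal; apply normClVec_ext; exact (fun i t Hi Ht => H1 i Hi t Ht)|].
        apply qnorm_ext. exact H2. }
      rewrite E. eapply Rle_trans; [now apply hcontr|]. simpl. lra. }
  set (Y := fun J => vcomb J (fun _ => RtoC 1) U).
  assert (HY : forall J, isClVec a b n m (Y J)) by (intros; apply isClVec_comb; auto).
  (* Consecutive partial sums differ by [U J], whose norm is at most K W 2^(-J). *)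
  destruct (isClVec_complete a b hab m n Y (K * W)) as [z [Hz Hlim]].
  { exact HY. }
  { intros J. rewrite (normClVec_ext a b m n _ (U J)).
    - eapply Rle_trans; [now apply norm_le_data_norm|]. rewrite Rmult_assoc.
      apply Rmult_le_compat_l; auto.
    - intros i t _ _. unfold Y. rewrite vcomb_S. unfold vsub, vlin. ring. }
  set (Cz := INR m * (INR (S n) * (2 * (K * W)))) in Hlim.
  (* The invariant of the series, for the equation here and for the boundary condition in [HBY]: the
     J-th partial sum misses the prescribed data exactly by the unperturbed data of [U J], which
     tend to 0. *)
  assert (HLY : forall J i t, (i < m)%nat -> a <= t <= b ->
    ode_lhs a b r m A' (Y J) i t = Cminus (f i t) (ode_lhs a b r m A (U J) i t)).
  { intros J. induction J as [|J IH]; intros i t Hi Ht.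
    - unfold Y. rewrite (ode_lhs_comb a b hab m r (proj1 hrn) n) by (auto; try lia; intros; lia).
      unfold U. simpl. rewrite (Hode0 i Hi t Ht). ring.
    - unfold Y. rewrite vcomb_S. fold (Y J).
      rewrite (ode_lhs_lin a b hab m r (proj1 hrn) n) by (auto; lia). rewrite IH by auto.
      change (U (S J)) with (nxt (U J)).
      rewrite (proj1 (proj2 (Hnxt (U J) (HU J))) i Hi t Ht). unfold vsub. ring. }
  assert (HBY : forall J i, (i < r * m)%nat -> B' (Y J) i = Cminus (q i) (B (U J) i)).
  { intros J. induction J as [|J IH]; intros i Hi.
    - unfold Y. rewrite (boundary_comb a b hab n m (r * m) B' hBlin') by (auto; intros; lia).
      unfold U. simpl. rewrite Hbc0 by auto. ring.
    - unfold Y. rewrite vcomb_S. fold (Y J). rewrite hBlin' by auto. rewrite IH by auto.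
      change (U (S J)) with (nxt (U J)).
      rewrite (proj2 (proj2 (Hnxt (U J) (HU J))) i Hi). ring. }
  assert (Hd0 : forall J, 0 <= normClVec a b (n - r) m (ode_lhs a b r m A (U J))).
  { intros J. apply normClVec_ge0; [exact hab|]. apply ode_lhs_isCl; auto; lia. }
  exists z. split; [exact Hz|]. split.
  - destruct (ode_lhs_bound a b hab m r (proj1 hrn) n A' (proj2 hrn) hA') as [KL [HKL0 HKL]].
    assert (HLz := ode_lhs_isCl a b hab m r (proj1 hrn) n A' z (proj2 hrn) hA' Hz).
    assert (H0 : normClVec a b (n - r) m (vsub (ode_lhs a b r m A' z) f) <= 0).
    { apply (le_of_half_pow _ _ (KL * Cz + W)). intros J.
      set (D := vsub z (Y J)).
      assert (HD : isClVec a b n m D) by now apply isClVec_sub.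
      rewrite (normClVec_ext a b m (n - r) _ (vsub (ode_lhs a b r m A' D) (ode_lhs a b r m A (U J)))).
      - eapply Rle_trans; [apply normClVec_sub; auto; apply ode_lhs_isCl; auto; lia|].
        assert (H1 := HKL D HD). assert (H2 := HW J). assert (H3 := Hlim J). fold D in H3.
        unfold data_norm in H2. assert (H4 := qnorm_ge0 (r * m) (B (U J))). assert (H5 := Hd0 J).
        assert (KL * normClVec a b n m D <= KL * (Cz * (/ 2) ^ J)) by now apply Rmult_le_compat_l.
        nra.
      - intros i t Hi Ht. unfold vsub at 1 2, D. rewrite vsub_vlin.
        rewrite (ode_lhs_lin a b hab m r (proj1 hrn) n) by (auto; lia). rewrite HLY by auto. ring. }
    intros i Hi t Ht.
    assert (E := normClVec_le0 a b hab m (n - r) _ (isClVec_sub a b hab m (n - r) _ _ HLz Hf) H0 i t Hi Ht).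
    unfold vsub in E. replace (ode_lhs a b r m A' z i t) with
      (Cplus (Cminus (ode_lhs a b r m A' z i t) (f i t)) (f i t)) by ring. rewrite E. ring.
  - intros i Hi. destruct hBbound' as [KB [HKB0 HKB]].
    assert (E : Cminus (B' z i) (q i) = RtoC 0).
    { apply Cmod_eq_0, Rle_antisym; [|apply Cmod_ge_0].
      apply (le_of_half_pow _ _ (KB * Cz + W)). intros J.
      set (D := vsub z (Y J)).
      assert (HD : isClVec a b n m D) by now apply isClVec_sub.
      replace (Cminus (B' z i) (q i)) with (Cminus (B' D i) (B (U J) i)).
      - eapply Rle_trans; [apply Cmod_minus_le|].
        assert (H1 := HKB D HD). assert (H2 := HW J). assert (H3 := Hlim J). fold D in H3.
        assert (H4 := qnorm_term (r * m) (B (U J)) i Hi). assert (H5 := Hd0 J).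
        assert (H6 := qnorm_term (r * m) (B' D) i Hi). unfold data_norm in H2.
        assert (KB * normClVec a b n m D <= KB * (Cz * (/ 2) ^ J)) by now apply Rmult_le_compat_l.
        nra.
      - unfold D. rewrite (boundary_sub a b n m (r * m) B' hBlin') by auto. rewrite HBY by auto. ring. }
    replace (B' z i) with (Cplus (Cminus (B' z i) (q i)) (q i)) by ring. rewrite E. ring.
Qed.

Lemma perturbed_unique f q y z : isClVec a b n m y -> isClVec a b n m z ->
  solves_ode a b r m A' f y -> solves_ode a b r m A' f z ->
  (forall i, (i < r * m)%nat -> B' y i = q i) -> (forall i, (i < r * m)%nat -> B' z i = q i) ->
  forall i t, (i < m)%nat -> a <= t <= b -> z i t = y i t.
Proof.
  intros Hy Hz Hly Hlz Hby Hbz i t Hi Ht.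
  assert (HD : isClVec a b n m (vsub z y)) by now apply isClVec_sub.
  assert (H0 : normClVec a b n m (vsub z y) <= 0).
  { eapply Rle_trans; [now apply perturbed_estimate|]. unfold data_norm.
    rewrite (normClVec_ext a b m (n - r) _ vzero).
    - rewrite normClVec_zero by exact hab. rewrite (qnorm_ext _ _ (fun _ => RtoC 0)).
      + unfold qnorm. rewrite rsum_const, Cmod_0. lra.
      + intros k Hk. rewrite (boundary_sub a b n m (r * m) B' hBlin'), Hby, Hbz by auto. ring.
    - intros k s Hk Hs. rewrite vsub_vlin, (ode_lhs_lin a b hab m r (proj1 hrn) n) by (auto; lia).
      rewrite (Hly k Hk s Hs), (Hlz k Hk s Hs). unfold vzero. ring. }
  assert (E := normClVec_le0 a b hab m n _ HD H0 i t Hi Ht). unfold vsub in E.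
  replace (z i t) with (Cplus (Cminus (z i t) (y i t)) (y i t)) by ring. rewrite E. ring.
Qed.

End Perturbation.

(** * Multipoint boundary operators *)

Section Multipoint.

Context (a b : R) (hab : a < b) (n m N : nat).
Context (B : vfun -> nat -> C)
  (hBlin : forall y z c, isClVec a b n m y -> isClVec a b n m z ->
     forall i, (i < N)%nat -> B (vlin y c z) i = Cplus (B y i) (Cmult c (B z i))).

(** B composed with spline interpolation, expanded by linearity. Column s of the matrix for (j, l)
    is B of the basis function placed in component s, so the coefficients depend on k and B
    alone. *)
Definition multipoint (k : nat) (y : vfun) (i : nat) : C :=
  csum (S k) (fun j => csum (S n) (fun l => csum m (fun s =>
    Cmult (B (unit_vec s (interp_basis a b n k j l)) i) (nder a b l (y s) (node a b k j))))).

Lemma multipoint_interp k y i : (i < N)%nat -> multipoint k y i = B (spline_interp a b n m k y) i.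
Proof.
  intros Hi. unfold spline_interp, multipoint.
  assert (Hb : forall k j l s, isClVec a b n m (unit_vec s (interp_basis a b n k j l))).
  { intros. apply unit_vec_isCl; [exact hab|]. now apply interp_basis_isCl. }
  rewrite (boundary_comb a b hab n m N B hBlin); [|intros; apply isClVec_comb; auto; intros; apply isClVec_comb; auto|exact Hi].
  apply csum_ext. intros j _. rewrite Cmult_1_l.
  rewrite (boundary_comb a b hab n m N B hBlin); [|intros; apply isClVec_comb; auto|exact Hi].
  apply csum_ext. intros l _. rewrite Cmult_1_l.
  rewrite (boundary_comb a b hab n m N B hBlin); auto.
  apply csum_ext. intros s _. ring.
Qed.

Lemma multipoint_lin k y z c i : (1 <= k)%nat -> isClVec a b n m y -> isClVec a b n m z ->
  multipoint k (vlin y c z) i = Cplus (multipoint k y i) (Cmult c (multipoint k z i)).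
Proof.
  intros Hk Hy Hz. unfold multipoint. rewrite <- csum_lin. apply csum_ext. intros j Hj.
  rewrite <- csum_lin. apply csum_ext. intros l Hl. rewrite <- csum_lin. apply csum_ext. intros s Hs.
  unfold vlin. rewrite (nder_lin a b hab n); auto; [ring|lia|]. apply node_in; auto; lia.
Qed.

(** The two boundary values differ by B of the interpolation error, so boundedness of B transfers
    both the uniform bound and the convergence of the interpolants. *)
Lemma multipoint_error k y Kb : (1 <= k)%nat -> isClVec a b n m y ->
  (forall y, isClVec a b n m y -> qnorm N (B y) <= Kb * normClVec a b n m y) ->
  qnorm N (fun i => Cminus (B y i) (multipoint k y i)) <= Kb * normClVec a b n m (vsub (spline_interp a b n m k y) y).
Proof.
  intros Hk Hy HB. assert (HI := spline_interp_isCl a b hab n m k y).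
  eapply Rle_trans; [|apply HB; now apply isClVec_sub].
  apply rsum_le. intros i Hi. rewrite (boundary_sub a b n m N B hBlin) by auto.
  rewrite multipoint_interp by auto. rewrite Cmod_minus_sym. lra.
Qed.

End Multipoint.

(** * Contraction estimate for the multipoint problems *)

Lemma isClMat_sub a b l m M M' : a < b -> isClMat a b l m M -> isClMat a b l m M' ->
  isClMat a b l m (msub M M').
Proof.
  intros hab HM HM' i j Hi Hj.
  apply (isCl_ext a b l (fun t => Cplus (M i j t) (Cmult (Copp (RtoC 1)) (M' i j t)))).
  - intros t _. unfold msub. ring.
  - apply isCl_lin; auto.
Qed.

Lemma harmonic_small c eps : 0 < eps -> exists K, forall k, (K <= k)%nat -> c * / (INR k + 1) < eps.
Proof.
  intros Heps. destruct (INR_archimed eps c Heps) as [K HK]. exists K. intros k Hk.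
  assert (H0 := pos_INR k). assert (H1 : INR K <= INR k) by now apply le_INR.
  apply (Rmult_lt_reg_r (INR k + 1)); [lra|].
  rewrite Rmult_assoc, Rinv_l by lra. nra.
Qed.

Lemma eventually_all N (P : nat -> nat -> Prop) :
  (forall i, (i < N)%nat -> exists K, forall k, (K <= k)%nat -> P i k) ->
  exists K, forall k, (K <= k)%nat -> forall i, (i < N)%nat -> P i k.
Proof.
  induction N as [|N IH]; intros H; [exists 0%nat; intros; lia|].
  destruct IH as [K1 H1]; [intros; apply H; lia|]. destruct (H N ltac:(lia)) as [K2 H2].
  exists (K1 + K2)%nat. intros k Hk i Hi. destruct (Nat.eq_dec i N) as [->|Hne].
  - apply H2. lia.
  - apply H1; lia.
Qed.

(* On a general y, split off the combination of the basis h of the kernel with the same boundary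
   values: the rest is bounded by the differential equation alone. *)
Lemma multipoint_perturbation a b n r m A A' B (h : nat -> vfun) K Kb e k : a < b ->
  (1 <= r <= n)%nat -> (1 <= k)%nat ->
  (forall j, (j < r)%nat -> isClMat a b (n - r) m (A j)) ->
  (forall j, (j < r)%nat -> isClMat a b (n - r) m (A' j)) ->
  (forall y z c, isClVec a b n m y -> isClVec a b n m z ->
     forall i, (i < r * m)%nat -> B (vlin y c z) i = Cplus (B y i) (Cmult c (B z i))) ->
  0 <= K -> 0 <= Kb -> 0 <= e ->
  (forall y, isClVec a b n m y -> qnorm (r * m) (B y) <= Kb * normClVec a b n m y) ->
  (forall y, isClVec a b n m y -> normClVec a b n m y <=
     K * (normClVec a b (n - r) m (ode_lhs a b r m A y) + qnorm (r * m) (B y))) ->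
  (forall k, (k < r * m)%nat -> isClVec a b n m (h k)) ->
  (forall k, (k < r * m)%nat -> solves_ode a b r m A vzero (h k)) ->
  (forall k, (k < r * m)%nat -> forall i, (i < r * m)%nat ->
     B (h k) i = if Nat.eqb i k then RtoC 1 else RtoC 0) ->
  let D := Kb * (spline_interp_const a b n m * 2) in
  let lam := 4 * D * K + 1 in
  (forall j, (j < r)%nat -> normClMat a b (n - r) m (msub (A j) (A' j)) <= e) ->
  lam * (lower_const m r (n - r) * K) * e <= / 4 ->
  (forall k', (k' < r * m)%nat ->
     qnorm (r * m) (fun i => Cminus (B (h k') i) (multipoint a b n m B k (h k') i)) <= / 4) ->
  forall y, isClVec a b n m y ->
  lam * normClVec a b (n - r) m (vsub (ode_lhs a b r m A y) (ode_lhs a b r m A' y)) +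
  qnorm (r * m) (fun i => Cminus (B y i) (multipoint a b n m B k y i)) <=
  / 2 * data_norm a b n r m lam A B y.
Proof.
  intros hab hrn Hk hA hA' hBlin HK0 HKb0 He0 HB HK hcl hode hbc D lam He Hlam Hh y Hy.
  assert (HD : 0 <= D).
  { unfold D. apply Rmult_le_pos; [exact HKb0|]. assert (H := spline_interp_const_ge0 a b hab n m). lra. }
  assert (HDK : 0 <= D * K) by now apply Rmult_le_pos.
  assert (Hlc := lower_const_ge0 m r (n - r)).
  set (w := vcomb (r * m) (B y) h). set (u := vlin y (Copp (RtoC 1)) w).
  assert (Hw : isClVec a b n m w) by now apply isClVec_comb.
  assert (Hu : isClVec a b n m u) by now apply isClVec_lin.
  set (F := normClVec a b (n - r) m (ode_lhs a b r m A y)). set (Q := qnorm (r * m) (B y)).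
  assert (HF : 0 <= F) by (apply normClVec_ge0; [exact hab|]; apply ode_lhs_isCl; auto; lia).
  assert (HQ : 0 <= Q) by apply qnorm_ge0.
  (* [u] has the equation data of y and zero boundary data, so Q disappears from its bound. *)
  assert (Hun : normClVec a b n m u <= K * F).
  { eapply Rle_trans; [now apply HK|]. apply Req_le. f_equal.
    rewrite (normClVec_ext a b m (n - r) _ (ode_lhs a b r m A y)).
    - rewrite (qnorm_ext _ _ (fun _ => RtoC 0)).
      + unfold qnorm. rewrite rsum_const, Cmod_0. unfold F. ring.
      + intros i Hi. unfold u. rewrite hBlin by auto. unfold w.
        rewrite (boundary_basis a b hab n r m B hBlin h hcl hbc) by auto. ring.
    - intros i t Hi Ht. unfold u. rewrite (ode_lhs_lin a b hab m r (proj1 hrn) n) by (auto; lia).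
      unfold w. rewrite (ode_basis a b hab n r m hrn A h hcl hode (B y) i Hi t Ht).
      unfold vzero. ring. }
  assert (HBu : qnorm (r * m) (fun i => Cminus (B u i) (multipoint a b n m B k u i)) <= D * (K * F)).
  { eapply Rle_trans; [now apply (multipoint_error a b hab n m (r * m) B hBlin k u Kb)|].
    unfold D. rewrite (Rmult_assoc Kb). apply Rmult_le_compat_l; [exact HKb0|].
    eapply Rle_trans; [now apply spline_interp_bound|]. apply Rmult_le_compat_l; [|exact Hun].
    assert (H := spline_interp_const_ge0 a b hab n m). lra. }
  assert (HMcomb : forall i, multipoint a b n m B k w i =
    csum (r * m) (fun k' => Cmult (B y k') (multipoint a b n m B k (h k') i))).
  { intros i. unfold w. generalize (B y). intros c. 
    assert (Hind : forall M, (M <= r * m)%nat -> multipoint a b n m B k (vcomb M c h) i =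
      csum M (fun k' => Cmult (c k') (multipoint a b n m B k (h k') i))).
    { intros M. induction M as [|M IH]; intros HM.
      - unfold multipoint. simpl csum at 4. apply csum_zero. intros j Hj. apply csum_zero. intros l Hl.
        apply csum_zero. intros s Hs. change (vcomb 0 c h s) with (fun _ : R => RtoC 0).
        rewrite nder_zero; [ring|exact hab|]. apply node_in; auto; lia.
      - rewrite vcomb_S, (multipoint_lin a b hab n m B); [|exact Hk|apply isClVec_comb; auto; intros; apply hcl; lia|apply hcl; lia].
        rewrite IH by lia. reflexivity. }
    now apply Hind. }
  assert (HBw : qnorm (r * m) (fun i => Cminus (B w i) (multipoint a b n m B k w i)) <= Q * / 4).
  { rewrite (qnorm_ext _ _ (fun i => csum (r * m) (fun k' => Cmult (B y k')
       (Cminus (B (h k') i) (multipoint a b n m B k (h k') i))))).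
    - eapply Rle_trans; [apply (qnorm_comb (r * m) (r * m) (B y)
         (fun k' i => Cminus (B (h k') i) (multipoint a b n m B k (h k') i)))|].
      unfold Q, qnorm at 2. rewrite Rmult_comm, <- rsum_scal. apply rsum_le. intros k' Hk'.
      rewrite (Rmult_comm (/ 4)). apply Rmult_le_compat_l; [apply Cmod_ge_0|auto].
    - intros i Hi. rewrite HMcomb. unfold w.
      rewrite (boundary_comb a b hab n m (r * m) B hBlin) by auto. rewrite <- csum_minus.
      apply csum_ext. intros k' _. ring. }
  assert (HBy : qnorm (r * m) (fun i => Cminus (B y i) (multipoint a b n m B k y i)) <= D * (K * F) + Q * / 4).
  { eapply Rle_trans; [|apply Rplus_le_compat; [exact HBu|exact HBw]].
    unfold qnorm. rewrite <- (Rmult_1_l (rsum (r * m) (fun i => Cmod (Cminus (B w i) _)))), <- rsum_lin.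
    apply rsum_le. intros i Hi. rewrite Rmult_1_l. unfold u.
    rewrite hBlin, (multipoint_lin a b hab n m B) by auto.
    eapply Rle_trans; [|apply Cmod_triangle]. apply Req_le. f_equal. ring. }
  assert (HE : normClVec a b (n - r) m (vsub (ode_lhs a b r m A y) (ode_lhs a b r m A' y)) <=
     lower_const m r (n - r) * e * (K * (F + Q))).
  { eapply Rle_trans; [apply (ode_lhs_diff_bound a b hab m r (proj1 hrn) n A A' e y); auto; try lia|].
    - intros j Hj. apply isClMat_sub; auto.
    - apply Rmult_le_compat_l; [now apply Rmult_le_pos|]. now apply HK. }
  assert (HE' : lam * normClVec a b (n - r) m (vsub (ode_lhs a b r m A y) (ode_lhs a b r m A' y)) <= / 4 * (F + Q)).
  { apply Rle_trans with (lam * (lower_const m r (n - r) * e * (K * (F + Q)))).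
    - apply Rmult_le_compat_l; [unfold lam; lra|exact HE].
    - replace (lam * (lower_const m r (n - r) * e * (K * (F + Q)))) with
        (lam * (lower_const m r (n - r) * K) * e * (F + Q)) by ring.
      apply Rmult_le_compat_r; [lra|exact Hlam]. }
  unfold data_norm. fold F Q.
  (* Final balance: (F + Q)/4 from the equation, D K F + Q/4 from the boundary. Since 4 D K F = (lam
     - 1) F, the sum is lam F / 4 + Q / 2. *)
  assert (HlF : F + 4 * (D * K * F) = lam * F) by (unfold lam; ring).
  assert (0 <= D * K * F) by now apply Rmult_le_pos.
  lra.
Qed.

(** * Multipoint approximation of the boundary-value problem *)

Theorem theorem1
  (a b : R) (n r m : nat)
  (hab : a < b) (hrn : (1 <= r <= n)%nat) (hm : (1 <= m)%nat)
  (* A j = A_j, j = r - l, 0 <= j <= r-1, an m x m matrix function *)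
  (A : nat -> mfun)
  (hA : forall j, (j < r)%nat -> isClMat a b (n - r) m (A j))
  (* B : (C^(n))^m -> C^(rm), components indexed by i < r*m *)
  (B : vfun -> nat -> C)
  (hBlin : forall y z c, isClVec a b n m y -> isClVec a b n m z ->
     forall i, (i < r * m)%nat -> B (vlin y c z) i = Cplus (B y i) (Cmult c (B z i)))
  (hBcont : forall y, isClVec a b n m y -> forall eps, 0 < eps ->
     exists delta, 0 < delta /\ forall z, isClVec a b n m z ->
       normClVec a b n m (vsub z y) < delta ->
       forall i, (i < r * m)%nat -> Cmod (Cminus (B z i) (B y i)) < eps)
  (* unique solvability of the original boundary-value problem *)
  (huniq : forall (f : vfun) (q : nat -> C), isClVec a b (n - r) m f ->
     exists y, isClVec a b n m y /\ solves_ode a b r m A f y /\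
       (forall i, (i < r * m)%nat -> B y i = q i) /\
       forall z, isClVec a b n m z -> solves_ode a b r m A f z ->
         (forall i, (i < r * m)%nat -> B z i = q i) ->
         forall i, (i < m)%nat -> forall t, a <= t <= b -> z i t = y i t)
  (* a dense subset of (C^(n-r))^(m x m) *)
  (X : mfun -> Prop)
  (hXsub : forall M, X M -> isClMat a b (n - r) m M)
  (hXdense : forall M, isClMat a b (n - r) m M -> forall eps, 0 < eps ->
     exists M', X M' /\ normClMat a b (n - r) m (msub M M') < eps) :
  (* Ak k j = A_{j,k};  p k = p_k;  tk k j = t_{k,j};
     beta k j l = beta_k^{j,l}, an (r m) x m complex matrix *)
  exists (Ak : nat -> nat -> mfun) (p : nat -> nat) (tk : nat -> nat -> R)
         (beta : nat -> nat -> nat -> nat -> nat -> C),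
    (forall k, (1 <= k)%nat -> forall j, (j < r)%nat -> X (Ak k j)) /\
    (forall k, (1 <= k)%nat -> forall j, (1 <= j <= p k)%nat -> a <= tk k j <= b) /\
    let bc (k : nat) (y : vfun) (q : nat -> C) : Prop :=
      forall i, (i < r * m)%nat ->
        csum (p k) (fun j' => let j := S j' in
          csum (S n) (fun l =>
            csum m (fun s => Cmult (beta k j l i s) (nder a b l (y s) (tk k j))))) = q i in
    exists k0, (1 <= k0)%nat /\
      (forall k, (k0 <= k)%nat -> forall (f : vfun) (q : nat -> C),
         isClVec a b (n - r) m f ->
         exists yk, isClVec a b n m yk /\ solves_ode a b r m (Ak k) f yk /\ bc k yk q /\
           forall z, isClVec a b n m z -> solves_ode a b r m (Ak k) f z -> bc k z q ->
             forall i, (i < m)%nat -> forall t, a <= t <= b -> z i t = yk i t) /\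
      (forall (f : vfun) (q : nat -> C) (y : vfun) (yk : nat -> vfun),
         isClVec a b (n - r) m f ->
         isClVec a b n m y -> solves_ode a b r m A f y ->
         (forall i, (i < r * m)%nat -> B y i = q i) ->
         (forall k, (k0 <= k)%nat ->
            isClVec a b n m (yk k) /\ solves_ode a b r m (Ak k) f (yk k) /\ bc k (yk k) q) ->
         forall eps, 0 < eps -> exists K, (k0 <= K)%nat /\
           forall k, (K <= k)%nat -> normClVec a b n m (vsub (yk k) y) < eps).
Proof.
  assert (hBbound := boundary_bounded a b hab n m (r * m) B hBlin hBcont).
  destruct hBbound as [Kb [HKb0 HKb]].
  assert (Hh : exists h : nat -> vfun, forall k, (k < r * m)%nat -> isClVec a b n m (h k) /\
    solves_ode a b r m A vzero (h k) /\
    forall i, (i < r * m)%nat -> B (h k) i = if Nat.eqb i k then RtoC 1 else RtoC 0).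
  { assert (Hex : forall k, exists y, isClVec a b n m y /\ solves_ode a b r m A vzero y /\
      forall i, (i < r * m)%nat -> B y i = if Nat.eqb i k then RtoC 1 else RtoC 0).
    { intros k. destruct (huniq vzero (fun i => if Nat.eqb i k then RtoC 1 else RtoC 0)) as [y [H1 [H2 [H3 _]]]].
      - now apply isClVec_zero.
      - now exists y. }
    exists (fun k => proj1_sig (constructive_indefinite_description _ (Hex k))).
    intros k _. apply proj2_sig. }
  destruct Hh as [h Hh].
  assert (hcl := fun k Hk => proj1 (Hh k Hk)).
  assert (hode := fun k Hk => proj1 (proj2 (Hh k Hk))).
  assert (hbc := fun k Hk => proj2 (proj2 (Hh k Hk))).
  destruct (inverse_bound a b hab n r m hrn A hA B hBlin (ex_intro _ Kb (conj HKb0 HKb)) h hcl hode hbc)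
    as [K [HK0 HK]].
  (* The tolerance [/ (INR k + 1)] tends to 0 and is positive for every k, including 0. *)
  assert (HX : exists Ak : nat -> nat -> mfun, forall k j, (j < r)%nat ->
    X (Ak k j) /\ normClMat a b (n - r) m (msub (A j) (Ak k j)) <= / (INR k + 1)).
  { assert (Hex : forall k j, exists M, (j < r)%nat -> X M /\
      normClMat a b (n - r) m (msub (A j) M) <= / (INR k + 1)).
    { intros k j. destruct (Nat.le_gt_cases r j) as [Hj|Hj]; [exists (A j); lia|].
      assert (H0 := pos_INR k).
      destruct (hXdense (A j) (hA j Hj) (/ (INR k + 1))) as [M [H1 H2]].
      - apply Rinv_0_lt_compat. lra.
      - exists M. intros _. split; [exact H1|lra]. }
    exists (fun k j => proj1_sig (constructive_indefinite_description _ (Hex k j))).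
    intros k j. exact (proj2_sig (constructive_indefinite_description _ (Hex k j))). }
  destruct HX as [Ak HAk].
  assert (hAk : forall k j, (j < r)%nat -> isClMat a b (n - r) m (Ak k j)).
  { intros k j Hj. apply hXsub. now apply HAk. }
  set (D := Kb * (spline_interp_const a b n m * 2)).
  set (lam := 4 * D * K + 1).
  assert (HD : 0 <= D).
  { unfold D. apply Rmult_le_pos; [exact HKb0|]. assert (H := spline_interp_const_ge0 a b hab n m). lra. }
  assert (Hlam : 1 <= lam).
  { assert (0 <= D * K) by now apply Rmult_le_pos. unfold lam. lra. }
  assert (Hlc := lower_const_ge0 m r (n - r)).
  destruct (harmonic_small (lam * (lower_const m r (n - r) * K)) (/ 4) ltac:(lra)) as [k1 Hk1].
  destruct (eventually_all (r * m) (fun k' k => (1 <= k)%nat ->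
     qnorm (r * m) (fun i => Cminus (B (h k') i) (multipoint a b n m B k (h k') i)) <= / 4)) as [k2 Hk2].
  { intros k' Hk'.
    (* After multiplication by [Kb] this tolerance stays below 1/4; the [+ 1] covers Kb = 0. *)
    destruct (spline_interp_converges a b hab n m (h k') (hcl k' Hk') (/ 4 * / (Kb + 1))) as [K' HK'].
    { apply Rmult_lt_0_compat; [lra|]. apply Rinv_0_lt_compat. lra. }
    exists K'. intros k Hk Hk0.
    eapply Rle_trans; [apply (multipoint_error a b hab n m (r * m) B hBlin k (h k') Kb Hk0); auto|].
    specialize (HK' k Hk Hk0). set (x := normClVec a b n m (vsub (spline_interp a b n m k (h k')) (h k'))) in *.
    assert (Kb * x <= Kb * (/ 4 * / (Kb + 1))) by (apply Rmult_le_compat_l; lra).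
    assert (Kb * (/ 4 * / (Kb + 1)) <= / 4); [|lra].
    apply (Rmult_le_reg_r (Kb + 1)); [lra|].
    replace (Kb * (/ 4 * / (Kb + 1)) * (Kb + 1)) with (Kb * / 4) by (field; lra). lra. }
  set (k0 := (1 + k1 + k2)%nat).
  assert (He0 : forall k, 0 < / (INR k + 1)).
  { intros k. apply Rinv_0_lt_compat. assert (H := pos_INR k). lra. }
  assert (Hcontr : forall k, (k0 <= k)%nat -> forall y, isClVec a b n m y ->
    lam * normClVec a b (n - r) m (vsub (ode_lhs a b r m A y) (ode_lhs a b r m (Ak k) y)) +
    qnorm (r * m) (fun i => Cminus (B y i) (multipoint a b n m B k y i)) <=
    / 2 * data_norm a b n r m lam A B y).
  { intros k Hk. unfold k0 in Hk.
    apply (multipoint_perturbation a b n r m A (Ak k) B h K Kb (/ (INR k + 1)) k); auto; try lia.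
    - apply Rlt_le, He0.
    - intros j Hj. now apply HAk.
    - apply Rlt_le, Hk1. lia.
    - intros k' Hk'. apply Hk2; auto; lia. }
  assert (Hmlin : forall k, (k0 <= k)%nat -> forall y z c, isClVec a b n m y -> isClVec a b n m z ->
     forall i, (i < r * m)%nat -> multipoint a b n m B k (vlin y c z) i =
       Cplus (multipoint a b n m B k y i) (Cmult c (multipoint a b n m B k z i))).
  { intros k Hk y z c Hy Hz i Hi. apply multipoint_lin; auto. unfold k0 in Hk. lia. }
  assert (hsol : forall (f : vfun) (q : nat -> C), isClVec a b (n - r) m f ->
     exists y, isClVec a b n m y /\ solves_ode a b r m A f y /\
       forall i, (i < r * m)%nat -> B y i = q i).
  { intros f q Hf. destruct (huniq f q Hf) as [y [H1 [H2 [H3 _]]]]. now exists y. }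
  (* There are k + 1 nodes, numbered from 0, while the points of the statement are numbered from 1;
     hence [S] for the number of points and [pred j] for the index. *)
  exists Ak, S, (fun k j => node a b k (pred j)),
    (fun k j l i s => B (unit_vec s (interp_basis a b n k (pred j) l)) i).
  split; [intros k _ j Hj; now apply HAk|].
  split; [intros k Hk j Hj; apply node_in; auto; lia|].
  intros bc.
  assert (Hbc : forall k y q, bc k y q <-> forall i, (i < r * m)%nat -> multipoint a b n m B k y i = q i).
  (* [pred (S j')] computes to [j'], so the two sums are convertible. *)
  { intros k y q. reflexivity. }
  exists k0. split; [unfold k0; lia|]. split.
  - intros k Hk f q Hf.
    assert (HmB : exists Km, 0 <= Km /\ forall y, isClVec a b n m y ->
      qnorm (r * m) (multipoint a b n m B k y) <= Km * normClVec a b n m y).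
    (* [Kb] for B and [D] for its deviation from the multipoint operator. *)
    { exists (Kb + D). split; [lra|]. intros y Hy.
      assert (H1 : qnorm (r * m) (fun i => Cminus (B y i) (multipoint a b n m B k y i)) <= D * normClVec a b n m y).
      { eapply Rle_trans; [apply (multipoint_error a b hab n m (r * m) B hBlin k y Kb); auto; unfold k0 in Hk; lia|].
        unfold D. rewrite (Rmult_assoc Kb). apply Rmult_le_compat_l; [exact HKb0|].
        apply spline_interp_bound; auto. unfold k0 in Hk. lia. }
      rewrite (qnorm_ext _ _ (fun i => Cminus (B y i) (Cminus (B y i) (multipoint a b n m B k y i))))
        by (intros; ring).
      eapply Rle_trans; [apply qnorm_minus|]. specialize (HKb y Hy). lra. }
    destruct (perturbed_solvable a b hab n r m hrn A (Ak k) hA (hAk k) B (multipoint a b n m B k)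
      (Hmlin k Hk) HmB hsol K HK0 HK lam Hlam (Hcontr k Hk) f q Hf) as [y [Hy [Hode Hq]]].
    exists y. split; [exact Hy|]. split; [exact Hode|]. split; [now apply Hbc|].
    intros z Hz Hodez Hqz i Hi t Ht.
    apply (perturbed_unique a b hab n r m hrn A (Ak k) hA (hAk k) B (multipoint a b n m B k)
      (Hmlin k Hk) K HK0 HK lam Hlam (Hcontr k Hk) f q y z); auto.
  - intros f q y yk Hf Hy Hode Hq Hyk eps Heps.
    set (c1 := 2 * K * (lam * (lower_const m r (n - r) * normClVec a b n m y))).
    destruct (harmonic_small c1 (eps / 2) ltac:(lra)) as [K1 HK1].
    assert (Hc2 : 0 <= 2 * K * Kb) by (apply Rmult_le_pos; lra).
    destruct (spline_interp_converges a b hab n m y Hy (eps / 2 * / (2 * K * Kb + 1))) as [K2 HK2].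
    { apply Rmult_lt_0_compat; [lra|]. apply Rinv_0_lt_compat. lra. }
    exists (k0 + K1 + K2)%nat. split; [lia|]. intros k Hk.
    destruct (Hyk k ltac:(lia)) as [Hykc [Hyko Hykb]]. rewrite Hbc in Hykb.
    assert (Hk0 : (1 <= k)%nat) by (unfold k0 in Hk; lia).
    specialize (HK1 k ltac:(lia)). specialize (HK2 k ltac:(lia) Hk0).
    assert (Hw : isClVec a b n m (vsub (yk k) y)) by now apply isClVec_sub.
    eapply Rle_lt_trans; [apply (perturbed_estimate a b hab n r m hrn A (Ak k) hA (hAk k) B
      (multipoint a b n m B k) K HK0 HK lam Hlam (Hcontr k ltac:(lia)) _ Hw)|].
    (* Both functions solve an equation with the same f, so L_k (y_k - y) = L y - L_k y: only the
       fixed function y enters, and convergence of the coefficients suffices. The boundary part [HQ]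
       is analogous and uses strong convergence at y. *)
    assert (HL : normClVec a b (n - r) m (ode_lhs a b r m (Ak k) (vsub (yk k) y)) <=
      lower_const m r (n - r) * / (INR k + 1) * normClVec a b n m y).
    { rewrite (normClVec_ext a b m (n - r) _ (vsub (ode_lhs a b r m A y) (ode_lhs a b r m (Ak k) y))).
      - apply (ode_lhs_diff_bound a b hab m r (proj1 hrn) n); auto; try lia.
        + intros j Hj. apply isClMat_sub; auto.
        + intros j Hj. now apply HAk.
        + apply Rlt_le, He0.
      - intros i t Hi Ht. rewrite vsub_vlin, (ode_lhs_lin a b hab m r (proj1 hrn) n) by (auto; lia).
        unfold vsub. rewrite (Hyko i Hi t Ht), (Hode i Hi t Ht). ring. }
    assert (HQ : qnorm (r * m) (multipoint a b n m B k (vsub (yk k) y)) <=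
      Kb * normClVec a b n m (vsub (spline_interp a b n m k y) y)).
    { eapply Rle_trans; [|apply (multipoint_error a b hab n m (r * m) B hBlin k y Kb Hk0 Hy HKb)].
      apply Req_le, qnorm_ext. intros i Hi.
      rewrite (boundary_sub a b n m (r * m) _ (Hmlin k ltac:(lia))) by auto.
      rewrite Hykb, Hq by auto. reflexivity. }
    set (x := normClVec a b n m (vsub (spline_interp a b n m k y) y)) in *.
    unfold data_norm.
    apply Rle_lt_trans with (c1 * / (INR k + 1) + 2 * K * Kb * x).
    + replace (c1 * / (INR k + 1) + 2 * K * Kb * x) with
        (2 * K * (lam * (lower_const m r (n - r) * / (INR k + 1) * normClVec a b n m y) + Kb * x))
        by (unfold c1; ring).
      apply Rmult_le_compat_l; [lra|]. apply Rplus_le_compat; [|exact HQ].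
      apply Rmult_le_compat_l; [lra|exact HL].
    + assert (2 * K * Kb * x <= 2 * K * Kb * (eps / 2 * / (2 * K * Kb + 1)))
        by (apply Rmult_le_compat_l; lra).
      assert (2 * K * Kb * (eps / 2 * / (2 * K * Kb + 1)) <= eps / 2); [|lra].
      apply (Rmult_le_reg_r (2 * K * Kb + 1)); [lra|].
      replace (2 * K * Kb * (eps / 2 * / (2 * K * Kb + 1)) * (2 * K * Kb + 1)) with (2 * K * Kb * (eps / 2))
        by (field; lra). nra.
Qed.
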